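(* Let $N\ge1$, let $\alpha>-1$ and let $\psi$ be an Orlicz function satisfying the $\Delta^2$-condition. For every holomorphic self-map $\phi$ of $\mathbb{B}_N$, $C_\phi$ is bounded on $A_\alpha^\psi(\mathbb{B}_N)$. Moreover $$\|C_\phi\|_{A_\alpha^\psi\to A_\alpha^\psi}\simeq\sup_{z\in\mathbb{B}_N}\frac{\psi^{-1}\left(\frac{1}{(1-|\phi(z)|)^{N+\alpha+1}}\right)}{\psi^{-1}\left(\frac{1}{(1-|z|)^{N+\alpha+1}}\right)}\simeq\sup_{z\in\mathbb{B}_N}\frac{\psi^{-1}\left(\frac{1}{1-|\phi(z)|}\right)}{\psi^{-1}\left(\frac{1}{1-|z|}\right)},$$ where $\simeq$ means two-sided estimates up to positive constants not depending on $\phi$.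
   Context: $\mathbb{B}_N$ is the open Euclidean unit ball of $\mathbb{C}^N$, $H(\mathbb{B}_N)$ is the space of holomorphic functions on it, and for $\alpha>-1$, $dv_\alpha=c_\alpha(1-|z|^2)^\alpha dv$ is the normalized (probability) weighted Lebesgue measure on $\mathbb{B}_N$. An Orlicz function is a strictly convex function $\psi:[0,\infty)\to[0,\infty)$ with $\psi(0)=0$, continuous at $0$, and with $\psi(x)/x\to+\infty$ as $x\to+\infty$; $\psi^{-1}$ is its inverse. $\psi$ satisfies the $\Delta^2$-condition if there is $C>0$ with $\psi(x)^2\le\psi(Cx)$ for all $x$ large enough. $A_\alpha^\psi(\mathbb{B}_N)$ is the space of $f\in H(\mathbb{B}_N)$ such that $\int_{\mathbb{B}_N}\psi(|f|/C)\,dv_\alpha<\infty$ for some $C>0$, with the Luxemburg norm $\|f\|_{A_\alpha^\psi}=\inf\{C>0:\int_{\mathbb{B}_N}\psi(|f|/C)\,dv_\alpha\le1\}$. The composition operator is $C_\phi f=f\circ\phi$. *)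

(* Defs.v *)
From HB Require Import structures.
From mathcomp Require Import all_boot all_order all_algebra.
From mathcomp Require Import all_classical all_reals all_analysis.
From mathcomp Require Import complex.

Set Implicit Arguments.
Unset Strict Implicit.
Unset Printing Implicit Defensive.

Import Order.TTheory GRing.Theory Num.Theory.
Import numFieldNormedType.Exports.

Local Open Scope classical_set_scope.
Local Open Scope complex_scope.
Local Open Scope ring_scope.

(* The library's sigma-finite structure on [m1 \x m2] is not inferred (it is
   shadowed by the one for subprobabilities), hence this lemma. *)
Lemma sigma_finite_product d1 d2 (T1 : measurableType d1)
    (T2 : measurableType d2) (R : realType)
    (m1 : {sigma_finite_measure set T1 -> \bar R})
    (m2 : {sigma_finite_measure set T2 -> \bar R}) :
  sigma_finite setT (m1 \x m2)%E.
Proof.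
have /sigma_finiteP[F [TF ndF Foo]] := sigma_finiteT m1.
have /sigma_finiteP[G [TG ndG Goo]] := sigma_finiteT m2.
exists (fun n => F n `*` G n).
  rewrite -setXTT TF TG predeqE => -[x y]; split.
    move=> [/= [n _ Fnx] [k _ Gky]]; exists (maxn n k) => //; split.
    - by move: x Fnx; exact/subsetPset/ndF/leq_maxl.
    - by move: y Gky; exact/subsetPset/ndG/leq_maxr.
  by move=> [n _ []/= ? ?]; split; exists n.
move=> k; have [? ?] := Foo k; have [? ?] := Goo k.
split; first exact: measurableX.
by rewrite product_measure1E// lte_mul_pinfty// ge0_fin_numE.
Qed.

Section cons_measure.
Local Open Scope ereal_scope.
Context d (T : measurableType d) (R : realType) (n : nat).
Variables (mu : {sigma_finite_measure set T -> \bar R})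
  (nu : {sigma_finite_measure set (n.-tuple T) -> \bar R}).

Definition cons_pair (p : T * n.-tuple T) : n.+1.-tuple T :=
  [tuple of p.1 :: p.2].

Lemma measurable_cons_pair : measurable_fun [set: T * n.-tuple T] cons_pair.
Proof. exact: measurable_cons measurable_fst measurable_snd. Qed.

Definition cons_measure : set (n.+1.-tuple T) -> \bar R :=
  pushforward (mu \x nu) cons_pair.

Let cons_measure0 : cons_measure set0 = 0.
Proof. by rewrite /cons_measure /pushforward preimage_set0 measure0. Qed.

Let cons_measure_ge0 A : 0 <= cons_measure A.
Proof. by apply: integral_ge0. Qed.

Let cons_measure_sigma_additive : semi_sigma_additive cons_measure.
Proof.
have mc := measurable_cons_pair.
move=> F mF tF mUF; rewrite /cons_measure /pushforward preimage_bigcup.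
apply: measure_semi_sigma_additive.
- by move=> k; rewrite -[X in measurable X]setTI; exact: mc.
- apply/trivIsetP => /= i j _ _ ij; rewrite -preimage_setI.
  by move/trivIsetP : tF => /(_ _ _ _ _ ij) ->//; rewrite preimage_set0.
- by rewrite -preimage_bigcup -[X in measurable X]setTI; exact: mc.
Qed.

HB.instance Definition _ := isMeasure.Build _ _ _ cons_measure
  cons_measure0 cons_measure_ge0 cons_measure_sigma_additive.

Let cons_measure_sigma_finite : sigma_finite setT cons_measure.
Proof.
have [F TF Foo] := sigma_finite_product mu nu.
pose u (t : n.+1.-tuple T) : T * n.-tuple T := (thead t, [tuple of behead t]).
have mu_ : measurable_fun setT u.
  apply: measurable_fun_pair; first exact: measurable_tnth.
  exact: measurable_behead.
have uK : cancel cons_pair u.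
  move=> [x t]; rewrite /u /cons_pair /=; congr pair; exact: val_inj.
exists (fun k => u @^-1` F k).
  by rewrite -preimage_bigcup -TF preimage_setT.
move=> k; have [mFk Fk] := Foo k; split.
  by rewrite -[X in measurable X]setTI; exact: mu_.
rewrite /cons_measure /pushforward -comp_preimage.
by rewrite (_ : u \o cons_pair = id) //; apply/funext => p; exact: uK.
Qed.

HB.instance Definition _ := Measure_isSigmaFinite.Build _ _ _ cons_measure
  cons_measure_sigma_finite.

End cons_measure.

Fixpoint power_measure d (T : measurableType d) (R : realType)
    (mu : {sigma_finite_measure set T -> \bar R}) (n : nat) :
    {sigma_finite_measure set (n.-tuple T) -> \bar R} :=
  match n with
  | 0 => \d_([tuple] : 0.-tuple T)
  | m.+1 => cons_measure mu (power_measure mu m)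
  end.


Section several_complex_variables.
Context (R : realType).

(* [V] and [W] are normed spaces over [R[i]], so [differentiable] is complex
   Frechet differentiability: the differential is [R[i]]-linear. *)
Definition holomorphic_on (V W : normedModType R[i]) (U : set V) (f : V -> W) :=
  forall z : V, U z -> differentiable f z.

Definition hermitian_norm (N : nat) (z : 'rV[R[i]]_N) : R :=
  Num.sqrt (\sum_(k < N) Normc.normc (z ord0 k) ^+ 2).

(* The norm of the library on ['rV[R[i]]_N] is the sup norm; it is only used for
   the topology, the unit ball being the Euclidean one. *)
Definition unit_ball (N : nat) : set 'rV[R[i]]_N :=
  [set z | hermitian_norm z < 1].

Definition holomorphic_self_map (N : nat) (phi : 'rV[R[i]]_N -> 'rV[R[i]]_N) :=
  holomorphic_on (@unit_ball N) phi /\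
  (forall z, unit_ball z -> unit_ball (phi z)).

(* C^N is identified with (R^2)^N in order to carry Lebesgue measure. *)
Definition cvec (N : nat)
    (t : N.-tuple (measurableTypeR R * measurableTypeR R)) : 'rV[R[i]]_N :=
  \row_(k < N) ((tnth t k).1 +i* (tnth t k).2).

Definition lebesgue_R2 : set (measurableTypeR R * measurableTypeR R) -> \bar R :=
  (@lebesgue_measure R \x @lebesgue_measure R)%E.

HB.instance Definition _ := Measure.on lebesgue_R2.
HB.instance Definition _ := Measure_isSigmaFinite.Build _ _ _ lebesgue_R2
  (sigma_finite_product lebesgue_measure lebesgue_measure).

Definition lebesgue_C (N : nat) :
    {sigma_finite_measure
       set (N.-tuple (measurableTypeR R * measurableTypeR R)) -> \bar R} :=
  power_measure lebesgue_R2 N.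

Definition integral_ball (N : nat) (g : 'rV[R[i]]_N -> R) : \bar R :=
  (\int[lebesgue_C N]_(t in @cvec N @^-1` @unit_ball N) (g (cvec t))%:E)%E.

Definition bergman_weight (N : nat) (alpha : R) (z : 'rV[R[i]]_N) : R :=
  (1 - hermitian_norm z ^+ 2) `^ alpha.

Definition bergman_const (N : nat) (alpha : R) : R :=
  (fine (integral_ball (@bergman_weight N alpha)))^-1.

(* dv_alpha = c_alpha (1 - |z|^2)^alpha dv, where c_alpha makes it a probability;
   the normalization of [lebesgue_C] is therefore immaterial. *)
Definition bergman_integral (N : nat) (alpha : R) (g : 'rV[R[i]]_N -> R) :
    \bar R :=
  integral_ball
    (fun z => g z * (bergman_const N alpha * bergman_weight alpha z)).

End several_complex_variables.

Section Orlicz_functions.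
Context (R : realType).
Implicit Type psi : R -> R.

(* Only the values of [psi] on [0, +oo[ matter. *)
Definition Orlicz_function psi :=
  [/\ (forall x, 0 <= x -> 0 <= psi x),
      (forall x y t, 0 <= x -> 0 <= y -> x != y -> 0 < t < 1 ->
         psi (t * x + (1 - t) * y) < t * psi x + (1 - t) * psi y),
      psi 0 = 0,
      psi x @[x --> 0^'+] --> psi 0
    & psi x / x @[x --> +oo] --> +oo].

Definition Delta2_up psi :=
  exists2 C : R, 0 < C & \forall x \near +oo, psi x ^+ 2 <= psi (C * x).

Definition Orlicz_inv psi : R -> R := 'pinv_(fun=> 0) [set x | 0 <= x] psi.

End Orlicz_functions.

Section Bergman_Orlicz_spaces.
Context (R : realType) (N : nat) (alpha : R) (psi : R -> R).
Implicit Type f : 'rV[R[i]]_N -> R[i]^o.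

Definition Orlicz_modular f (C : R) : \bar R :=
  bergman_integral alpha (fun z => psi (Normc.normc (f z) / C)).

(* Elements are total functions, considered only through their restriction to
   the unit ball. *)
Definition Bergman_Orlicz f :=
  holomorphic_on (@unit_ball R N) f /\
  exists2 C : R, 0 < C & (Orlicz_modular f C < +oo)%E.

(* The infimum is +oo when no such C exists; it is finite on the space. *)
Definition Luxemburg_norm f : \bar R :=
  ereal_inf [set C%:E | C in [set C : R | 0 < C /\ (Orlicz_modular f C <= 1)%E]].

Definition bounded_operator (T : ('rV[R[i]]_N -> R[i]^o) -> 'rV[R[i]]_N -> R[i]^o) :=
  exists M : R, forall f, Bergman_Orlicz f ->
    Bergman_Orlicz (T f) /\ (Luxemburg_norm (T f) <= M%:E * Luxemburg_norm f)%E.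

Definition operator_norm (T : ('rV[R[i]]_N -> R[i]^o) -> 'rV[R[i]]_N -> R[i]^o) :
    \bar R :=
  ereal_sup [set Luxemburg_norm (T f) |
    f in [set f | Bergman_Orlicz f /\ (Luxemburg_norm f <= 1)%E]].

End Bergman_Orlicz_spaces.

Definition composition_operator (R : realType) (N : nat)
    (phi : 'rV[R[i]]_N -> 'rV[R[i]]_N) (f : 'rV[R[i]]_N -> R[i]^o) :
    'rV[R[i]]_N -> R[i]^o :=
  f \o phi.

Definition comparable_on (R : realType) (X : Type) (A : set X)
    (F G : X -> \bar R) :=
  exists c C : R, [/\ 0 < c, 0 < C &
    forall x, A x -> (c%:E * G x <= F x)%E /\ (F x <= C%:E * G x)%E].

(* Main.v *)
Require Import Defs.
From mathcomp Require Import all_boot all_order all_algebra.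
From mathcomp Require Import all_classical all_reals all_analysis.
From mathcomp Require Import measurable_realfun complex ring lra.

(** The Delta^2 condition says that psi^-1(y^2) <= C psi^-1(y) for y >= 1; by
    iteration, psi^-1(K y^m) <= C' psi^-1(y) for all fixed K and m
    ([Orlicz_inv_poly]). Inside psi^-1, constants and powers are thus free up to
    a factor, and rough estimates give sharp orders of magnitude.

    Let w(z) = psi^-1(1 / (1 - |z|)) ([growth]). Up to equivalence of norms, the
    Bergman-Orlicz space is the space of holomorphic functions that are O(w):
    - if the modular of f / D is at most 1, then |f| <= K D w on the ball
      ([point_evaluation]);
    - if |f| <= D w on the ball, then the modular of f / (K D) is at most 1
      ([modular_growth]): for every e > 0, w is at most a multiple of
      psi^-1((1 - |z|)^-e), and (1 - |z|)^-e has a finite integral once e is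
      small.
    On the space of functions O(w), the norm of the composition operator of phi
    is at most the supremum of w(phi(z)) / w(z) ([composition_bound]), and
    multiples of the kernels 1 / (1 - <z, a>) with a = phi(z) show that it is at
    least that ([composition_lower_bound]). The supremum is finite because
    1 - |phi(z)| >= c (1 - |z|)^k for some c > 0 and some k
    ([self_map_boundary_growth]), a polynomial loss. The same principle allows
    replacing 1 / (1 - |z|) by its power N + alpha + 1 ([growth_power]).

    Two facts of complex analysis enter, both with arbitrary constants: a mean
    value inequality for |f| ([cauchy_polysquare_estimate]) and a Schwarz-Pick
    inequality ([schwarz_pick_square]). Both come from one argument on
    rectangles. The difference quotient of f at w has no flux through the
    boundary ([cflux_difference_quotient], from Goursat's theorem), whereas the
    flux of F / (z - w) is at least a multiple of F, its outward component being
    positive on the four sides ([cauchy_kernel_bound]). This bounds f(w) by the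
    integral of |f| over the boundary without computing the winding integral.
    Averaging over the position of the sides yields the mean value inequality;
    subtracting the difference quotient at a zero of f yields Schwarz's lemma. *)

Set Implicit Arguments.
Unset Strict Implicit.
Unset Printing Implicit Defensive.

Import Order.TTheory GRing.Theory Num.Theory.
Import numFieldNormedType.Exports.

Local Open Scope classical_set_scope.
Local Open Scope complex_scope.
Local Open Scope ring_scope.

(** * Integrals over segments *)

Section segment_integrals.
Context (R : realType).
Implicit Types (f g : R -> R) (u v w : R).
Local Notation mu := (@lebesgue_measure R).

(** Continuity is two-sided at the end points as well: the functions integrated
    below come from functions differentiable, as functions of two variables, at
    each point of a closed rectangle. *)
Definition continuous_seg g u v :=
  forall y, u <= y <= v -> g z @[z --> y] --> g y.

Definition sint g u v : R := \int[mu]_(x in `[u, v]) g x.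

Lemma continuous_segW g u v u' v' : u <= u' -> v' <= v ->
  continuous_seg g u v -> continuous_seg g u' v'.
Proof.
move=> uu' vv' cg y /andP[uy yv]; apply: cg.
by rewrite (le_trans uu' uy) (le_trans yv vv').
Qed.

Lemma continuous_segB f g u v : continuous_seg f u v -> continuous_seg g u v ->
  continuous_seg (fun x => f x - g x) u v.
Proof. by move=> cf cg y uyv; apply: cvgB; [exact: cf|exact: cg]. Qed.

Lemma continuous_segZ k g u v : continuous_seg g u v ->
  continuous_seg (fun x => k * g x) u v.
Proof. by move=> cg y uyv; apply: cvgMr; exact: cg. Qed.

Lemma continuous_seg_cst k u v : continuous_seg (fun=> k) u v.
Proof. by move=> y _; exact: cvg_cst. Qed.

Lemma continuous_seg_integrable g u v : continuous_seg g u v ->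
  mu.-integrable `[u, v] (EFin \o g).
Proof.
move=> cg; apply: continuous_compact_integrable; first exact: segment_compact.
apply: continuous_in_subspaceT => y; rewrite inE/= in_itv/= => uyv.
exact: cg.
Qed.

Lemma sintB f g u v : continuous_seg f u v -> continuous_seg g u v ->
  sint (fun x => f x - g x) u v = sint f u v - sint g u v.
Proof. by move=> cf cg; apply: RintegralB => //; exact: continuous_seg_integrable. Qed.

Lemma sintZ k g u v : continuous_seg g u v ->
  sint (fun x => k * g x) u v = k * sint g u v.
Proof. by move=> cg; apply: RintegralZl => //; exact: continuous_seg_integrable. Qed.

Lemma le_sint f g u v : continuous_seg f u v -> continuous_seg g u v ->
  (forall x, u <= x <= v -> f x <= g x) -> sint f u v <= sint g u v.
Proof.
move=> cf cg fg; apply: le_Rintegral => //; exact: continuous_seg_integrable.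
Qed.

Lemma sint_cst k u v : u <= v -> sint (fun=> k) u v = k * (v - u).
Proof.
move=> uv; rewrite /sint Rintegral_cst//= lebesgue_measure_itv/= lte_fin.
by case: ltgtP uv => //= -> _; rewrite subrr.
Qed.

Lemma sint_split g u w v : u <= w -> w <= v -> continuous_seg g u v ->
  sint g u v = sint g u w + sint g w v.
Proof.
move=> uw wv cg.
have ig := continuous_seg_integrable cg.
have := @Rintegral_itvB R g (BLeft u) (BRight v) w ig.
rewrite !bnd_simp => /(_ uw wv)/eqP; rewrite subr_eq addrC => /eqP.
rewrite /sint => ->; congr (_ + _).
rewrite Rintegral_itv_obnd_cbnd//; apply: integrableS ig => //.
apply: subset_itvr; by rewrite bnd_simp.
Qed.

Lemma sint_close g (k e : R) u v : u <= v -> continuous_seg g u v ->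
  (forall x, u <= x <= v -> `|g x - k| <= e) ->
  `|sint g u v - k * (v - u)| <= e * (v - u).
Proof.
move=> uv cg ge.
have cc (k' : R) : continuous_seg (fun=> k') u v by exact: continuous_seg_cst.
rewrite -(sint_cst k uv) -sintB// ler_norml -mulNr -!sint_cst//.
apply/andP; split; apply: le_sint => //; try exact: continuous_segB.
- by move=> x /ge; rewrite ler_norml => /andP[].
- by move=> x /ge; rewrite ler_norml => /andP[].
Qed.

End segment_integrals.

(** * Goursat's theorem *)

Section flux.
Context (R : realType).
Implicit Types (P Q : R -> R -> R).

(** The outward flux of the field (P, Q) through the boundary of the rectangle
    [a, b] x [c, d]. For P = Re f and Q = - Im f it is the imaginary part of the
    contour integral of f, which is all that is used of that integral. *)
Definition flux P Q (a b c d : R) : R :=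
  (sint (P b) c d - sint (P a) c d) + (sint (Q ^~ d) a b - sint (Q ^~ c) a b).

(** Frechet differentiability at (x0, y0), with partial derivatives A and B. *)
Definition linear_approx P (x0 y0 A B : R) := forall e, 0 < e ->
  exists2 d, 0 < d & forall x y, `|x - x0| < d -> `|y - y0| < d ->
    `|P x y - P x0 y0 - A * (x - x0) - B * (y - y0)| <=
      e * (`|x - x0| + `|y - y0|).

(** The vanishing of dP/dx + dQ/dy at a point; for P = Re f and Q = - Im f this
    is one of the Cauchy-Riemann equations. *)
Definition divergence_free P Q (x0 y0 : R) := exists A B C : R,
  linear_approx P x0 y0 A B /\ linear_approx Q x0 y0 C (- A).

Lemma linear_approx_continuous P x0 y0 A B : linear_approx P x0 y0 A B ->
  P x y0 @[x --> x0] --> P x0 y0 /\ P x0 y @[y --> y0] --> P x0 y0.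
Proof.
move=> /(_ 1 ltr01)[d d0 H]; split.
- apply/cvgrPdist_le => e e0; near=> x.
  have xd : `|x - x0| < d.
    by near: x; apply: cvgr_distC_lt => //; exact: cvg_id.
  have := H x y0 xd; rewrite !subrr normr0 mulr0 subr0 mul1r addr0 => /(_ d0).
  move=> h; rewrite distrC.
  have -> : P x y0 - P x0 y0 = (P x y0 - P x0 y0 - A * (x - x0)) + A * (x - x0).
    by ring.
  apply: le_trans (ler_normD _ _) _.
  apply: (@le_trans _ _ ((1 + `|A|) * `|x - x0|)).
    by rewrite mulrDl mul1r normrM lerD.
  rewrite mulrC -ler_pdivlMr ?ltr_wpDr//.
  apply/ltW; near: x; apply: cvgr_distC_lt; first exact: cvg_id.
  by rewrite divr_gt0// ltr_wpDr.
- apply/cvgrPdist_le => e e0; near=> y.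
  have yd : `|y - y0| < d.
    by near: y; apply: cvgr_distC_lt => //; exact: cvg_id.
  have := H x0 y _ yd; rewrite !subrr normr0 mulr0 subr0 mul1r add0r => /(_ d0).
  move=> h; rewrite distrC.
  have -> : P x0 y - P x0 y0 = (P x0 y - P x0 y0 - B * (y - y0)) + B * (y - y0).
    by ring.
  apply: le_trans (ler_normD _ _) _.
  apply: (@le_trans _ _ ((1 + `|B|) * `|y - y0|)).
    by rewrite mulrDl mul1r normrM lerD.
  rewrite mulrC -ler_pdivlMr ?ltr_wpDr//.
  apply/ltW; near: y; apply: cvgr_distC_lt; first exact: cvg_id.
  by rewrite divr_gt0// ltr_wpDr.
Unshelve. all: by end_near. Qed.

Definition regular_on P Q (a b c d : R) := forall x y,
  a <= x <= b -> c <= y <= d -> divergence_free P Q x y.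

Lemma regular_onW P Q a b c d a' b' c' d' :
  a <= a' -> b' <= b -> c <= c' -> d' <= d ->
  regular_on P Q a b c d -> regular_on P Q a' b' c' d'.
Proof.
move=> aa bb cc dd H x y /andP[? ?] /andP[? ?].
by apply: H; apply/andP; split; lra.
Qed.

Lemma regular_on_continuous_vert P Q a b c d x : regular_on P Q a b c d ->
  a <= x <= b -> continuous_seg (P x) c d.
Proof. by move=> H xab y ycd; have [A [B [C [/linear_approx_continuous[]]]]] := H _ _ xab ycd. Qed.

Lemma regular_on_continuous_horiz P Q a b c d y : regular_on P Q a b c d ->
  c <= y <= d -> continuous_seg (Q ^~ y) a b.
Proof. by move=> H ycd x xab; have [A [B [C [_ /linear_approx_continuous[]]]]] := H _ _ xab ycd. Qed.

Lemma flux_split_vert P Q a m b c d : a <= m -> m <= b ->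
  continuous_seg (Q ^~ c) a b -> continuous_seg (Q ^~ d) a b ->
  flux P Q a b c d = flux P Q a m c d + flux P Q m b c d.
Proof.
move=> am mb cc cd; rewrite /flux (sint_split am mb cc) (sint_split am mb cd).
ring.
Qed.

Lemma flux_split_horiz P Q a b c m d : c <= m -> m <= d ->
  continuous_seg (P a) c d -> continuous_seg (P b) c d ->
  flux P Q a b c d = flux P Q a b c m + flux P Q a b m d.
Proof.
move=> am mb cc cd; rewrite /flux (sint_split am mb cc) (sint_split am mb cd).
ring.
Qed.

(** The affine parts of P and Q contribute nothing, the divergence being 0 at
    (x0, y0). The errors of the two approximations are at most a small multiple
    of the size of the rectangle, and they are integrated over sides of that
    size. *)
Lemma flux_small P Q x0 y0 e : divergence_free P Q x0 y0 -> 0 < e ->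
  exists2 r, 0 < r & forall a b c d, a <= x0 <= b -> c <= y0 <= d ->
    b - a < r -> d - c < r ->
    regular_on P Q a b c d ->
    `|flux P Q a b c d| <= e * ((b - a) + (d - c)) ^+ 2.
Proof.
move=> [A [B [C [HP HQ]]]] e0.
have e40 : 0 < e / 4 by lra.
have [r1 r10 H1] := HP _ e40; have [r2 r20 H2] := HQ _ e40.
exists (Num.min r1 r2); first by rewrite lt_min r10.
move=> a b c d /andP[ax xb] /andP[cy yd]; rewrite !lt_min.
move=> /andP[ab1 ab2] /andP[cd1 cd2] reg.
have ab : a <= b by lra.
have cd : c <= d by lra.
have small x : a <= x <= b -> `|x - x0| <= b - a.
  by move=> /andP[? ?]; rewrite ler_norml; apply/andP; split; lra.
have small' y : c <= y <= d -> `|y - y0| <= d - c.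
  by move=> /andP[? ?]; rewrite ler_norml; apply/andP; split; lra.
have aab : a <= a <= b by lra.
have bab : a <= b <= b by lra.
have ccd : c <= c <= d by lra.
have dcd : c <= d <= d by lra.
set s := (b - a) + (d - c).
have s0 : 0 <= s by rewrite /s; lra.
have K1 : `|sint (fun y => P b y - P a y) c d - (A * (b - a)) * (d - c)| <=
    (e / 2 * s) * (d - c).
  apply: sint_close => //.
    by apply: continuous_segB; exact: (regular_on_continuous_vert reg).
  move=> y ycd.
  have Pb := H1 b y (le_lt_trans (small _ bab) ab1) (le_lt_trans (small' _ ycd) cd1).
  have Pa := H1 a y (le_lt_trans (small _ aab) ab1) (le_lt_trans (small' _ ycd) cd1).
  rewrite (_ : _ - _ = (P b y - P x0 y0 - A * (b - x0) - B * (y - y0)) -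
    (P a y - P x0 y0 - A * (a - x0) - B * (y - y0))); last by ring.
  apply: le_trans (ler_normB _ _) _.
  have := small _ aab; have := small _ bab; have := small' _ ycd.
  rewrite /s; nra.
have K2 : `|sint (fun x => Q x d - Q x c) a b - (- A * (d - c)) * (b - a)| <=
    (e / 2 * s) * (b - a).
  apply: sint_close => //.
    by apply: continuous_segB; exact: (regular_on_continuous_horiz reg).
  move=> x xab.
  have Pb := H2 x d (le_lt_trans (small _ xab) ab2) (le_lt_trans (small' _ dcd) cd2).
  have Pa := H2 x c (le_lt_trans (small _ xab) ab2) (le_lt_trans (small' _ ccd) cd2).
  rewrite (_ : _ - _ = (Q x d - Q x0 y0 - C * (x - x0) - - A * (d - y0)) -
    (Q x c - Q x0 y0 - C * (x - x0) - - A * (c - y0))); last by ring.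
  apply: le_trans (ler_normB _ _) _.
  have := small' _ ccd; have := small' _ dcd; have := small _ xab.
  rewrite /s; nra.
rewrite /flux -sintB; [|exact: (regular_on_continuous_vert reg)..].
rewrite -sintB; [|exact: (regular_on_continuous_horiz reg)..].
set I1 := sint _ c d in K1 *; set I2 := sint _ a b in K2 *.
rewrite (_ : I1 + I2 = (I1 - A * (b - a) * (d - c)) +
  (I2 - - A * (d - c) * (b - a))); last by ring.
apply: le_trans (ler_normD _ _) _.
apply: le_trans (lerD K1 K2) _.
rewrite -mulrDr (addrC (d - c)) -/s expr2 mulrA.
apply: ler_wpM2r => //; apply: ler_wpM2r => //; lra.
Qed.

End flux.

Section goursat.
Context (R : realType).
Implicit Types (P Q : R -> R -> R).

(** The flux is the sum of the fluxes through the four quarters, since the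
    contributions of the inner sides cancel. *)
Lemma flux_quarter P Q (a b c d : R) : a <= b -> c <= d ->
  regular_on P Q a b c d ->
  exists a' b' c' d' : R,
    [/\ (a <= a' /\ a' <= b') /\ b' <= b, (c <= c' /\ c' <= d') /\ d' <= d,
        b' - a' = (b - a) / 2, d' - c' = (d - c) / 2 &
        `|flux P Q a b c d| <= 4 * `|flux P Q a' b' c' d'|].
Proof.
move=> ab cd reg; set m := (a + b) / 2; set n := (c + d) / 2.
have am : a <= m by rewrite /m; lra.
have mb : m <= b by rewrite /m; lra.
have cn : c <= n by rewrite /n; lra.
have nd : n <= d by rewrite /n; lra.
have hx x : a <= x -> x <= b -> a <= x <= b by move=> -> ->.
have hy x : c <= x -> x <= d -> c <= x <= d by move=> -> ->.
have cQ y : c <= y -> y <= d -> continuous_seg (Q ^~ y) a b.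
  by move=> ? ?; apply: (regular_on_continuous_horiz reg); exact: hy.
have cP x : a <= x -> x <= b -> continuous_seg (P x) c d.
  by move=> ? ?; apply: (regular_on_continuous_vert reg); exact: hx.
have E : flux P Q a b c d =
   flux P Q a m c n + flux P Q a m n d + (flux P Q m b c n + flux P Q m b n d).
  rewrite (@flux_split_vert _ P Q a m b c d)//; try by apply: cQ.
  by rewrite (@flux_split_horiz _ P Q a m c n d)//;
    [rewrite (@flux_split_horiz _ P Q m b c n d)//|..];
    apply: cP => //; apply: (le_trans am).
have [H1|H1] := leP (`|flux P Q a b c d|) (4 * `|flux P Q a m c n|).
  by exists a, m, c, n; split => //; clear - m n ab cd; rewrite /m /n; lra.
have [H2|H2] := leP (`|flux P Q a b c d|) (4 * `|flux P Q a m n d|).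
  by exists a, m, n, d; split => //; clear - m n ab cd; rewrite /m /n; lra.
have [H3|H3] := leP (`|flux P Q a b c d|) (4 * `|flux P Q m b c n|).
  by exists m, b, c, n; split => //; clear - m n ab cd; rewrite /m /n; lra.
have [H4|H4] := leP (`|flux P Q a b c d|) (4 * `|flux P Q m b n d|).
  by exists m, b, n, d; split => //; clear - m n ab cd; rewrite /m /n; lra.
exfalso.
have := ler_normD (flux P Q a m c n + flux P Q a m n d) (flux P Q m b c n + flux P Q m b n d).
have := ler_normD (flux P Q a m c n) (flux P Q a m n d).
have := ler_normD (flux P Q m b c n) (flux P Q m b n d).
rewrite -E; clear - H1 H2 H3 H4; lra.
Qed.

Lemma nested_intervals (u v : nat -> R) :
  (forall n, u n <= u n.+1) -> (forall n, v n.+1 <= v n) ->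
  (forall n, u n <= v n) -> exists x, forall n, u n <= x <= v n.
Proof.
move=> hu hv huv.
have hu' : nondecreasing_seq u by apply/nondecreasing_seqP.
have hv' : nonincreasing_seq v by apply/nonincreasing_seqP.
have uv n k : u n <= v k.
  apply: (@le_trans _ _ (u (maxn n k))); first by apply: hu'; exact: leq_maxl.
  by apply: le_trans (huv _) _; apply: hv'; exact: leq_maxr.
have ne : [set u n | n in setT] !=set0 by exists (u 0%N); exists 0%N.
exists (sup [set u n | n in setT]) => n; apply/andP; split.
  apply: ub_le_sup; last by exists n.
  by exists (v 0%N) => _ [k _ <-].
by apply: ge_sup => // _ [k _ <-].
Qed.

(** Goursat's bisection: the n-th of the nested quarters carries at least 4^-n
    of the flux, and its squared perimeter is 4^-n that of the rectangle, so
    that [flux_small] at the common point of the quarters makes the flux smaller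
    than any e. *)
Lemma goursat P Q (a b c d : R) : a <= b -> c <= d ->
  regular_on P Q a b c d -> flux P Q a b c d = 0.
Proof.
move=> ab cd reg.
pose good (r : R * R * (R * R)) := [/\ a <= r.1.1, r.1.1 <= r.1.2, r.1.2 <= b &
  [/\ c <= r.2.1, r.2.1 <= r.2.2 & r.2.2 <= d]].
pose F (r : R * R * (R * R)) := `|flux P Q r.1.1 r.1.2 r.2.1 r.2.2|.
have /choice[nxt Hn] : forall r, exists s, good r -> good s /\
    [/\ (r.1.1 <= s.1.1 /\ s.1.2 <= r.1.2),
      (r.2.1 <= s.2.1 /\ s.2.2 <= r.2.2),
      s.1.2 - s.1.1 = (r.1.2 - r.1.1) / 2,
      s.2.2 - s.2.1 = (r.2.2 - r.2.1) / 2 &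
      F r <= 4 * F s].
  move=> -[[a0 b0] [c0 d0]].
  have [|nr] := pselect (good (a0, b0, (c0, d0))); last first.
    by exists (a0, b0, (c0, d0)) => /nr.
  move=> [/= aa0 ab0 bb0 [cc0 cd0 dd0]].
  have reg0 : regular_on P Q a0 b0 c0 d0 by apply: regular_onW reg.
  have [a' [b' [c' [d' [[[aa' ab'] bb'] [[cc' cd'] dd'] hb hd hF]]]]] := flux_quarter ab0 cd0 reg0.
  exists ((a', b'), (c', d')) => _; split; last by split.
  by clear - aa0 ab0 bb0 cc0 cd0 dd0 aa' ab' bb' cc' cd' dd'; split => /=; [lra|lra|lra|split; lra].
pose r n := iter n nxt ((a, b), (c, d)).
have gr n : good (r n).
  by elim: n => [|n IH]; [split|rewrite /r iterS; have [] := Hn _ IH].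
have [x0 hx] : exists x, forall n, (r n).1.1 <= x <= (r n).1.2.
  apply: nested_intervals => n.
  - by rewrite /r iterS; have [_ [[]]] := Hn _ (gr n).
  - by rewrite /r iterS; have [_ [[]]] := Hn _ (gr n).
  - by have [] := gr n.
have [y0 hy] : exists x, forall n, (r n).2.1 <= x <= (r n).2.2.
  apply: nested_intervals => n.
  - by rewrite /r iterS; have [_ [_ []]] := Hn _ (gr n).
  - by rewrite /r iterS; have [_ [_ []]] := Hn _ (gr n).
  - by have [_ _ _ []] := gr n.
have sx n : (r n).1.2 - (r n).1.1 = (b - a) / 2 ^+ n.
  elim: n => [|n IH]; first by rewrite expr0 divr1.
  rewrite /r iterS; have [_ [_ _ -> _ _]] := Hn _ (gr n).
  by rewrite -/(r n) IH exprS invfM mulrA mulrAC.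
have sy n : (r n).2.2 - (r n).2.1 = (d - c) / 2 ^+ n.
  elim: n => [|n IH]; first by rewrite expr0 divr1.
  rewrite /r iterS; have [_ [_ _ _ -> _]] := Hn _ (gr n).
  by rewrite -/(r n) IH exprS invfM mulrA mulrAC.
have Fr n : F (r 0%N) <= 4 ^+ n * F (r n).
  elim: n => [|n IH]; first by rewrite expr0 mul1r.
  apply: (le_trans IH); rewrite exprSr -mulrA ler_pM2l ?exprn_gt0//.
  by rewrite /r iterS; have [_ [_ _ _ _]] := Hn _ (gr n).
have regp : divergence_free P Q x0 y0 by apply: reg; [exact: (hx 0%N)|exact: (hy 0%N)].
apply/eqP; rewrite -normr_eq0 -/(F ((a,b),(c,d))) eq_le; apply/andP; split; last exact: normr_ge0.
apply/ler_addgt0Pr => e e0; rewrite add0r.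
set s := (b - a) + (d - c).
have s0 : 0 <= s by rewrite /s; lra.
(* The term + 1 keeps the quotient meaningful for a degenerate rectangle. *)
have e'0 : 0 < e / (s ^+ 2 + 1) by rewrite divr_gt0// ltr_wpDl// sqr_ge0.
have [rr rr0 Hr] := flux_small regp e'0.
(* From this rank on the rectangles are in the scope of [flux_small]. *)
have [n Hnn] : exists n : nat, s / 2 ^+ n < rr.
  have : (fun n : nat => s / 2 ^+ n : R) @ \oo --> (0 : R).
    have := @cvg_geometric R s (2^-1).
    rewrite ger0_norm// invf_lt1// ltr1n => /(_ isT).
    by apply: cvg_trans; apply: near_eq_cvg; near=> n; rewrite /geometric/= exprVn.
  move/cvgrPdist_lt => /(_ _ rr0)[N _ HN]; exists N.
  have := HN N (leqnn N); rewrite /= sub0r normrN => /(le_lt_trans _); apply.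
  exact: ler_norm.
have p2 : 0 < (2 ^+ n : R) by rewrite exprn_gt0.
have [g1 g2 g3 [g4 g5 g6]] := gr n.
have l1 : (b - a) / 2 ^+ n < rr.
  apply: le_lt_trans Hnn; rewrite ler_pM2r ?invr_gt0// /s; lra.
have l2 : (d - c) / 2 ^+ n < rr.
  apply: le_lt_trans Hnn; rewrite ler_pM2r ?invr_gt0// /s; lra.
have regn : regular_on P Q (r n).1.1 (r n).1.2 (r n).2.1 (r n).2.2.
  by apply: regular_onW reg.
have := Hr _ _ _ _ (hx n) (hy n); rewrite sx sy => /(_ l1 l2 regn).
rewrite -mulrDl -/s => HF.
apply: le_trans (Fr n) _.
apply: (@le_trans _ _ (4 ^+ n * (e / (s ^+ 2 + 1) * (s / 2 ^+ n) ^+ 2))).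
  by rewrite ler_pM2l ?exprn_gt0.
have -> : 4 ^+ n = (2 ^+ n) ^+ 2 :> R.
  by rewrite -exprM mulnC exprM; congr (_ ^+ n); rewrite expr2; ring.
have n1 : s ^+ 2 + 1 != 0 by rewrite lt0r_neq0// ltr_wpDl// sqr_ge0.
have n2 := lt0r_neq0 p2.
have -> : (2 ^+ n) ^+ 2 * (e / (s ^+ 2 + 1) * (s / 2 ^+ n) ^+ 2) =
    e * (s ^+ 2 / (s ^+ 2 + 1)).
  by field; rewrite ?n1 ?n2.
apply: ler_piMr; first exact: ltW.
rewrite ler_pdivrMr ?ltr_wpDl ?sqr_ge0// mul1r.
by rewrite lerDl.
Unshelve. all: by end_near. Qed.

End goursat.

Section goursat_bounded.
Context (R : realType).
Implicit Types (P Q : R -> R -> R).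

(** A square of half-side t around the exceptional point is what remains after
    removing two strips beside it and two rectangles above and below it, all
    without flux. The flux through the square is at most 8 K t, and t is
    arbitrarily small. *)
Lemma goursat_bounded P Q (a b c d x0 y0 K r0 : R) :
  a < x0 < b -> c < y0 < d -> 0 < r0 ->
  (forall x y, a <= x <= b -> c <= y <= d -> (x, y) != (x0, y0) ->
     divergence_free P Q x y) ->
  (forall x y, `|x - x0| <= r0 -> `|y - y0| <= r0 -> (x, y) != (x0, y0) ->
     `|P x y| <= K /\ `|Q x y| <= K) ->
  flux P Q a b c d = 0.
Proof.
move=> /andP[ax xb] /andP[cy yd] r00 reg bd.
apply/eqP; rewrite -normr_eq0 eq_le; apply/andP; split => //.
have K0 : 0 <= K.
  have [] := bd (x0 + r0) y0; last by move=> /(le_trans _) + _; apply.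
  - by rewrite addrC addKr ger0_norm// ltW.
  - by rewrite subrr normr0 ltW.
  - by apply/eqP => -[]; lra.
apply/ler_addgt0Pr => e e0; rewrite add0r.
(* The square of half-side t lies in the rectangle and in the region where the
   bound K holds, and 8 K t <= e. *)
pose t := Num.min (Num.min (x0 - a) (b - x0)) (Num.min (Num.min (y0 - c) (d - y0))
   (Num.min r0 (e / (8 * K + 1)))).
have t0 : 0 < t by rewrite !lt_min; do ! (apply/andP; split); rewrite ?subr_gt0 ?divr_gt0//; lra.
have [t1 [t2 [t3 [t4 [t5 t6]]]]] : t <= x0 - a /\ t <= b - x0 /\ t <= y0 - c /\ t <= d - y0 /\ t <= r0 /\ t <= e / (8 * K + 1).
  by rewrite /t !ge_min !lexx ?orbT.
have neq x y : x != x0 \/ y != y0 -> (x, y) != (x0, y0).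
  by rewrite xpair_eqE negb_and => -[->|->]; rewrite ?orbT.
have R1 : regular_on P Q a (x0 - t) c d.
  move=> x y xx yy; apply: reg => //; [lra|].
  by apply: neq; left; apply/eqP; lra.
have R2 : regular_on P Q (x0 + t) b c d.
  move=> x y xx yy; apply: reg => //; [lra|].
  by apply: neq; left; apply/eqP; lra.
have R3 : regular_on P Q a b c (y0 - t).
  move=> x y xx yy; apply: reg => //; [lra|].
  by apply: neq; right; apply/eqP; lra.
have R4 : regular_on P Q a b (y0 + t) d.
  move=> x y xx yy; apply: reg => //; [lra|].
  by apply: neq; right; apply/eqP; lra.
have cQc : continuous_seg (Q ^~ c) a b by apply: (regular_on_continuous_horiz R3); lra.
have cQd : continuous_seg (Q ^~ d) a b by apply: (regular_on_continuous_horiz R4); lra.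
have cQm : continuous_seg (Q ^~ (y0 - t)) a b by apply: (regular_on_continuous_horiz R3); lra.
have cQp : continuous_seg (Q ^~ (y0 + t)) a b by apply: (regular_on_continuous_horiz R4); lra.
have cPm : continuous_seg (P (x0 - t)) c d by apply: (regular_on_continuous_vert R1); lra.
have cPp : continuous_seg (P (x0 + t)) c d by apply: (regular_on_continuous_vert R2); lra.
rewrite (@flux_split_vert _ P Q a (x0 - t)); [|lra|lra|by []|by []].
rewrite (@flux_split_vert _ P Q (x0 - t) (x0 + t)); [|lra|lra|..]; last 2 first.
  by apply: continuous_segW cQc; clear - ax xb cy yd t0 t1 t2 t3 t4; lra.
  by apply: continuous_segW cQd; clear - ax xb cy yd t0 t1 t2 t3 t4; lra.
rewrite (goursat _ _ R1); [|lra|lra].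
rewrite (goursat _ _ R2); [|lra|lra].
rewrite (@flux_split_horiz _ P Q _ _ _ (y0 - t)); [|lra|lra|by []|by []].
rewrite (@flux_split_horiz _ P Q _ _ (y0 - t) (y0 + t)); [|lra|lra|..]; last 2 first.
  by apply: continuous_segW cPm; clear - ax xb cy yd t0 t1 t2 t3 t4; lra.
  by apply: continuous_segW cPp; clear - ax xb cy yd t0 t1 t2 t3 t4; lra.
have R3' : regular_on P Q (x0 - t) (x0 + t) c (y0 - t) by apply: regular_onW R3; clear - t0 t1 t2; lra.
have R4' : regular_on P Q (x0 - t) (x0 + t) (y0 + t) d by apply: regular_onW R4; clear - t0 t1 t2; lra.
rewrite (goursat _ _ R3'); [|lra|lra].
rewrite (goursat _ _ R4'); [|lra|lra].
rewrite !add0r !addr0.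
have small (f : R -> R) z : continuous_seg f (z - t) (z + t) ->
    (forall x, z - t <= x <= z + t -> `|f x| <= K) -> `|sint f (z - t) (z + t)| <= 2 * K * t.
  move=> cf fK; have zz : z - t <= z + t by lra.
  have fK' x : z - t <= x <= z + t -> `|f x - 0| <= K by move=> /fK; rewrite subr0.
  have := sint_close zz cf fK'; rewrite mul0r subr0 => /le_trans; apply; lra.
have B1 : `|sint (P (x0 + t)) (y0 - t) (y0 + t)| <= 2 * K * t.
  apply: small; first by apply: continuous_segW cPp; clear - ax xb cy yd t0 t1 t2 t3 t4; lra.
  move=> y hy; have [] // := bd (x0 + t) y; [| |apply: neq; left; apply/eqP; clear - t0; lra];
    clear - hy t0 t5; rewrite ler_norml; lra.
have B2 : `|sint (P (x0 - t)) (y0 - t) (y0 + t)| <= 2 * K * t.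
  apply: small; first by apply: continuous_segW cPm; clear - ax xb cy yd t0 t1 t2 t3 t4; lra.
  move=> y hy; have [] // := bd (x0 - t) y; [| |apply: neq; left; apply/eqP; clear - t0; lra];
    clear - hy t0 t5; rewrite ler_norml; lra.
have B3 : `|sint (Q ^~ (y0 + t)) (x0 - t) (x0 + t)| <= 2 * K * t.
  apply: small; first by apply: continuous_segW cQp; lra.
  move=> y hy; have [] // := bd y (y0 + t); [| |apply: neq; right; apply/eqP; clear - t0; lra];
    clear - hy t0 t5; rewrite ler_norml; lra.
have B4 : `|sint (Q ^~ (y0 - t)) (x0 - t) (x0 + t)| <= 2 * K * t.
  apply: small; first by apply: continuous_segW cQm; lra.
  move=> y hy; have [] // := bd y (y0 - t); [| |apply: neq; right; apply/eqP; clear - t0; lra];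
    clear - hy t0 t5; rewrite ler_norml; lra.
have tt : t * (8 * K + 1) <= e by rewrite -ler_pdivlMr//; lra.
rewrite /flux; apply: le_trans (ler_normD _ _) _.
have := ler_normB (sint (P (x0 + t)) (y0 - t) (y0 + t)) (sint (P (x0 - t)) (y0 - t) (y0 + t)).
have := ler_normB (sint (Q ^~ (y0 + t)) (x0 - t) (x0 + t)) (sint (Q ^~ (y0 - t)) (x0 - t) (x0 + t)).
clear - t0 tt B1 B2 B3 B4; lra.
Qed.

End goursat_bounded.

(** * Cauchy's formula on rectangles, up to constants *)

Section complex_line.
Context (R : realType).
Local Notation C := (R[i]^o).
Local Notation N := (@Normc.normc R).
Implicit Types (f g : C -> C) (z w : C).
Local Notation pt x y := (Complex x y : C).

Lemma normC_normc z : `|z| = (N z)%:C.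
Proof. by []. Qed.

Lemma normc_ge0 z : 0 <= N z.
Proof. by rewrite -ler0c -normC_normc. Qed.

Lemma normc_Re z : `|complex.Re z| <= N z.
Proof. by have := normc_ge_Re z; rewrite normC_normc lecR. Qed.

Lemma normc_Im z : `|complex.Im z| <= N z.
Proof.
case: z => x y /=; rewrite -[leLHS]sqrtr_sqr ler_sqrt ?addr_ge0 ?sqr_ge0//.
by rewrite lerDr sqr_ge0.
Qed.

Lemma normc_le_ReIm z : N z <= `|complex.Re z| + `|complex.Im z|.
Proof.
case: z => x y /=; rewrite -[leRHS]ger0_norm ?addr_ge0// -sqrtr_sqr.
rewrite ler_sqrt ?sqr_ge0// sqrrD !real_normK ?num_real//.
by rewrite lerD2r lerDl mulrn_wge0// mulr_ge0.
Qed.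

(** The derivative as a complex number A, in terms of real norms. *)
Lemma complex_linear_approx f z : differentiable f z ->
  exists A, forall e, 0 < e -> exists2 d, 0 < d &
    forall w, N (w - z) < d -> N (f w - f z - A * (w - z)) <= e * N (w - z).
Proof.
move=> /derivable1_diffP; rewrite /derivable => /cvg_ex[/= A HA].
exists A => e e0; have e0' : 0 < e%:C by rewrite ltcR.
move/cvgrPdist_le : HA => /(_ _ e0')[/= d d0 Hd].
have dr : d = (N d)%:C by rewrite -normC_normc gtr0_norm.
exists (N d); first by rewrite -ltcR -dr.
move=> w wd; have [->|wz] := eqVneq w z.
  by rewrite !subrr mulr0 subr0 (_ : N 0 = 0) ?mulr0 //; exact: Normc.normc0.
have wz0 : w - z != 0 by rewrite subr_eq0.
have := Hd (w - z); rewrite /= sub0r normrN normC_normc dr ltcR => /(_ wd wz0).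
rewrite [X in f X](_ : _ = w); last first.
  by rewrite /GRing.scale/= mulr1 subrK.
rewrite normC_normc lecR => H.
rewrite -ler_pdivrMr; last first.
  by rewrite lt_def normc_ge0 andbT; apply: contra wz0 => /eqP/Normc.eq0_normc ->.
apply: le_trans H; rewrite -Normc.normcV -Normc.normcM -[leRHS]normcN.
rewrite [leLHS](_ : _ = N (- (A - (w - z)^-1 * (f w - f z))))//.
by congr N; rewrite opprB mulrBl mulfK// mulrC.
Qed.

(** The Cauchy-Riemann equations: if the derivative is a + i b, the partial
    derivatives are a and - b for Re f, and - b and - a for - Im f. *)
Lemma differentiable_divergence_free f x y : differentiable f (pt x y) ->
  divergence_free (fun x y => complex.Re (f (x +i* y)))
    (fun x y => - complex.Im (f (x +i* y))) x y.
Proof.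
move=> /complex_linear_approx[[a b] HA]; exists a, (- b), (- b).
split => e e0; have [d d0 Hd] := HA e e0; exists (d / 2); rewrite ?divr_gt0// => x' y' xx yy.
- have le1 : N ((x' +i* y') - (x +i* y)) <= `|x' - x| + `|y' - y|.
    exact: (normc_le_ReIm ((x' +i* y') - (x +i* y))).
  have /Hd H : N ((x' +i* y') - (x +i* y)) < d by lra.
  apply: le_trans (le_trans H _); last by rewrite ler_pM2l.
  apply: le_trans (normc_Re _).
  case: (f _) (f _) => [u v] [u' v'] /=.
  by rewrite le_eqVlt; apply/orP; left; apply/eqP; congr (`|_|); ring.
- have le1 : N ((x' +i* y') - (x +i* y)) <= `|x' - x| + `|y' - y|.
    exact: (normc_le_ReIm ((x' +i* y') - (x +i* y))).
  have /Hd H : N ((x' +i* y') - (x +i* y)) < d by lra.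
  apply: le_trans (le_trans H _); last by rewrite ler_pM2l.
  apply: le_trans (normc_Im _).
  case: (f _) (f _) => [u v] [u' v'] /=.
  by rewrite -normrN le_eqVlt; apply/orP; left; apply/eqP; congr (`|_|); ring.
Qed.

Definition cflux f (a b c d : R) : R :=
  flux (fun x y => complex.Re (f (x +i* y)))
    (fun x y => - complex.Im (f (x +i* y))) a b c d.

Lemma differentiable_difference_quotient f z w : z != w -> differentiable f z ->
  differentiable (fun y => (f y - f w) / (y - w) : C) z.
Proof.
move=> zw df.
have -> : (fun y => (f y - f w) / (y - w)) =
  ((f : C -> C) - cst (f w)) * (fun y : C => ((id - cst w : C -> C) y)^-1 : C).
  by apply/funext.
apply: differentiableM.
  by apply: differentiableB => //; exact: differentiable_cst.
apply: differentiableV; last by rewrite /= subr_eq0.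
by apply: differentiableB => //; exact: differentiable_cst.
Qed.

(** The difference quotient is differentiable away from w = x0 + i y0 and, since f
    is differentiable at w, bounded near w: [goursat_bounded] applies. *)
Lemma cflux_difference_quotient f (a b c d x0 y0 : R) :
  a < x0 < b -> c < y0 < d ->
  (forall x y, a <= x <= b -> c <= y <= d -> differentiable f (pt x y)) ->
  cflux (fun z => (f z - f (x0 +i* y0)) / (z - (x0 +i* y0))) a b c d = 0.
Proof.
move=> abx cdy df; set w := pt x0 y0.
have dfw : differentiable f w.
  by apply: df; [move: abx|move: cdy] => /andP[? ?]; apply/andP; split; exact: ltW.
have [A /(_ 1 ltr01)[r r0 Hr]] := complex_linear_approx dfw.
(* With e = 1, the linear approximation bounds the quotient by |A| + 1 within
   r / 4 of each coordinate, hence within r of w. *)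
apply: (@goursat_bounded _ _ _ a b c d x0 y0 (N A + 1) (r / 4)) => //.
- by rewrite divr_gt0.
- move=> x y xab ycd xy.
  apply: (@differentiable_divergence_free (fun z => (f z - f w) / (z - w) : C)).
  apply: differentiable_difference_quotient; last exact: df.
  by apply: contra xy; rewrite /w eq_complex.
- move=> x y xr yr xy.
  set z := pt x y.
  have zw : z - w != 0.
    by rewrite subr_eq0; apply: contra xy; rewrite /w eq_complex.
  have Nzw : 0 < N (z - w).
    by rewrite lt_def normc_ge0 andbT; apply: contra zw => /eqP/Normc.eq0_normc ->.
  have zwr : N (z - w) < r.
    apply: le_lt_trans (normc_le_ReIm (z - w)) _.
    have : `|x - x0| + `|y - y0| < r by lra.
    by [].
  suff H : N ((f z - f w) / (z - w)) <= N A + 1.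
    split; first by apply: le_trans (normc_Re _) _; exact: H.
    by rewrite normrN; apply: le_trans (normc_Im _) _; exact: H.
  rewrite Normc.normcM Normc.normcV ler_pdivrMr// mulrDl -Normc.normcM [leRHS]addrC.
  apply: le_trans (lerD (Hr _ zwr) (lexx _)).
  by apply: le_trans (le_normcD _ _); rewrite subrK.
Qed.

Definition on_boundary (a b c d x y : R) :=
  (x == a) || (x == b) || (y == c) || (y == d).

Definition boundary_int (k : R -> R -> R) (a b c d : R) : R :=
  (sint (k b) c d + sint (k a) c d) + (sint (k ^~ d) a b + sint (k ^~ c) a b).

Definition boundary_continuous (k : R -> R -> R) (a b c d : R) :=
  (continuous_seg (k b) c d /\ continuous_seg (k a) c d) /\
  (continuous_seg (k ^~ d) a b /\ continuous_seg (k ^~ c) a b).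

(** Along a side carried by a line at distance u from w, the outward component of
    the field of F / (z - w) is F u / (u ^ 2 + v ^ 2). *)
Lemma inv_complex_side (u v F delta L : R) : 0 <= F -> 0 < delta -> delta <= u ->
  u <= L -> `|v| <= L -> F * (delta / (2 * L ^+ 2)) <= F * (u / (u ^+ 2 + v ^+ 2)).
Proof.
move=> F0 d0 du uL vL; apply: ler_wpM2l => //.
have u0 : 0 < u by lra.
have q0 : 0 < u ^+ 2 + v ^+ 2 by rewrite ltr_wpDr ?sqr_ge0// exprn_gt0.
have L0 : 0 < L by lra.
rewrite ler_pdivrMr ?mulr_gt0 ?exprn_gt0// mulrAC ler_pdivlMr//.
have u2 : u ^+ 2 <= L ^+ 2 by rewrite ler_sqr ?nnegrE//; lra.
have v2 : v ^+ 2 <= L ^+ 2.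
  by rewrite -(real_normK (num_real v)) ler_sqr ?nnegrE//; lra.
apply: (@le_trans _ _ (delta * (2 * L ^+ 2))).
  by rewrite ler_pM2l//; lra.
by apply: ler_wpM2r => //; rewrite mulr_ge0// sqr_ge0.
Qed.

(** Cauchy's formula up to a constant. As h has no flux, the flux of F / (z - w)
    is that of h + F / (z - w), which the integral of k bounds; on the other hand
    the outward component of F / (z - w) is positive on the four sides, so that
    its flux is at least a multiple of F. *)
Lemma cauchy_kernel_bound (h : R[i] -> R[i]) (k : R -> R -> R)
    (a b c d x0 y0 F delta L : R) :
  0 <= F -> 0 < delta ->
  delta <= x0 - a -> delta <= b - x0 -> delta <= y0 - c -> delta <= d - y0 ->
  b - a <= L -> d - c <= L ->
  boundary_continuous (fun x y => complex.Re (h (x +i* y))) a b c d ->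
  boundary_continuous (fun x y => - complex.Im (h (x +i* y))) a b c d ->
  boundary_continuous k a b c d ->
  cflux h a b c d = 0 ->
  (forall x y, a <= x <= b -> c <= y <= d ->
    on_boundary a b c d x y ->
    N (h (x +i* y) + F%:C / ((x +i* y) - (x0 +i* y0))) <= k x y) ->
  F * (delta ^+ 2 / L ^+ 2) <= boundary_int k a b c d.
Proof.
move=> F0 d0 ax xb cy yd bL dL [[cR1 cR2] _] [_ [cI1 cI2]] [[ck1 ck2] [ck3 ck4]] flux0 Hk.
(* The lower bound of the outward component on each of the four sides. *)
set e := F * (delta / (2 * L ^+ 2)).
have cst u v : continuous_seg (fun=> e) u v by exact: continuous_seg_cst.
have I1 : sint (fun y => complex.Re (h (b +i* y))) c d <= sint (fun y => k b y - e) c d.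
  apply: le_sint => //; first exact: continuous_segB.
  move=> y ycd; have := Hk b y; rewrite /on_boundary eqxx !orbT => /(_ _ ycd isT) H.
  have {H} := le_trans (normc_Re _) (H _); rewrite ler_norml => H.
  have /H/andP[_] : a <= b <= b by lra.
  have := @inv_complex_side (b - x0) (y - y0) F delta L F0 d0.
  rewrite -/e ler_norml; case: (h _) => u v /=; lra.
have I2 : sint (fun y => - complex.Re (h (a +i* y))) c d <= sint (fun y => k a y - e) c d.
  apply: le_sint => //; [by move=> y hy; apply: cvgN; exact: cR2|exact: continuous_segB|].
  move=> y ycd; have := Hk a y; rewrite /on_boundary eqxx /= => /(_ _ ycd isT) H.
  have {H} := le_trans (normc_Re _) (H _); rewrite ler_norml => H.
  have /H/andP[+ _] : a <= a <= b by lra.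
  have := @inv_complex_side (x0 - a) (y - y0) F delta L F0 d0.
  rewrite -/e -(sqrrN (x0 - a)) opprB ler_norml; case: (h _) => u v /=; lra.
have I3 : sint (fun x => - complex.Im (h (x +i* d))) a b <= sint (fun x => k x d - e) a b.
  apply: le_sint => //; first exact: continuous_segB.
  move=> x xab; have := Hk x d xab; rewrite /on_boundary eqxx !orbT => /(_ _ isT) H.
  have {H} := le_trans (normc_Im _) (H _); rewrite ler_norml => H.
  have /H/andP[+ _] : c <= d <= d by lra.
  have := @inv_complex_side (d - y0) (x - x0) F delta L F0 d0.
  rewrite -/e ler_norml (addrC (_ ^+ 2)); case: (h _) => u v /=; lra.
have I4 : sint (fun x => complex.Im (h (x +i* c))) a b <= sint (fun x => k x c - e) a b.
  apply: le_sint => //; [|exact: continuous_segB|].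
    have -> : (fun x => complex.Im (h (x +i* c))) =
        (fun x => - - complex.Im (h (x +i* c))) by apply/funext => x; rewrite opprK.
    by move=> x hx; apply: cvgN; exact: cI2.
  move=> x xab; have := Hk x c xab; rewrite /on_boundary eqxx !orbT => /(_ _ isT) H.
  have {H} := le_trans (normc_Im _) (H _); rewrite ler_norml => H.
  have /H/andP[_] : c <= c <= d by lra.
  have := @inv_complex_side (y0 - c) (x - x0) F delta L F0 d0.
  rewrite -/e -(sqrrN (y0 - c)) opprB ler_norml (addrC (_ ^+ 2)); case: (h _) => u v /=; lra.
have sN (g : R -> R) (u v : R) : continuous_seg g u v -> sint (fun x => - g x) u v = - sint g u v.
  by move=> cg; rewrite -mulN1r -sintZ//; congr sint; apply/funext => x; rewrite mulN1r.
have ab : a <= b by lra.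
have cd : c <= d by lra.
move: flux0 I1 I2 I3 I4; rewrite /cflux /flux.
rewrite (sN (fun y => complex.Re (h (a +i* y))))//.
rewrite (@sintB _ (k b))// (@sintB _ (k a))// (@sintB _ (k ^~ d))// (@sintB _ (k ^~ c))//.
rewrite !sint_cst//.
have -> : sint (fun x => complex.Im (h (x +i* c))) a b = - sint (fun x => - complex.Im (h (x +i* c))) a b.
  by rewrite -sN//; congr sint; apply/funext => x; rewrite opprK.
rewrite /boundary_int.
have e0 : 0 <= e.
  apply: mulr_ge0 => //; apply: divr_ge0; first exact: ltW.
  by apply: mulr_ge0 => //; exact: sqr_ge0.
have le1 : e * (4 * delta) <= e * ((b - a) + (d - c)).
  apply: ler_wpM2l => //; lra.
have -> : F * (delta ^+ 2 / L ^+ 2) = e * (2 * delta).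
  have L0 : L != 0 by apply: lt0r_neq0; lra.
  by rewrite /e; field; rewrite ?L0.
have : 0 <= e * delta by rewrite mulr_ge0// ltW.
move=> *; lra.
Qed.

End complex_line.

Section cauchy_estimates.
Context (R : realType).
Local Notation C := (R[i]^o).
Local Notation N := (@Normc.normc R).
Implicit Types (f g : C -> C) (z w : C).
Local Notation pt x y := (Complex x y : C).

Lemma continuous_seg_vert f (x c d : R) :
  (forall y, c <= y <= d -> differentiable f (pt x y)) ->
  continuous_seg (fun y => complex.Re (f (pt x y))) c d /\
  continuous_seg (fun y => - complex.Im (f (pt x y))) c d.
Proof.
move=> df; split=> y yH.
  have [A [B [D [/linear_approx_continuous[h1 h2] /linear_approx_continuous[h3 h4]]]]] :=
    differentiable_divergence_free (df y yH).
  exact: h2.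
have [A [B [D [/linear_approx_continuous[h1 h2] /linear_approx_continuous[h3 h4]]]]] :=
    differentiable_divergence_free (df y yH).
exact: h4.
Qed.

Lemma continuous_seg_horiz f (a b y : R) :
  (forall x, a <= x <= b -> differentiable f (pt x y)) ->
  continuous_seg (fun x => complex.Re (f (pt x y))) a b /\
  continuous_seg (fun x => - complex.Im (f (pt x y))) a b.
Proof.
move=> df; split=> x xH.
  have [A [B [D [/linear_approx_continuous[h1 h2] /linear_approx_continuous[h3 h4]]]]] :=
    differentiable_divergence_free (df x xH).
  exact: h1.
have [A [B [D [/linear_approx_continuous[h1 h2] /linear_approx_continuous[h3 h4]]]]] :=
    differentiable_divergence_free (df x xH).
exact: h3.
Qed.

Lemma differentiable_boundary_continuous f (a b c d : R) : a <= b -> c <= d ->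
  (forall x y, a <= x <= b -> c <= y <= d -> on_boundary a b c d x y ->
    differentiable f (pt x y)) ->
  boundary_continuous (fun x y => complex.Re (f (pt x y))) a b c d /\
  boundary_continuous (fun x y => - complex.Im (f (pt x y))) a b c d.
Proof.
move=> ab cd df.
have [|? ?] := @continuous_seg_vert f b c d.
  by move=> y ycd; apply: df => //; rewrite /on_boundary ?eqxx ?orbT// ab lexx.
have [|? ?] := @continuous_seg_vert f a c d.
  by move=> y ycd; apply: df => //; rewrite /on_boundary ?eqxx ?orbT// ab lexx.
have [|? ?] := @continuous_seg_horiz f a b d.
  by move=> y ycd; apply: df => //; rewrite /on_boundary ?eqxx ?orbT// cd lexx.
have [|? ?] := @continuous_seg_horiz f a b c.
  by move=> y ycd; apply: df => //; rewrite /on_boundary ?eqxx ?orbT// cd lexx.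
by [].
Qed.

Lemma cfluxB f g (a b c d : R) :
  boundary_continuous (fun x y => complex.Re (f (pt x y))) a b c d ->
  boundary_continuous (fun x y => - complex.Im (f (pt x y))) a b c d ->
  boundary_continuous (fun x y => complex.Re (g (pt x y))) a b c d ->
  boundary_continuous (fun x y => - complex.Im (g (pt x y))) a b c d ->
  cflux (fun z => f z - g z) a b c d = cflux f a b c d - cflux g a b c d.
Proof.
move=> [[? ?] _] [_ [? ?]] [[? ?] _] [_ [? ?]].
rewrite /cflux /flux.
have ReB (u v : C) : complex.Re (u - v) = complex.Re u - complex.Re v.
  by case: u v => ? ? [].
have ImB (u v : C) : - complex.Im (u - v) = - complex.Im u - - complex.Im v.
  by case: u v => ? ? [? ?] /=; ring.
have E1 x : (fun y => complex.Re (f (pt x y) - g (pt x y))) =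
    (fun y => complex.Re (f (pt x y)) - complex.Re (g (pt x y))).
  by apply/funext => y; exact: ReB.
have E2 y : (fun x => - complex.Im (f (pt x y) - g (pt x y))) =
    (fun x => - complex.Im (f (pt x y)) - - complex.Im (g (pt x y))).
  by apply/funext => x; exact: ImB.
rewrite !E1 !E2 !sintB//; ring.
Qed.

Lemma normc_eq0 z : (N z == 0) = (z == 0).
Proof.
apply/eqP/eqP => [/Normc.eq0_normc//|->]; exact: Normc.normc0.
Qed.

Lemma normc_gt0 z : (0 < N z) = (z != 0).
Proof. by rewrite lt_def normc_ge0 andbT normc_eq0. Qed.

Lemma normc_real (x : R) : N (x%:C) = `|x|.
Proof. by rewrite /= expr0n addr0 sqrtr_sqr. Qed.

Lemma rotate_to_real z : exists u : C, N u = 1 /\ u * z = (N z)%:C.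
Proof.
have [->|z0] := eqVneq z 0.
  by exists 1; rewrite mulr0 [N 0]Normc.normc0; split => //; exact: Normc.normc1.
exists ((N z)%:C / z); split; last by rewrite mulfVK.
by rewrite Normc.normcM Normc.normcV normc_real ger0_norm ?normc_ge0// divff// normc_eq0.
Qed.

Lemma normc_far (x y x0 y0 delta : R) : delta <= `|x - x0| \/ delta <= `|y - y0| ->
  delta <= N (pt x y - pt x0 y0).
Proof.
by move=> [/le_trans|/le_trans]; apply; [exact: (normc_Re (pt x y - pt x0 y0))|exact: (normc_Im (pt x y - pt x0 y0))].
Qed.

Lemma boundary_far (a b c d x0 y0 delta x y : R) :
  delta <= x0 - a -> delta <= b - x0 -> delta <= y0 - c -> delta <= d - y0 ->
  on_boundary a b c d x y -> delta <= N (pt x y - pt x0 y0).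
Proof.
move=> ax xb cy yd; rewrite /on_boundary.
move=> /orP[/orP[/orP[]|]|] /eqP ->; apply: normc_far.
- by left; rewrite distrC; apply: le_trans (ler_norm _).
- by left; apply: le_trans (ler_norm _).
- by right; rewrite distrC; apply: le_trans (ler_norm _).
- by right; apply: le_trans (ler_norm _).
Qed.

(** Schwarz's lemma up to a constant. Rotate f so that f(w) >= 0. The difference
    of the difference quotients of f at w and at 0 has no flux, and adding
    f(w) / (z - w) to it leaves f(z) w / (z (z - w)), at most 2 |w| on the
    boundary of the square. *)
Lemma schwarz_square f (x0 y0 : R) :
  (forall x y, -1 <= x <= 1 -> -1 <= y <= 1 ->
     differentiable f (pt x y) /\ N (f (pt x y)) <= 1) ->
  f 0 = 0 -> `|x0| <= 1/2 -> `|y0| <= 1/2 ->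
  N (f (pt x0 y0)) <= 256 * N (pt x0 y0).
Proof.
move=> Hf f0; rewrite !ler_norml => /andP[x1 x2] /andP[y1 y2].
set w := pt x0 y0.
have [u [u1 uf]] := rotate_to_real (f w).
pose g : C -> C := fun z => u * f z.
have dg x y : -1 <= x <= 1 -> -1 <= y <= 1 -> differentiable g (pt x y).
  move=> hx hy; have [df _] := Hf x y hx hy.
  have -> : g = (cst u : C -> C) * f by apply/funext.
  by apply: differentiableM => //; exact: differentiable_cst.
have g1 x y : -1 <= x <= 1 -> -1 <= y <= 1 -> N (g (pt x y)) <= 1.
  by move=> hx hy; rewrite /g Normc.normcM u1 mul1r; have [] := Hf x y hx hy.
have gw : g w = (N (f w))%:C by [].
have g0 : g 0 = 0 by rewrite /g f0 mulr0.
clearbody g.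
pose h1 : C -> C := fun z => (g z - g w) / (z - w).
pose h2 : C -> C := fun z => (g z - g (pt 0 0)) / (z - pt 0 0).
have far0 x y : on_boundary (-1) 1 (-1) 1 x y -> 1 <= N (pt x y - pt 0 0).
  by apply: boundary_far; lra.
have farw x y : on_boundary (-1) 1 (-1) 1 x y -> 1/2 <= N (pt x y - w).
  by apply: boundary_far; lra.
have le11 : (-1 : R) <= 1 by lra.
have [R1 I1] : boundary_continuous (fun x y => complex.Re (h1 (pt x y))) (-1) 1 (-1) 1 /\
  boundary_continuous (fun x y => - complex.Im (h1 (pt x y))) (-1) 1 (-1) 1.
  apply: (differentiable_boundary_continuous le11 le11) => x y hx hy bxy.
  apply: differentiable_difference_quotient; last exact: dg.
  rewrite -subr_eq0 -normc_gt0; apply: lt_le_trans (farw _ _ bxy); lra.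
have [R2 I2] : boundary_continuous (fun x y => complex.Re (h2 (pt x y))) (-1) 1 (-1) 1 /\
  boundary_continuous (fun x y => - complex.Im (h2 (pt x y))) (-1) 1 (-1) 1.
  apply: (differentiable_boundary_continuous le11 le11) => x y hx hy bxy.
  apply: differentiable_difference_quotient; last exact: dg.
  rewrite -subr_eq0 -normc_gt0; apply: lt_le_trans (far0 _ _ bxy); lra.
have [R3 I3] : boundary_continuous (fun x y => complex.Re (h1 (pt x y) - h2 (pt x y))) (-1) 1 (-1) 1 /\
  boundary_continuous (fun x y => - complex.Im (h1 (pt x y) - h2 (pt x y))) (-1) 1 (-1) 1.
  apply: (@differentiable_boundary_continuous (fun z => h1 z - h2 z) _ _ _ _ le11 le11) => x y hx hy bxy.
  apply: (@differentiableB _ _ _ h1 h2); apply: differentiable_difference_quotient; try exact: dg.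
    rewrite -subr_eq0 -normc_gt0; apply: lt_le_trans (farw _ _ bxy); lra.
  rewrite -subr_eq0 -normc_gt0; apply: lt_le_trans (far0 _ _ bxy); lra.
have fl : cflux (fun z => h1 z - h2 z) (-1) 1 (-1) 1 = 0.
  by rewrite cfluxB// !cflux_difference_quotient ?subr0//; lra.
(* The constant: delta = 1 / 2 and L = 2 give |f(w)| / 16 on the left, while the
   perimeter 8 times 2 |w| is 16 |w|. *)
have := @cauchy_kernel_bound _ (fun z => h1 z - h2 z) (fun _ _ => 2 * N w) (-1) 1 (-1) 1
  x0 y0 (N (f w)) (1/2) 2 (normc_ge0 _).
have H0 : (0 : R) < 1/2 by lra.
have e1 : 1/2 <= x0 - -1 by lra.
have e2 : 1/2 <= 1 - x0 by lra.
have e3 : 1/2 <= y0 - -1 by lra.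
have e4 : 1/2 <= 1 - y0 by lra.
have e5 : 1 - -1 <= 2 :> R by lra.
have bc : boundary_continuous (fun _ _ : R => 2 * N w) (-1) 1 (-1) 1.
  by do 2 split; exact: continuous_seg_cst.
move=> /(_ H0 e1 e2 e3 e4 e5 e5 R3 I3 bc fl) H.
have {}H : N (f w) * ((1/2) ^+ 2 / 2 ^+ 2) <= boundary_int (fun _ _ => 2 * N w) (-1) 1 (-1) 1.
  apply: H => x y hx hy bxy.
  have n1 := farw _ _ bxy; have n0 := far0 _ _ bxy.
  have zw : pt x y - w != 0 by rewrite -normc_gt0; lra.
  have z0 : pt x y - pt 0 0 != 0 by rewrite -normc_gt0; lra.
  have -> : h1 (pt x y) - h2 (pt x y) + (N (f w))%:C / (pt x y - pt x0 y0) =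
     g (pt x y) * w / ((pt x y - pt 0 0) * (pt x y - w)).
    rewrite /h1 /h2 -gw -/w (_ : pt 0 0 = 0)// g0 !subr0 in zw z0 *.
    by field; rewrite zw z0.
  rewrite !Normc.normcM Normc.normcV Normc.normcM.
  rewrite ler_pdivrMr ?mulr_gt0//; [|lra|lra].
  apply: (@le_trans _ _ (1 * N w)).
    by apply: ler_wpM2r; [exact: normc_ge0|exact: g1].
  have le12 : 1 <= 2 * (N (pt x y - pt 0 0) * N (pt x y - w)).
    have : 1 * (1 / 2) <= N (pt x y - pt 0 0) * N (pt x y - w).
      by apply: ler_pM => //; clear; lra.
    clear; lra.
  by rewrite [leRHS]mulrAC; apply: ler_wpM2r => //; exact: normc_ge0.
move: H; rewrite /boundary_int !sint_cst//.
lra.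
Qed.

Lemma continuous_seg_normc (p q : R -> R) (u v : R) :
  continuous_seg p u v -> continuous_seg q u v ->
  continuous_seg (fun x => N (p x +i* q x)) u v.
Proof.
move=> cp cq x xuv; apply: continuous_comp; last exact: sqrt_continuous.
apply: cvgD; first by apply: (cvgM (cp _ xuv) (cp _ xuv)).
by apply: (cvgM (cq _ xuv) (cq _ xuv)).
Qed.

(** The sides of the rectangle may be placed anywhere at distances between r / 2
    and r from the centre, in view of averaging over their positions. The
    integrals extend over the full width of the square, so that each of them
    depends on the position of a single side. *)
Lemma cauchy_boundary_estimate f (k : R -> R -> R) (x0 y0 r a b c d : R) : 0 < r ->
  (forall x y, k x y = N (f (pt x y))) ->
  (forall x y, x0 - r <= x <= x0 + r -> y0 - r <= y <= y0 + r ->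
     differentiable f (pt x y)) ->
  x0 - r <= a -> a <= x0 - r / 2 -> x0 + r / 2 <= b -> b <= x0 + r ->
  y0 - r <= c -> c <= y0 - r / 2 -> y0 + r / 2 <= d -> d <= y0 + r ->
  N (f (pt x0 y0)) <= 32 / r *
   ((sint (k b) (y0 - r) (y0 + r) + sint (k a) (y0 - r) (y0 + r)) +
    (sint (k ^~ d) (x0 - r) (x0 + r) + sint (k ^~ c) (x0 - r) (x0 + r))).
Proof.
move=> r0 kE df a1 a2 b1 b2 c1 c2 d1 d2.
set w := pt x0 y0.
have [u [u1 uf]] := rotate_to_real (f w).
pose g : C -> C := fun z => u * f z.
have dg x y : x0 - r <= x <= x0 + r -> y0 - r <= y <= y0 + r -> differentiable g (pt x y).
  move=> hx hy; have {}df := df x y hx hy.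
  have -> : g = (cst u : C -> C) * f by apply/funext.
  by apply: differentiableM => //; exact: differentiable_cst.
have gk x y : N (g (pt x y)) = k x y by rewrite /g Normc.normcM u1 mul1r kE.
have gw : g w = (N (f w))%:C by [].
clearbody g.
pose h : C -> C := fun z => (g z - g w) / (z - w).
have r20 : 0 < r / 2 by lra.
have far x y : on_boundary a b c d x y -> r / 2 <= N (pt x y - w).
  by apply: boundary_far; lra.
have dg' x y : a <= x <= b -> c <= y <= d -> differentiable g (pt x y).
  by move=> ? ?; apply: dg; lra.
have [R1 I1] : boundary_continuous (fun x y => complex.Re (h (pt x y))) a b c d /\
  boundary_continuous (fun x y => - complex.Im (h (pt x y))) a b c d.
  apply: differentiable_boundary_continuous => [||x y hx hy bxy]; [lra|lra|].
  apply: differentiable_difference_quotient; last exact: dg'.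
  rewrite -subr_eq0 -normc_gt0; apply: lt_le_trans (far _ _ bxy); lra.
have ck1 x : x0 - r <= x <= x0 + r -> continuous_seg (k x) (y0 - r) (y0 + r).
  move=> hx.
  have [cR cI] := @continuous_seg_vert f x (y0 - r) (y0 + r) (df x ^~ hx).
  have := continuous_seg_normc cR cI.
  congr continuous_seg; apply/funext => y.
  by rewrite kE; case: (f _) => p q /=; rewrite sqrrN.
have ck2 y : y0 - r <= y <= y0 + r -> continuous_seg (k ^~ y) (x0 - r) (x0 + r).
  move=> hy.
  have [cR cI] := @continuous_seg_horiz f (x0 - r) (x0 + r) y (fun x hx => df x y hx hy).
  have := continuous_seg_normc cR cI.
  congr continuous_seg; apply/funext => x.
  by rewrite kE; case: (f _) => p q /=; rewrite sqrrN.
have k0 x y : 0 <= k x y by rewrite kE; exact: normc_ge0.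
have fl : cflux h a b c d = 0.
  by apply: cflux_difference_quotient => //; lra.
pose kk x y := 2 / r * k x y.
have bk : boundary_continuous kk a b c d.
  split; split; apply: continuous_segZ.
  - by apply: continuous_segW (ck1 b _); lra.
  - by apply: continuous_segW (ck1 a _); lra.
  - by apply: continuous_segW (ck2 d _); lra.
  - by apply: continuous_segW (ck2 c _); lra.
have e1 : r / 2 <= x0 - a by lra.
have e2 : r / 2 <= b - x0 by lra.
have e3 : r / 2 <= y0 - c by lra.
have e4 : r / 2 <= d - y0 by lra.
have e5 : b - a <= 2 * r by lra.
have e6 : d - c <= 2 * r by lra.
have H : N (f w) * ((r / 2) ^+ 2 / (2 * r) ^+ 2) <= boundary_int kk a b c d.
  apply: (cauchy_kernel_bound (normc_ge0 _) r20 e1 e2 e3 e4 e5 e6 R1 I1 bk fl).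
  move=> x y hx hy bxy; rewrite -gw /h -mulrDl subrK Normc.normcM Normc.normcV gk.
  rewrite /kk mulrC; apply: ler_wpM2r => //.
  have Nr := far _ _ bxy.
  rewrite -[leRHS]invf_div lef_pV2// posrE; lra.
have nn (q : R -> R) (s t s' t' : R) : (forall x, 0 <= q x) -> s <= s' -> s' <= t' -> t' <= t ->
    continuous_seg q s t -> sint q s' t' <= sint q s t.
  move=> q0 ss st tt cq.
  have P0 (s1 t1 : R) : 0 <= sint q s1 t1 by apply: Rintegral_ge0 => x _; exact: q0.
  rewrite (@sint_split _ q s s' t)//; [|exact: le_trans tt].
  rewrite (@sint_split _ q s' t' t)//; first by rewrite addrCA lerDl addr_ge0.
  exact: continuous_segW cq.
(* With delta = r / 2 and L = 2 r, delta ^ 2 / L ^ 2 is 1 / 16. *)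
have -> : N (f w) = 16 * (N (f w) * ((r / 2) ^+ 2 / (2 * r) ^+ 2)).
  by field; rewrite lt0r_neq0.
have -> : 32 / r = 16 * (2 / r) by field; rewrite lt0r_neq0.
rewrite -mulrA ler_pM2l//; apply: le_trans H _.
rewrite /boundary_int /kk.
rewrite !sintZ; [|by apply: continuous_segW (ck2 c _); lra|by apply: continuous_segW (ck2 d _); lra
  |by apply: continuous_segW (ck1 a _); lra|by apply: continuous_segW (ck1 b _); lra].
rewrite -!mulrDr ler_pM2l ?divr_gt0//.
apply: lerD; apply: lerD; apply: nn => //; try lra.
- by apply: ck1; lra.
- by apply: ck1; lra.
- by apply: ck2; lra.
- by apply: ck2; lra.
Qed.

End cauchy_estimates.

(** * The mean value inequality *)

Section monotone_integral.
Local Open Scope ereal_scope.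
Context d (T : measurableType d) (R : realType).
Variable mu : {measure set T -> \bar R}.
Import HBNNSimple.

(** The integral of a nonnegative function is a supremum over the simple
    functions below it, hence monotone for arbitrary functions. *)
Lemma ge0_le_integral_nonmeasurable (D : set T) (f g : T -> \bar R) :
  (forall x, D x -> 0 <= f x) -> (forall x, D x -> f x <= g x) ->
  \int[mu]_(x in D) f x <= \int[mu]_(x in D) g x.
Proof.
move=> f0 fg; rewrite !ge0_integralE//; last first.
  by move=> x Dx; exact: le_trans (f0 x Dx) (fg x Dx).
apply: ereal_sup_le => _ [h /= hf <-]; exists h => // x.
by apply: le_trans (hf x) _; apply: lee_restrict.
Qed.

End monotone_integral.

Section power_measure_integral.
Local Open Scope ereal_scope.
Context d (T : measurableType d) (R : realType).
Variable mu : {sigma_finite_measure set T -> \bar R}.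

Lemma ge0_integral_power_measureS n (f : n.+1.-tuple T -> \bar R) :
  measurable_fun [set: n.+1.-tuple T] f -> (forall t, 0 <= f t) ->
  \int[power_measure mu n.+1]_t f t =
  \int[mu]_x \int[power_measure mu n]_t f (cons_pair (x, t)).
Proof.
move=> mf f0.
rewrite [LHS](@ge0_integral_pushforward _ _ _ _ R _ (@measurable_cons_pair _ T n)
   (mu \x power_measure mu n) setT f)//.
rewrite preimage_setT (fubini_tonelli1 (fun p => f (cons_pair p)))//.
by apply: measurableT_comp => //; exact: measurable_cons_pair.
Qed.

Lemma ge0_integral_power_measureS_swap n (f : n.+1.-tuple T -> \bar R) :
  measurable_fun [set: n.+1.-tuple T] f -> (forall t, 0 <= f t) ->
  \int[power_measure mu n.+1]_t f t =
  \int[power_measure mu n]_t \int[mu]_x f (cons_pair (x, t)).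
Proof.
move=> mf f0.
rewrite [LHS](@ge0_integral_pushforward _ _ _ _ R _ (@measurable_cons_pair _ T n)
   (mu \x power_measure mu n) setT f)//.
rewrite preimage_setT (fubini_tonelli2 (fun p => f (cons_pair p)))//.
by apply: measurableT_comp => //; exact: measurable_cons_pair.
Qed.

Lemma measurable_fun_cons_section n (f : n.+1.-tuple T -> \bar R) x :
  measurable_fun [set: n.+1.-tuple T] f ->
  measurable_fun [set: n.-tuple T] (fun t : n.-tuple T => f (cons_pair (x, t))).
Proof.
move=> mf; apply: measurableT_comp => //.
by apply: measurable_cons => //; exact: measurable_id.
Qed.

End power_measure_integral.

Section area_estimate.
Context (R : realType).
Local Notation C := (R[i]^o).
Local Notation N := (@Normc.normc R).
Local Notation pt x y := (Complex x y : C).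
Local Notation mR := (measurableTypeR R).

(** Otherwise the integral of J over [s, t] would be at least v + e; the slack e
    replaces a strict inequality between integrals. *)
Lemma exists_le_average (J : R -> \bar R) (v e s t : R) :
  measurable_fun setT (J : mR -> \bar R) -> (forall x, 0 <= J x)%E ->
  (\int[@lebesgue_measure R]_x J x <= v%:E)%E -> 0 < e -> s < t ->
  exists2 b, s <= b <= t & (J b <= ((v + e) / (t - s))%:E)%E.
Proof.
move=> mJ J0 Jv e0 st; apply: contrapT => H.
have HH x : s <= x <= t -> (((v + e) / (t - s))%:E <= J x)%E.
  move=> xst; rewrite leNgt; apply/negP => /ltW h; apply: H; by exists x.
have ve0 : (0 <= v)%R.
  by rewrite -lee_fin; apply: le_trans Jv; apply: integral_ge0.
have : ((v + e)%:E <= v%:E)%E; last by rewrite lee_fin; lra.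
apply: le_trans Jv.
apply: (@le_trans _ _ (\int[@lebesgue_measure R]_(x in `[s, t]) J x)%E); last first.
  by apply: ge0_subset_integral.
have ts : t - s != 0 by rewrite subr_eq0 gt_eqF.
apply: (@le_trans _ _ (\int[@lebesgue_measure R]_(x in `[s, t]) (cst ((v + e) / (t - s))%:E x))%E).
  rewrite integral_cst//= lebesgue_measure_itv/= lte_fin st.
  by rewrite -EFinD -EFinM divfK.
apply: ge0_le_integral_nonmeasurable => x /=; rewrite in_itv/=; last exact: HH.
by rewrite lee_fin divr_ge0//; lra.
Qed.

(** By Fubini's theorem each side can be placed on a line along which the integral
    of g is at most 2 / r times the integral of g over the plane, up to an
    arbitrarily small error. The majorant g stands for |f|, about whose
    measurability outside the square nothing is known. *)
Lemma cauchy_area_estimate (f : C -> C) (g : mR * mR -> \bar R) (x0 y0 r : R) :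
  0 < r ->
  (forall x y, x0 - r <= x <= x0 + r -> y0 - r <= y <= y0 + r ->
     differentiable f (pt x y) /\ ((N (f (pt x y)))%:E <= g (x, y))%E) ->
  measurable_fun setT g -> (forall p, 0 <= g p)%E ->
  ((N (f (pt x0 y0)))%:E <= (256 / r ^+ 2)%:E * \int[@lebesgue_R2 R]_p g p)%E.
Proof.
move=> r0 Hf mg g0.
have p256 : 0 < 256 :> R by rewrite ltr0n.
have r2 : 0 < r ^+ 2 by exact: exprn_gt0.
have c0 : 0 < 256 / r ^+ 2 by exact: divr_gt0.
have [V0|] := leP (+oo)%E (\int[@lebesgue_R2 R]_p g p)%E.
  rewrite (_ : \int[_]_p _ = +oo)%E; last by apply/eqP; rewrite eq_le leey.
  by rewrite gt0_muley ?leey// lte_fin.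
move=> Vfin; pose V := fine (\int[@lebesgue_R2 R]_p g p)%E.
have VE : (\int[@lebesgue_R2 R]_p g p = V%:E)%E.
  by rewrite fineK// ge0_fin_numE//; apply: integral_ge0.
rewrite VE -EFinM lee_fin.
pose J1 (x : R) := (\int[@lebesgue_measure R]_y g (x, y))%E.
pose J2 (y : R) := (\int[@lebesgue_measure R]_x g (x, y))%E.
have mJ1 : measurable_fun setT (J1 : mR -> \bar R).
  exact: (measurable_fun_fubini_tonelli_F g mg g0).
have mJ2 : measurable_fun setT (J2 : mR -> \bar R).
  exact: (measurable_fun_fubini_tonelli_G g mg g0).
have J10 x : (0 <= J1 x)%E by apply: integral_ge0.
have J20 y : (0 <= J2 y)%E by apply: integral_ge0.
have IJ1 : (\int[@lebesgue_measure R]_x J1 x <= V%:E)%E.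
  by rewrite -VE (fubini_tonelli1 g mg g0).
have IJ2 : (\int[@lebesgue_measure R]_x J2 x <= V%:E)%E.
  by rewrite -VE (fubini_tonelli2 g mg g0).
pose k x y := N (f (pt x y)).
have k0 x y : 0 <= k x y by exact: normc_ge0.
have df x y : x0 - r <= x <= x0 + r -> y0 - r <= y <= y0 + r -> differentiable f (pt x y).
  by move=> hx hy; have [] := Hf x y hx hy.
have S1 x v : x0 - r <= x <= x0 + r -> (J1 x <= v%:E)%E ->
    sint (k x) (y0 - r) (y0 + r) <= v.
  move=> hx Jv.
  have : (\int[@lebesgue_measure R]_(y in `[(y0 - r)%R, (y0 + r)%R]) (k x y)%:E <= v%:E)%E.
    apply: le_trans Jv.
    apply: (@le_trans _ _ (\int[@lebesgue_measure R]_(y in `[(y0 - r)%R, (y0 + r)%R]) g (x, y))%E).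
      apply: ge0_le_integral_nonmeasurable => y /=; first by rewrite lee_fin.
      by rewrite in_itv/= => hy; have [] := Hf x y hx hy.
    apply: ge0_subset_integral => //.
    apply: measurableT_comp => //.
  rewrite /sint /Rintegral => h.
  have h0 : (0 <= \int[@lebesgue_measure R]_(y in `[(y0 - r)%R, (y0 + r)%R]) (k x y)%:E)%E.
    by apply: integral_ge0 => y _; rewrite lee_fin.
  rewrite -lee_fin fineK// ge0_fin_numE//; exact: le_lt_trans h (ltry _).
have S2 y v : y0 - r <= y <= y0 + r -> (J2 y <= v%:E)%E ->
    sint (k ^~ y) (x0 - r) (x0 + r) <= v.
  move=> hy Jv.
  have : (\int[@lebesgue_measure R]_(x in `[(x0 - r)%R, (x0 + r)%R]) (k x y)%:E <= v%:E)%E.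
    apply: le_trans Jv.
    apply: (@le_trans _ _ (\int[@lebesgue_measure R]_(x in `[(x0 - r)%R, (x0 + r)%R]) g (x, y))%E).
      apply: ge0_le_integral_nonmeasurable => x /=; first by rewrite lee_fin.
      by rewrite in_itv/= => hx; have [] := Hf x y hx hy.
    apply: ge0_subset_integral => //.
    apply: measurableT_comp => //.
  rewrite /sint /Rintegral => h.
  have h0 : (0 <= \int[@lebesgue_measure R]_(x in `[(x0 - r)%R, (x0 + r)%R]) (k x y)%:E)%E.
    by apply: integral_ge0 => x _; rewrite lee_fin.
  rewrite -lee_fin fineK// ge0_fin_numE//; exact: le_lt_trans h (ltry _).
have V0 : 0 <= V by rewrite -lee_fin -VE; apply: integral_ge0.
apply/ler_addgt0Pr => e e0.
(* The error allowed in each average, so that the total error is e. *)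
pose e' := e * r ^+ 2 / 256.
have e'0 : 0 < e' by apply: divr_gt0 => //; exact: mulr_gt0.
have avg (J : R -> \bar R) (s t : R) : measurable_fun setT (J : mR -> \bar R) ->
    (forall x, 0 <= J x)%E -> (\int[@lebesgue_measure R]_x J x <= V%:E)%E ->
    t - s = r / 2 ->
    exists2 b, s <= b <= t & (J b <= (2 / r * (V + e'))%:E)%E.
  move=> mJ J0 IJ ts; have st : s < t by rewrite -subr_gt0 ts; lra.
  have [b bst Jb] := exists_le_average mJ J0 IJ e'0 st.
  by exists b => //; move: Jb; rewrite ts invf_div mulrC.
have [b /andP[b1 b2] Jb] := avg J1 (x0 + r / 2) (x0 + r) mJ1 J10 IJ1 ltac:(lra).
have [a /andP[a1 a2] Ja] := avg J1 (x0 - r) (x0 - r / 2) mJ1 J10 IJ1 ltac:(lra).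
have [d /andP[d1 d2] Jd] := avg J2 (y0 + r / 2) (y0 + r) mJ2 J20 IJ2 ltac:(lra).
have [c /andP[c1 c2] Jc] := avg J2 (y0 - r) (y0 - r / 2) mJ2 J20 IJ2 ltac:(lra).
apply: le_trans (@cauchy_boundary_estimate _ f k x0 y0 r a b c d r0 _ df a1 a2 b1 b2 c1 c2 d1 d2) _ => //.
have {}Jb := S1 b _ ltac:(lra) Jb; have {}Ja := S1 a _ ltac:(lra) Ja.
have {}Jc := S2 c _ ltac:(lra) Jc; have {}Jd := S2 d _ ltac:(lra) Jd.
(* Four sides, each with an integral of at most 2 / r times V + e'. *)
have -> : 256 / r ^+ 2 * V + e = 32 / r * (4 * (2 / r * (V + e'))).
  by rewrite /e'; field; rewrite lt0r_neq0.
rewrite ler_pM2l ?divr_gt0//; clear -Ja Jb Jc Jd; lra.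
Qed.

End area_estimate.

(** * The mean value inequality in several variables *)

Section polysquare.
Context (R : realType).
Local Notation C := (R[i]^o).
Local Notation N := (@Normc.normc R).
Local Notation pt x y := (Complex x y : C).
Local Notation plane := (measurableTypeR R * measurableTypeR R)%type.

Definition polysquare n (a : n.-tuple plane) (r : R) : set (n.-tuple plane) :=
  [set t | forall i, (tnth a i).1 - r <= (tnth t i).1 <= (tnth a i).1 + r /\
                     (tnth a i).2 - r <= (tnth t i).2 <= (tnth a i).2 + r].

(** The slices along which [cauchy_polysquare_estimate] asks for holomorphy. *)
Definition set_coord n (t : n.-tuple plane) (i : 'I_n) (w : C) : n.-tuple plane :=
  [tuple if j == i then (complex.Re w, complex.Im w) else tnth t j | j < n].

Lemma polysquare_cons n (a t : n.-tuple plane) (p q : plane) r :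
  (p.1 - r <= q.1 <= p.1 + r /\ p.2 - r <= q.2 <= p.2 + r) ->
  polysquare a r t -> polysquare (cons_pair (p, a)) r (cons_pair (q, t)).
Proof.
move=> pq at_ i; case: (unliftP ord0 i) => [j ->|->]; last by rewrite !tnth0.
by rewrite !tnthS; exact: at_.
Qed.

Lemma set_coord_cons0 n (t : n.-tuple plane) (p : plane) w :
  set_coord (cons_pair (p, t)) ord0 w =
  cons_pair ((complex.Re w, complex.Im w), t).
Proof.
apply: eq_from_tnth => i; rewrite tnth_mktuple.
by case: (unliftP ord0 i) => [j ->|->]; rewrite ?eqxx ?tnth0// !tnthS.
Qed.

Lemma set_coord_consS n (t : n.-tuple plane) (p : plane) i w :
  set_coord (cons_pair (p, t)) (lift ord0 i) w = cons_pair (p, set_coord t i w).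
Proof.
apply: eq_from_tnth => j; rewrite tnth_mktuple.
case: (unliftP ord0 j) => [k ->|->]; last by rewrite !tnth0.
by rewrite !tnthS tnth_mktuple (inj_eq lift_inj).
Qed.

Lemma polysquare_refl n (a : n.-tuple plane) r : 0 <= r -> polysquare a r a.
Proof. by move=> r0 i; split; apply/andP; split; rewrite ?gerBl ?lerDl. Qed.

(** Apply the area estimate to one coordinate after the other: integrating the
    majorant over the last n coordinates gives, by induction, a majorant for the
    function of the first one. *)
Lemma cauchy_polysquare_estimate n (a : n.-tuple plane) r
    (F : n.-tuple plane -> C) (g : n.-tuple plane -> \bar R) : 0 < r ->
  measurable_fun [set: n.-tuple plane] g -> (forall t, 0 <= g t)%E ->
  (forall t, polysquare a r t -> ((N (F t))%:E <= g t)%E) ->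
  (forall t i, polysquare a r t ->
     differentiable (fun w : C => F (set_coord t i w))
       (pt (tnth t i).1 (tnth t i).2)) ->
  ((N (F a))%:E <= ((256 / r ^+ 2) ^+ n)%:E * \int[lebesgue_C R n]_t g t)%E.
Proof.
move=> r0; have r0' := ltW r0.
have [c cE c0] : exists2 c, 256 / r ^+ 2 = c & 0 < c.
  by eexists; [reflexivity|apply: divr_gt0; [rewrite ltr0n|exact: exprn_gt0]].
rewrite cE.
elim: n a F g => [|n IH] a F g mg g0 Fg dF.
  rewrite expr0 mul1e /lebesgue_C /= integral_dirac// diracT mul1e.
  by rewrite [a]tuple0; rewrite [a]tuple0 in Fg; exact/Fg/polysquare_refl.
case/tupleP: a Fg dF => p a Fg dF.
have aE : [tuple of p :: a] = cons_pair (p, a) by [].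
rewrite !aE in Fg dF *.
pose G (q : plane) := ((c ^+ n)%:E * \int[lebesgue_C R n]_t g (cons_pair (q, t)))%E.
have cn0 : (0 <= (c ^+ n)%:E :> \bar R)%E.
  by rewrite lee_fin; apply: exprn_ge0; exact: ltW.
have mgc : measurable_fun setT (fun q : plane * n.-tuple plane => g (cons_pair q)).
  by apply: measurableT_comp => //; exact: measurable_cons_pair.
have mG0 : measurable_fun setT (fun q : plane => \int[lebesgue_C R n]_t g (cons_pair (q, t)))%E.
  exact: (measurable_fun_fubini_tonelli_F (fun q => g (cons_pair q)) mgc).
have mG : measurable_fun setT G by apply: measurable_funeM.
have iG q : (0 <= \int[lebesgue_C R n]_t g (cons_pair (q, t)))%E by apply: integral_ge0.
have G0 q : (0 <= G q)%E by rewrite /G mule_ge0.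
have GF q : (p.1 - r <= q.1 <= p.1 + r /\ p.2 - r <= q.2 <= p.2 + r) ->
    ((N (F (cons_pair (q, a))))%:E <= G q)%E.
  move=> pq; apply: (IH a (fun t => F (cons_pair (q, t)))).
  - exact: measurable_fun_cons_section.
  - by [].
  - by move=> t at_; apply: Fg; exact: polysquare_cons.
  - move=> t i at_.
    have := dF (cons_pair (q, t)) (lift ord0 i) (polysquare_cons pq at_).
    rewrite tnthS (_ : (fun w => _) = (fun w => F (cons_pair (q, set_coord t i w))))//.
    by apply/funext => w; rewrite set_coord_consS.
pose f1 (w : C) := F (cons_pair ((complex.Re w, complex.Im w), a)).
have Hf x y : p.1 - r <= x <= p.1 + r -> p.2 - r <= y <= p.2 + r ->
    differentiable f1 (pt x y) /\ ((N (f1 (pt x y)))%:E <= G (x, y))%E.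
  move=> hx hy; split; last exact: (GF (x, y)).
  have xa : polysquare (cons_pair (p, a)) r (cons_pair ((x, y), a)).
    by apply: polysquare_cons => //; exact: polysquare_refl.
  have := dF (cons_pair ((x, y), a)) ord0 xa.
  rewrite tnth0/= (_ : (fun w => _) = f1)//.
  by apply/funext => w; rewrite /f1 set_coord_cons0.
have := cauchy_area_estimate r0 Hf mG G0; rewrite cE /f1 /= -surjective_pairing.
move=> /le_trans; apply.
rewrite exprS EFinM -muleA; apply: lee_wpmul2l; first by rewrite lee_fin ltW.
rewrite (_ : \int[_]_q G q = (c ^+ n)%:E * \int[@lebesgue_R2 R]_q \int[lebesgue_C R n]_t g (cons_pair (q, t)))%E; last first.
  apply: ge0_integralZl_EFin => //.
  all: try by apply: exprn_ge0; exact: ltW.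
by rewrite /lebesgue_C (@ge0_integral_power_measureS _ _ _ _ n g).
Qed.

End polysquare.

(** * Measurability of continuous functions in real coordinates *)

Section measurable_cvec.
Context (R : realType) (n : nat).
Local Notation N := (@Normc.normc R).
Local Notation C := (R[i]^o).
Local Notation V := [the normedModType R[i] of 'rV[R[i]]_n].
Local Notation plane := (measurableTypeR R * measurableTypeR R)%type.

(** An open set is the union of the rational boxes that it contains, and there
    are countably many of them. *)
Lemma measurable_cvec_open (U : set V) : open U ->
  measurable (@cvec R n @^-1` U).
Proof.
move=> oU.
pose box (q : {ffun 'I_n -> rat * rat} * nat) : set (n.-tuple plane) :=
  [set t | forall i, `|(tnth t i).1 - ratr (q.1 i).1| < q.2.+1%:R^-1 /\
                     `|(tnth t i).2 - ratr (q.1 i).2| < q.2.+1%:R^-1].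
have mbox q : measurable (box q).
  have -> : box q = \bigcap_(i in [set: 'I_n])
     ((fun t : n.-tuple plane => (tnth t i).1) @^-1` ball (ratr (q.1 i).1 : R) q.2.+1%:R^-1 `&`
      (fun t : n.-tuple plane => (tnth t i).2) @^-1` ball (ratr (q.1 i).2 : R) q.2.+1%:R^-1).
    apply/seteqP; split => [t tq i _|t tq i]; last first.
      by have [h1 h2] := tq i I; rewrite distrC (distrC (tnth t i).2).
    by have [h1 h2] := tq i; split; rewrite /= /ball/= distrC.
  apply: fin_bigcap_measurable => // i _; apply: measurableI.
    rewrite -[X in measurable X]setTI.
    apply: (measurableT_comp measurable_fst (measurable_tnth i)) => //.
    exact: measurable_ball.
  rewrite -[X in measurable X]setTI.
  apply: (measurableT_comp measurable_snd (measurable_tnth i)) => //.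
  exact: measurable_ball.
have -> : @cvec R n @^-1` U =
  \bigcup_(q in [set: {ffun 'I_n -> rat * rat} * nat])
     (if `[< box q `<=` @cvec R n @^-1` U >] then box q else set0).
  apply/seteqP; split => t; last first.
    by move=> [q _]; case: ifPn => // /asboolP; apply.
  move=> Ut.
  have := oU; rewrite openE => /(_ _ Ut) /nbhs_ballP[e /= e0 eU].
  (* Two points of a rational box of radius 1 / (m + 1) differ by less
     than 2 / (m + 1) in each real coordinate, hence by less than 4 / (m + 1) in each complex one. *)
  have [m Hm] : exists m : nat, 4 * m.+1%:R^-1 < complex.Re e.
    have e'0 : 0 < complex.Re e / 4 by move: e0; rewrite ltcE /= => /andP[_]; lra.
    have [k] := near_infty_natSinv_lt (PosNum e'0).
    move=> _ /(_ k (leqnn k))/= hk; exists k; rewrite mulrC -ltr_pdivlMr ?ltr0n//; exact: hk.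
  have eE : e = (complex.Re e)%:C.
    by case: (e) e0 => a b; rewrite ltcE /= => /andP[/eqP -> _].
  have m0 : 0 < m.+1%:R^-1 :> R by rewrite invr_gt0 ltr0n.
  have ratP (x : R) : {q : rat | `|x - ratr q| < m.+1%:R^-1}.
    apply/cid; have [|q] := @rat_in_itvoo R (x - m.+1%:R^-1) (x + m.+1%:R^-1).
      by rewrite ltrD2l -subr_gt0 opprK addr_gt0.
    rewrite in_itv/= => /andP[q1 q2]; exists q; rewrite ltr_norml.
    by move: (m.+1%:R^-1 : R) (ratr q : R) q1 q2 => dd u q1 q2; apply/andP; split; lra.
  pose q : {ffun 'I_n -> rat * rat} :=
    [ffun i => (sval (ratP (tnth t i).1), sval (ratP (tnth t i).2))].
  exists (q, m) => //; case: ifPn => [_ i|/asboolP[]].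
    by rewrite /q ffunE /=; split; [case: (ratP (tnth t i).1)|case: (ratP (tnth t i).2)].
  move=> s bs; apply: eU; split => // i j; rewrite (ord1 i) !mxE /ball /=.
  rewrite eE normC_normc ltcR; apply: le_lt_trans (normc_le_ReIm _) _.
  have [/= s1 s2] := bs j.
  have t1 : `|(tnth t j).1 - ratr (q j).1| < m.+1%:R^-1.
    by rewrite /q ffunE /=; case: (ratP (tnth t j).1).
  have t2 : `|(tnth t j).2 - ratr (q j).2| < m.+1%:R^-1.
    by rewrite /q ffunE /=; case: (ratP (tnth t j).2).
  apply: (@lt_trans _ _ (4 * m.+1%:R^-1)) => //.
  move: (m.+1%:R^-1 : R) s1 s2 t1 t2 => dd; rewrite !ltr_norml => s1 s2 t1 t2.
  have h1 : `|(tnth t j).1 - (tnth s j).1| < 2 * dd by rewrite ltr_norml; lra.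
  have h2 : `|(tnth t j).2 - (tnth s j).2| < 2 * dd by rewrite ltr_norml; lra.
  by have := ltrD h1 h2; rewrite -mulrDl -natrD.
apply: countable_bigcupT_measurable; first exact: countableP.
by move=> q; case: ifPn => // _; exact: mbox.
Qed.

Lemma measurable_fun_cvec (U : set V) (phi : V -> R) :
  open U -> (forall z, U z -> phi x @[x --> z] --> phi z) ->
  measurable_fun (@cvec R n @^-1` U) (fun t => phi (cvec t)).
Proof.
move=> oU cphi.
apply: (measurability _ (RGenOpens.measurableE R)).
move=> _ [_ [a [b ->] <-]].
rewrite (_ : _ `&` _ = @cvec R n @^-1` (U `&` phi @^-1` `]a, b[%classic))//.
apply: measurable_cvec_open; rewrite openE => z [Uz abz].
apply: filterI; first by move: oU; rewrite openE; exact.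
apply: cphi => //; apply: open_nbhs_nbhs; split => //.
Qed.

Lemma normc_cvg (w : C) : N y @[y --> w] --> N w.
Proof.
move=> A /nbhs_ballP[e /= e0 eA]; apply/nbhs_ballP.
exists e%:C => /=; first by rewrite ltcR.
move=> y; rewrite /ball/= normC_normc ltcR => wy; apply: eA; rewrite /ball/=.
apply: le_lt_trans wy.
have h1 := le_normcD (w - y) y; have h2 := le_normcD (y - w) w.
rewrite !subrK in h1 h2.
have h3 : N (y - w) = N (w - y) by rewrite -normcN opprB.
by rewrite ler_norml; lra.
Qed.

Lemma differentiable_normc_cvg (f : V -> C) z : differentiable f z ->
  N (f x) @[x --> z] --> N (f z).
Proof.
move=> /differentiable_continuous cf.
exact: (cvg_comp f N cf (@normc_cvg _)).
Qed.

End measurable_cvec.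

(** * Inverses of Orlicz functions *)

Section Orlicz_theory.
Context (R : realType) (psi : R -> R).
Hypothesis Opsi : Orlicz_function psi.
Local Notation inv := (Orlicz_inv psi).

Lemma Orlicz_ge0 x : 0 <= x -> 0 <= psi x.
Proof. by have [h _ _ _ _] := Opsi; exact: h. Qed.

Lemma Orlicz0 : psi 0 = 0.
Proof. by have [_ _ h _ _] := Opsi. Qed.

Lemma Orlicz_scale_lt t x : 0 < t < 1 -> 0 < x -> psi (t * x) < t * psi x.
Proof.
move=> t01 x0; have [_ cvx _ _ _] := Opsi.
have := cvx x 0 t (ltW x0) (lexx 0) _ t01.
by rewrite Orlicz0 !mulr0 !addr0; apply; rewrite gt_eqF.
Qed.

Lemma Orlicz_scale t x : 0 <= t <= 1 -> 0 <= x -> psi (t * x) <= t * psi x.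
Proof.
move=> /andP[]; rewrite le_eqVlt => /predU1P[<- _ _|t0].
  by rewrite !mul0r Orlicz0.
rewrite le_eqVlt => /predU1P[->|t1]; first by rewrite !mul1r.
rewrite le_eqVlt => /predU1P[<-|x0]; first by rewrite mulr0 Orlicz0 mulr0.
by rewrite ltW// Orlicz_scale_lt// t0.
Qed.

Lemma Orlicz_gt0 x : 0 < x -> 0 < psi x.
Proof.
move=> x0; have := @Orlicz_scale_lt (1/2) x _ x0.
have := @Orlicz_ge0 (1 / 2 * x); rewrite mulr_ge0//; [|lra].
by move=> /(_ isT) h /(_ _)/(le_lt_trans h); lra.
Qed.

Lemma Orlicz_lt x y : 0 <= x -> x < y -> psi x < psi y.
Proof.
rewrite le_eqVlt => /predU1P[<- y0|x0 xy].
  by rewrite Orlicz0 Orlicz_gt0.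
have y0 : 0 < y by lra.
have t01 : 0 < x / y < 1 by rewrite divr_gt0//= ltr_pdivrMr// mul1r.
have := Orlicz_scale_lt t01 y0; rewrite divfK ?gt_eqF// => /lt_trans; apply.
by have /andP[_ ?] := t01; rewrite gtr_pMl// Orlicz_gt0.
Qed.

Lemma Orlicz_le x y : 0 <= x -> x <= y -> psi x <= psi y.
Proof.
move=> x0; rewrite le_eqVlt => /predU1P[->//|xy].
by rewrite ltW// Orlicz_lt.
Qed.

(** Convexity and psi(0) = 0 make psi(x) / x nondecreasing. *)
Lemma Orlicz_chord x0 x : 0 < x0 -> x0 <= x -> psi x0 * x <= x0 * psi x.
Proof.
move=> x00 xx; have x_gt0 : 0 < x by lra.
have t01 : 0 <= x0 / x <= 1 by rewrite divr_ge0 ?(ltW x00) ?(ltW x_gt0)//= ler_pdivrMr// mul1r.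
have := Orlicz_scale t01 (ltW x_gt0); rewrite divfK ?gt_eqF//.
by rewrite mulrAC ler_pdivlMr.
Qed.

(** By convexity the slope over [x, x + h] is at most the slope over [x, x + 1];
    this is the continuity that [Orlicz_surj] relies on. *)
Lemma Orlicz_increment x h : 0 <= x -> 0 <= h <= 1 ->
  psi (x + h) - psi x <= h * (psi (x + 1) - psi x).
Proof.
move=> x0 /andP[]; rewrite le_eqVlt => /predU1P[<- _|h0].
  by rewrite addr0 subrr mul0r.
rewrite le_eqVlt => /predU1P[->|h1]; first by rewrite mul1r.
have [_ cvx _ _ _] := Opsi.
have := cvx (x + 1) x h _ x0 _ _; rewrite h0 h1 => /(_ _ _ isT).
have -> : h * (x + 1) + (1 - h) * x = x + h by ring.
move=> H; have {}H := H _ _; have /H{}H : 0 <= x + 1 by lra.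
have {}H : psi (x + h) < h * psi (x + 1) + (1 - h) * psi x.
  by apply: H; apply/eqP; lra.
lra.
Qed.

(** As psi(x) >= x for x large, the set where psi <= y is bounded, and
    [Orlicz_increment] shows that psi takes the value y at its supremum. *)
Lemma Orlicz_surj y : 0 <= y -> exists2 x, 0 <= x & psi x = y.
Proof.
move=> y0; have [_ _ _ _ gr] := Opsi.
have [b b0 yb] : exists2 b, 0 < b & y <= psi b.
  have [M [Mr HM]] : \forall x \near +oo, 1 <= psi x / x by move/cvgryPge : gr; exact.
  pose b := Num.max (Num.max M 0 + 1) (y + 1).
  have b0 : 0 < b by rewrite lt_max ltr_wpDl// le_max lexx orbT.
  have Mb : M < b by rewrite lt_max ltr_pwDr// le_max lexx.
  exists b => //; have := HM _ Mb; rewrite ler_pdivlMr// mul1r; apply: le_trans.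
  by rewrite /b le_max lerDl ler01 orbT.
pose A := [set x | 0 <= x /\ psi x <= y].
have A0 : A 0 by split; rewrite ?Orlicz0.
have Ab x : A x -> x <= b.
  move=> [x0 xy]; rewrite leNgt; apply/negP => bx.
  by have := Orlicz_lt (ltW b0) bx; lra.
have supA : has_sup A by split; [exists 0|exists b => x; exact: Ab].
pose s := sup A.
have s0 : 0 <= s by apply: ub_le_sup => //; exact: supA.2.
exists s => //; apply/eqP; rewrite eq_le; apply/andP; split.
- apply/ler_addgt0Pr => e e0.
  have D0 : 0 <= psi (s + 1) by apply: Orlicz_ge0; lra.
  pose h := Num.min 1 (e / (psi (s + 1) + 1)).
  have h0 : 0 < h by rewrite lt_min ltr01 divr_gt0//; lra.
  have h1 : h <= 1 by rewrite ge_min lexx.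
  have h2 : h * (psi (s + 1) + 1) <= e.
    by rewrite -ler_pdivlMr; [rewrite ge_min lexx orbT|lra].
  have [x [x0 xy] sx] := sup_adherent h0 supA.
  have {}sx : s - h < x by exact: sx.
  have xs : x <= s by apply: ub_le_sup => //; exact: supA.2.
  have := @Orlicz_increment x (s - x) x0; rewrite (addrC x) subrK.
  have /[swap]/[apply] : 0 <= s - x <= 1 by lra.
  have p0 := Orlicz_ge0 x0.
  have p1 : psi (x + 1) <= psi (s + 1) by apply: Orlicz_le; lra.
  have h3 : (s - x) * (psi (x + 1) - psi x) <= h * (psi (s + 1) + 1).
    apply: ler_pM; [lra| |lra|lra].
    by rewrite subr_ge0; apply: Orlicz_le; lra.
  lra.
- apply/ler_addgt0Pr => e e0.
  have D0 : 0 <= psi (s + 1) by apply: Orlicz_ge0; lra.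
  pose h := Num.min 1 (e / (psi (s + 1) + 1)).
  have h0 : 0 < h by rewrite lt_min ltr01 divr_gt0//; lra.
  have h1 : h <= 1 by rewrite ge_min lexx.
  have h2 : h * (psi (s + 1) + 1) <= e.
    by rewrite -ler_pdivlMr; [rewrite ge_min lexx orbT|lra].
  have nA : ~ A (s + h).
    by move=> /(ub_le_sup supA.2); rewrite -/s; lra.
  have ysh : y < psi (s + h).
    by rewrite ltNge; apply/negP => hh; apply: nA; split => //; lra.
  have := @Orlicz_increment s h s0; rewrite h1 (ltW h0) => /(_ isT).
  have p0 := Orlicz_ge0 s0.
  have h3 : h * (psi (s + 1) - psi s) <= h * (psi (s + 1) + 1).
    by apply: ler_wpM2l; lra.
  lra.
Qed.

Lemma Orlicz_inj : {in [set x | 0 <= x] &, injective psi}.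
Proof.
move=> x y; rewrite !inE/= => x0 y0 xy; case: (ltgtP x y) => // h.
  by have := Orlicz_lt x0 h; rewrite xy ltxx.
by have := Orlicz_lt y0 h; rewrite xy ltxx.
Qed.

Lemma Orlicz_invP y : 0 <= y -> 0 <= inv y /\ psi (inv y) = y.
Proof.
move=> /Orlicz_surj[x x0 <-].
by rewrite /Orlicz_inv (pinvKV _ Orlicz_inj)// inE.
Qed.

Lemma Orlicz_inv_ge0 y : 0 <= y -> 0 <= inv y.
Proof. by move=> /Orlicz_invP[]. Qed.

Lemma Orlicz_invK y : 0 <= y -> psi (inv y) = y.
Proof. by move=> /Orlicz_invP[]. Qed.

Lemma Orlicz_inv_gt0 y : 0 < y -> 0 < inv y.
Proof.
move=> y0; rewrite lt_def Orlicz_inv_ge0 ?ltW// andbT.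
by apply/eqP => h; have := Orlicz_invK (ltW y0); rewrite h Orlicz0; lra.
Qed.

Lemma Orlicz_inv_le_psi y x : 0 <= y -> 0 <= x -> y <= psi x -> inv y <= x.
Proof.
move=> y0 x0 yx; rewrite leNgt; apply/negP => h.
by have := Orlicz_lt x0 h; rewrite Orlicz_invK//; lra.
Qed.

Lemma Orlicz_inv_le y y' : 0 <= y -> y <= y' -> inv y <= inv y'.
Proof.
move=> y0 yy; have y'0 := le_trans y0 yy.
by apply: Orlicz_inv_le_psi; rewrite ?Orlicz_invK// Orlicz_inv_ge0.
Qed.

(** The inverse is concave and vanishes at 0. *)
Lemma Orlicz_inv_scale K y : 1 <= K -> 0 <= y -> inv (K * y) <= K * inv y.
Proof.
move=> K1 y0; have K0 : 0 < K by lra.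
have i0 := Orlicz_inv_ge0 y0.
apply: Orlicz_inv_le_psi; [by rewrite mulr_ge0// ltW|by rewrite mulr_ge0// ltW|].
have t01 : 0 <= K^-1 <= 1 by rewrite invr_ge0 ltW//= invf_le1.
have Ky0 : 0 <= K * inv y by apply: mulr_ge0 => //; exact: ltW.
have := Orlicz_scale t01 Ky0; rewrite mulKf ?gt_eqF// Orlicz_invK//.
by rewrite mulrC ler_pdivlMr// mulrC.
Qed.

Hypothesis Dpsi : Delta2_up psi.

(** The Delta^2 condition, read on the inverse, gives the inequality when
    psi^-1(y) is large; on the remaining bounded range of y, the right-hand side
    is bounded below and the left-hand side above. *)
Lemma Orlicz_inv_sqr : exists2 C, 1 <= C &
  forall y, 1 <= y -> inv (y ^+ 2) <= C * inv y.
Proof.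
have [C0 C00 [M [Mr HM]]] := Dpsi.
(* A positive threshold beyond which the inequality of the condition holds. *)
pose X := Num.max M 0 + 1.
have X0 : 0 < X by rewrite ltr_wpDl// le_max lexx orbT.
have MX : M < X by rewrite ltr_pwDr// le_max lexx.
have i1 : 0 < inv 1 by exact: Orlicz_inv_gt0.
pose C := Num.max (Num.max 1 C0) (inv (psi X ^+ 2) / inv 1).
have C1 : 1 <= C by rewrite !le_max lexx.
exists C => // y y1; have y0 : 0 <= y by lra.
have iy : inv 1 <= inv y by exact: Orlicz_inv_le.
have iy0 := Orlicz_inv_ge0 y0.
have [Xy|yX] := leP X (inv y).
  apply: Orlicz_inv_le_psi; [by rewrite exprn_ge0|by rewrite mulr_ge0//; lra|].
  have := HM _ (lt_le_trans MX Xy); rewrite Orlicz_invK// => /le_trans; apply.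
  apply: Orlicz_le; first by rewrite mulr_ge0// ltW.
  by apply: ler_wpM2r => //; rewrite !le_max lexx !orbT.
apply: (@le_trans _ _ (inv (psi X ^+ 2))).
  apply: Orlicz_inv_le; first by rewrite exprn_ge0.
  have yp : y <= psi X by rewrite -(Orlicz_invK y0); apply: Orlicz_le => //; exact: ltW.
  by rewrite ler_sqr// nnegrE ?(le_trans y0 yp).
apply: (@le_trans _ _ (C * inv 1)).
  by rewrite -ler_pdivrMr// le_max lexx orbT.
by apply: ler_wpM2l => //; lra.
Qed.

(** m squarings raise y to the power 2 ^ m >= m. *)
Lemma Orlicz_inv_expn m : exists2 C, 1 <= C &
  forall y, 1 <= y -> inv (y ^+ m) <= C * inv y.
Proof.
have [C C1 HC] := Orlicz_inv_sqr.
have H k : exists2 D, 1 <= D & forall y, 1 <= y -> inv (y ^+ (2 ^ k)) <= D * inv y.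
  elim: k => [|k [D D1 HD]].
    by exists 1 => // y y1; rewrite expn0 expr1 mul1r.
  exists (C * D); first by apply: (le_trans C1); apply: ler_peMr => //; lra.
  move=> y y1; rewrite expnSr exprM.
  apply: le_trans (HC _ _) _; first exact: exprn_ege1.
  by rewrite -mulrA; apply: ler_wpM2l; [lra|exact: HD].
(* The crude bound m <= 2 ^ m suffices. *)
have [D D1 HD] := H m; exists D => // y y1.
apply: le_trans (HD _ y1); apply: Orlicz_inv_le; first by rewrite exprn_ge0//; lra.
by apply: ler_weXn2l => //; apply: ltnW; exact: ltn_expl.
Qed.

(** Polynomial changes of the argument cost a constant factor only. All powers of
    1 / (1 - |z|) that occur in the sequel are absorbed in this way. *)
Lemma Orlicz_inv_poly K m : 0 <= K -> exists2 C, 1 <= C &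
  forall y y', 1 <= y -> 0 <= y' -> y' <= K * y ^+ m -> inv y' <= C * inv y.
Proof.
move=> K0; have [C C1 HC] := Orlicz_inv_expn m.
have K1 : 1 <= K + 1 by lra.
exists ((K + 1) * C); first by apply: (le_trans K1); apply: ler_peMr => //; lra.
move=> y y' y1 y'0 yy.
have p0 : 0 <= y ^+ m by rewrite exprn_ge0//; lra.
apply: (@le_trans _ _ (inv ((K + 1) * y ^+ m))).
  by apply: Orlicz_inv_le => //; lra.
apply: le_trans (Orlicz_inv_scale K1 p0) _.
by rewrite -mulrA; apply: ler_wpM2l; [lra|exact: HC].
Qed.

(** The power estimate read backwards: 1 / (1 - |z|) may be replaced by one of its
    powers with exponent so small that it is integrable over the ball. *)
Lemma Orlicz_inv_root e : 0 < e -> exists2 C, 1 <= C &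
  forall y, 1 <= y -> inv y <= C * inv (y `^ e).
Proof.
move=> e0.
(* For e >= 1 / m, y is the m-th power of y ^ (1 / m) <= y ^ e. *)
pose m := (Num.truncn e^-1).+1.
have me : e^-1 < m%:R by exact: truncnS_gt.
have m0 : 0 < m%:R :> R by rewrite ltr0n.
have [C C1 HC] := Orlicz_inv_expn m; exists C => // y y1.
have y0 : 0 < y by lra.
have mi0 : 0 <= m%:R^-1 :> R by rewrite invr_ge0 ltW.
have ye1 : 1 <= y `^ m%:R^-1 by have := ler_powR y1 mi0; rewrite powRr0.
have := HC _ ye1; rewrite -powR_mulrn ?powR_ge0// -powRrM mulVf ?gt_eqF// powRr1; last exact: ltW.
move=> /le_trans; apply; apply: ler_wpM2l; first by lra.
apply: Orlicz_inv_le; first exact: powR_ge0.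
by apply: ler_powR => //; rewrite invf_ple ?posrE//; exact: ltW.
Qed.

End Orlicz_theory.

(** * Integrability of powers of the distance to the sphere *)

Section cut_power.
Context (R : realType).
Local Notation mu := (@lebesgue_measure R).
Local Notation mR := (measurableTypeR R).
Implicit Types (s g : R).

(** A power extended by 0, so that integrals over balls become integrals over the
    whole space, to which Fubini's theorem applies coordinate by coordinate. *)
Definition cut_pow g s : R := if 0 < s then s `^ g else 0.

Lemma cut_pow_ge0 g s : 0 <= cut_pow g s.
Proof. by rewrite /cut_pow; case: ifP => // _; exact: powR_ge0. Qed.

Lemma measurable_cut_pow g : measurable_fun setT (cut_pow g : mR -> mR).
Proof.
apply: measurable_fun_ifT => //.
by apply: (@measurable_fun_ltr _ _ _ _ (cst 0) id).
Qed.

Lemma is_derive_sub_powR (A g x : R) : 0 < g + 1 -> x < A ->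
  is_derive x (1 : R) (fun y => - ((A - y) `^ (g + 1) / (g + 1))) ((A - x) `^ g).
Proof.
move=> g0 xA; have Ax : 0 < A - x by rewrite subr_gt0.
have d1 := @is_derive1_powR R (g + 1) (A - x) Ax.
have d2 : is_derive x (1 : R) (fun y => A - y) (-1).
  have h := is_deriveB (is_derive_cst A x (1 : R)) (is_derive_id x (1 : R)).
  by rewrite sub0r in h; exact: h.
have d3 : is_derive x (1 : R) ((fun y => y `^ (g + 1)) \o (fun y => A - y))
    ((g + 1) * (A - x) `^ (g + 1 - 1) * -1).
  exact: (@is_derive1_comp R _ (fun y => A - y) x).
have d4 := is_deriveZ (- (g + 1)^-1) d3.
have -> : (A - x) `^ g = (- (g + 1)^-1) *: ((g + 1) * (A - x) `^ (g + 1 - 1) * -1).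
  by rewrite addrK /GRing.scale/=; field; rewrite gt_eqF.
suff <- : (- (g + 1)^-1) *: ((fun y => y `^ (g + 1)) \o (fun y => A - y)) =
  (fun y => - ((A - y) `^ (g + 1) / (g + 1))) by exact: d4.
by apply/funext => y; rewrite [LHS](_ : _ = - (g + 1)^-1 * (A - y) `^ (g + 1))// mulNr mulrC.
Qed.

(** An antiderivative is - (A - x) ^ (g + 1) / (g + 1), away from the singularity
    at A; monotone convergence along the segments [0, A - A / (n + 2)] concludes. *)
Lemma integral_sub_powR_le (A g : R) : 0 < A -> -1 < g ->
  (\int[mu]_(x in `[0%R, A[) ((A - x) `^ g)%:E <=
     (A `^ (g + 1) / (g + 1))%:E)%E.
Proof.
move=> A0 g1; have g0 : 0 < g + 1 by lra.
pose F (n : nat) : set mR := `[0, A - A / n.+2%:R]%classic.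
have An (n : nat) : 0 < A / n.+2%:R < A.
  by rewrite divr_gt0 ?ltr0n//= ltr_pdivrMr ?ltr0n// ltr_pMr// ltr1n.
have mpow : measurable_fun setT (fun x : mR => ((A - x) `^ g)%:E).
  apply/measurable_EFinP; apply: (measurableT_comp (measurable_powR _)).
  exact: measurable_funB.
have ndF : nondecreasing_seq F.
  move=> m n mn; apply/subsetPset => x; rewrite /F/= !in_itv/= => /andP[-> /le_trans->]//.
  by rewrite lerD2l lerN2 ler_pM2l// lef_pV2 ?posrE ?ltr0n// ler_nat ltnS.
have H := @ge0_nondecreasing_set_cvg_integral _ _ R F (fun x => ((A - x) `^ g)%:E) mu
  ndF _ _ _.
have {}H : (\int[mu]_(x in F i) ((A - x) `^ g)%:E @[i --> \oo] -->
    \int[mu]_(x in \bigcup_i F i) ((A - x) `^ g)%:E)%E.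
  apply: H => [i|i|i x _]; [exact: measurable_itv|exact: measurable_funTS|].
  by rewrite lee_fin powR_ge0.
have -> : `[0%R, A[%classic = \bigcup_i F i.
  apply/seteqP; split => x; last first.
    move=> [n _]; rewrite /F/= !in_itv/= => /andP[-> h]/=.
    by apply: le_lt_trans h _; rewrite gtrBl; have /andP[] := An n.
  rewrite /= in_itv/= => /andP[x0 xA].
  have e0 : 0 < (A - x) / A by rewrite divr_gt0// subr_gt0.
  have [k] := near_infty_natSinv_lt (PosNum e0).
  move=> _ /(_ k.+1 (leqnSn k))/= hk; exists k => //.
  rewrite /F/= in_itv/= x0/= lerBrDr -lerBrDl.
  by move: hk; rewrite ltr_pdivlMr// mulrC => /ltW.
rewrite -(cvg_lim _ H)//; apply: lime_le; first by apply/cvg_ex; eexists; exact: H.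
apply: nearW => n; rewrite /F.
have [a1 a2] := andP (An n).
have ltA x : x <= A - A / n.+2%:R -> x < A.
  by move=> h; apply: le_lt_trans h _; rewrite gtrBl.
rewrite (@continuous_FTC2 _ _ (fun y => - ((A - y) `^ (g + 1) / (g + 1)))).
- rewrite subr0 -EFinB lee_fin opprK addrC gerBl divr_ge0 ?powR_ge0//.
  exact: ltW.
- by rewrite subr_gt0.
- apply: continuous_in_subspaceT => x; rewrite inE/= in_itv/= => /andP[x0 xA].
  have Ax : 0 < A - x by rewrite subr_gt0; exact: ltA.
  apply: (@continuous_comp _ _ _ (fun y => A - y) (fun y => y `^ g)).
    by apply: cvgB; [exact: cvg_cst|exact: cvg_id].
  have [+ _] := @is_derive1_powR R g (A - x) Ax.
  by move/derivable1_diffP/differentiable_continuous.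
- have dF x : x < A -> {for x, continuous (fun y => - ((A - y) `^ (g + 1) / (g + 1)))}.
    move=> xA; have [+ _] := is_derive_sub_powR g0 xA.
    by move/derivable1_diffP/differentiable_continuous.
  split.
  + move=> x; rewrite in_itv/= => /andP[x0 xA].
    have xA' : x < A by apply: ltA; exact: ltW.
    by have [] := is_derive_sub_powR g0 xA'.
  + by apply: cvg_at_right_filter; apply: dF.
  + by apply: cvg_at_left_filter; apply: dF; exact: ltA.
- move=> x; rewrite in_itv/= => /andP[x0 xA].
  have xA' : x < A by apply: ltA; exact: ltW.
  rewrite derive1E; by have [_ ->] := is_derive_sub_powR g0 xA'.
Qed.

(** For A = sqrt s and 0 <= x <= A one has s - x ^ 2 = (A - x) (A + x) >= A (A - x),
    and the power g reverses the inequality because g <= 0. *)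
Lemma integral_cut_pow_sqr_le g s : -1 < g -> g <= 0 ->
  (\int[mu]_x (cut_pow g (s - x ^+ 2))%:E <=
     (2 / (g + 1) * cut_pow (g + 1/2) s)%:E)%E.
Proof.
move=> g1 g0.
have f0 x : 0 <= cut_pow g (s - x ^+ 2) by exact: cut_pow_ge0.
have mf : measurable_fun setT (fun x : mR => (cut_pow g (s - x ^+ 2))%:E).
  apply/measurable_EFinP; apply: (measurableT_comp (measurable_cut_pow _)).
  by apply: measurable_funB => //; exact: measurable_funX.
have [s0|s0] := ltP 0 s; last first.
  rewrite {2}/cut_pow ltNge s0/= mulr0 (eq_integral (cst 0%E)) ?integral0//.
  move=> x _; rewrite /cut_pow ifF//; apply/negbTE; rewrite -leNgt.
  by rewrite subr_le0; apply: le_trans s0 _; exact: sqr_ge0.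
pose A := Num.sqrt s.
have A0 : 0 < A by rewrite sqrtr_gt0.
have A2 : A ^+ 2 = s by rewrite sqr_sqrtr// ltW.
have half : (\int[mu]_(x in `[0%R, +oo[) (cut_pow g (s - x ^+ 2))%:E <=
     (A `^ g * (A `^ (g + 1) / (g + 1)))%:E)%E.
  have -> : (\int[mu]_(x in `[0%R, +oo[) (cut_pow g (s - x ^+ 2))%:E =
      \int[mu]_(x in `[0%R, A[) (cut_pow g (s - x ^+ 2))%:E)%E.
    rewrite [LHS]integral_mkcond [RHS]integral_mkcond.
    apply: eq_integral => x _; rewrite !patchE !mem_setE !in_itv/= andbT.
    case: (leP 0 x) => //= x0; case: ltP => // Ax.
    rewrite /cut_pow ifF//; apply/negbTE; rewrite -leNgt subr_le0 -A2.
    by rewrite ler_sqr ?nnegrE// ltW.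
  rewrite EFinM; apply: (@le_trans _ _ ((A `^ g)%:E * \int[mu]_(x in `[0%R, A[) ((A - x) `^ g)%:E)%E); last first.
    apply: lee_wpmul2l; first by rewrite lee_fin powR_ge0.
    exact: integral_sub_powR_le.
  rewrite -ge0_integralZl_EFin//; last 3 first.
  - by move=> x _; rewrite lee_fin powR_ge0.
  - apply: measurable_funTS; apply/measurable_EFinP.
    apply: (measurableT_comp (measurable_powR _)); exact: measurable_funB.
  - exact: powR_ge0.
  apply: ge0_le_integral_nonmeasurable => x /=; rewrite in_itv/= => /andP[x0 xA].
    by rewrite lee_fin.
  rewrite -EFinM lee_fin -powRM; [|lra|lra].
  have x2 : 0 < s - x ^+ 2 by rewrite -A2 subr_sqr mulr_gt0//; lra.
  rewrite /cut_pow x2 -[g]opprK !(powRN _ (- g)).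
  have AA : 0 < A * (A - x) by rewrite mulr_gt0//; lra.
  rewrite lef_pV2 ?posrE ?powR_gt0//.
  apply: ge0_ler_powR; rewrite ?nnegrE ?(ltW AA) ?(ltW x2)//; first by lra.
  rewrite -A2 subr_sqr mulrC; apply: ler_wpM2l; lra.
have -> : (2 / (g + 1) * cut_pow (g + 1 / 2) s)%:E =
    ((A `^ g * (A `^ (g + 1) / (g + 1)))%:E + (A `^ g * (A `^ (g + 1) / (g + 1)))%:E)%E.
  rewrite -EFinD; congr EFin.
  have -> : cut_pow (g + 1/2) s = A `^ g * A `^ (g + 1).
    rewrite /cut_pow s0 -powRD; last by rewrite (gt_eqF A0) implybT.
    rewrite -[in LHS]A2 -powR_mulrn ?ltW// -powRrM; congr (_ `^ _); lra.
  by field; rewrite gt_eqF//; lra.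
rewrite (_ : setT = `[0%R, +oo[%classic `|` `]-oo, 0%R[%classic :> set mR); last first.
  by apply/seteqP; split => // x _ /=; rewrite !in_itv/= andbT; case: (leP 0 x); [left|right].
rewrite ge0_integral_setU//=; last 3 first.
  exact: measurable_funTS.
  by move=> x _; rewrite lee_fin.
  rewrite disj_set2E; apply/eqP/seteqP; split => // x [/=]; rewrite !in_itv/= andbT => x0 x1; lra.
apply: leeD; first exact: half.
apply: le_trans half.
have fE0 x : (0 <= (cut_pow g (s - x ^+ 2))%:E)%E by rewrite lee_fin.
rewrite (ge0_integration_by_substitution0 mf fE0).
apply: (@le_trans _ _ (\int[mu]_(x in `]-oo, 0%R]) (cut_pow g (s - x ^+ 2))%:E)%E).
  apply: ge0_subset_integral => //.
  - exact: measurable_funTS.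
  - by move=> x /=; rewrite !in_itv/=; exact: ltW.
apply: ge0_le_integral_nonmeasurable => x _; first by rewrite lee_fin.
by rewrite sqrrN.
Qed.

(** Each of the two integrations raises the exponent by 1 / 2, from b to b + 1,
    which is positive; the bound b <= - 1 / 2 keeps the exponents being integrated
    nonpositive, as [integral_cut_pow_sqr_le] requires. *)
Lemma integral_plane_cut_pow b : -1 < b -> b <= - (1/2) -> exists2 K : R, 0 <= K &
  forall s, s <= 1 ->
  (\int[@lebesgue_R2 R]_p (cut_pow b (s - (p.1 ^+ 2 + p.2 ^+ 2)))%:E <=
    (if (0 < s)%R then K%:E else 0))%E.
Proof.
move=> b1 b2; exists (2 / (b + 1) * (2 / (b + 1/2 + 1))).
  by apply: mulr_ge0; apply: divr_ge0; lra.
move=> s s1.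
have mf : measurable_fun setT (fun p : mR * mR => (cut_pow b (s - (p.1 ^+ 2 + p.2 ^+ 2)))%:E).
  apply/measurable_EFinP; apply: (measurableT_comp (measurable_cut_pow _)).
  apply: measurable_funB => //; apply: measurable_funD; apply: measurable_funX.
    exact: measurable_fst.
  exact: measurable_snd.
rewrite [leLHS](fubini_tonelli2 _ mf); last by move=> p; rewrite lee_fin cut_pow_ge0.
apply: (@le_trans _ _ (\int[mu]_y ((2 / (b + 1))%:E * (cut_pow (b + 1/2) (s - y ^+ 2))%:E))%E).
  apply: ge0_le_integral_nonmeasurable => y _.
    by apply: integral_ge0 => x _; rewrite lee_fin cut_pow_ge0.
  rewrite /fubini_G /= -EFinM; apply: le_trans (integral_cut_pow_sqr_le (s - y ^+ 2) b1 _); last by lra.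
  rewrite le_eqVlt; apply/orP; left; apply/eqP; apply: eq_integral => x _ /=.
  by congr (cut_pow _ _)%:E; ring.
have h2 : 0 <= 2 / (b + 1) by apply: divr_ge0; lra.
rewrite ge0_integralZl_EFin//; last 2 first.
- by move=> x _; rewrite lee_fin cut_pow_ge0.
- apply/measurable_EFinP; apply: (measurableT_comp (measurable_cut_pow _)).
  by apply: measurable_funB => //; exact: measurable_funX.
apply: (@le_trans _ _ ((2 / (b + 1))%:E * (2 / (b + 1/2 + 1) * cut_pow (b + 1/2 + 1/2) s)%:E)%E).
  apply: lee_wpmul2l; first by rewrite lee_fin.
  by apply: integral_cut_pow_sqr_le; lra.
rewrite /cut_pow; case: ltP => s0; last by rewrite mulr0 mule0.
rewrite -EFinM lee_fin; apply: ler_wpM2l => //; apply: ler_piMr.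
  by apply: divr_ge0; lra.
have s01 : 0 < s <= 1 by rewrite s0.
have b0 : 0 <= b + 1/2 + 1/2 by lra.
by have := ger_powR s01 b0; rewrite powRr0.
Qed.

End cut_power.

(** * The Hermitian norm and volumes *)

Section hermitian_norm_theory.
Context (R : realType) (n : nat).
Local Notation N := (@Normc.normc R).
Local Notation C := (R[i]^o).
Local Notation V := 'rV[R[i]]_n.
Local Notation hn := (@hermitian_norm R n).
Local Notation plane := (measurableTypeR R * measurableTypeR R)%type.
Implicit Types (z w a : V).

Lemma sum_sqr_ge0 (x : 'I_n -> R) : 0 <= \sum_k x k ^+ 2.
Proof. by apply: sumr_ge0 => k _; exact: sqr_ge0. Qed.

Lemma hermitian_norm_ge0 z : 0 <= hn z.
Proof. exact: sqrtr_ge0. Qed.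

Lemma sqr_hermitian_norm z : hn z ^+ 2 = \sum_k N (z ord0 k) ^+ 2.
Proof. by rewrite sqr_sqrtr// sum_sqr_ge0. Qed.

(** The quadratic polynomial in t which is the sum of the (x_k t - y_k) ^ 2 is
    nonnegative. *)
Lemma cauchy_schwarz_sum (x y : 'I_n -> R) :
  \sum_k x k * y k <= Num.sqrt (\sum_k x k ^+ 2) * Num.sqrt (\sum_k y k ^+ 2).
Proof.
set X := \sum_k x k ^+ 2; set Y := \sum_k y k ^+ 2.
have X0 : 0 <= X by exact: sum_sqr_ge0.
have Y0 : 0 <= Y by exact: sum_sqr_ge0.
set S := \sum_k x k * y k.
have quad t : 0 <= X * t ^+ 2 - 2 * S * t + Y.
  have -> : X * t ^+ 2 - 2 * S * t + Y = \sum_k (x k * t - y k) ^+ 2.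
    rewrite /X /S /Y mulr_suml mulr_sumr mulr_suml -sumrB -big_split/=.
    by apply: eq_bigr => k _; ring.
  exact: sum_sqr_ge0.
apply: le_trans (ler_norm _) _.
rewrite -sqrtr_sqr -sqrtrM// ler_sqrt ?mulr_ge0//.
have [X_eq0|X_neq0] := eqVneq X 0.
  have [->|S0] := eqVneq S 0; first by rewrite expr0n/= mulr_ge0.
  have := quad ((Y + 1) / (2 * S)); rewrite X_eq0 mul0r.
  have -> : 2 * S * ((Y + 1) / (2 * S)) = Y + 1 by field.
  lra.
have Xp : 0 < X by rewrite lt_def X_neq0.
have := quad (S / X).
have -> : X * (S / X) ^+ 2 - 2 * S * (S / X) + Y = Y - S ^+ 2 / X by field.
by rewrite subr_ge0 ler_pdivrMr// mulrC.
Qed.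

Lemma hermitian_norm_inner z a :
  N (\sum_k z ord0 k * conjc (a ord0 k)) <= hn z * hn a.
Proof.
have normc_sum (F : 'I_n -> R[i]) : N (\sum_k F k) <= \sum_k N (F k).
  elim/big_ind2 : _ => //; first by rewrite [N 0]Normc.normc0.
  by move=> x1 x2 y1 y2 h1 h2; apply: le_trans (le_normcD _ _) (lerD h1 h2).
apply: le_trans (normc_sum _) _.
have := cauchy_schwarz_sum (fun k => N (z ord0 k)) (fun k => N (a ord0 k)).
apply: le_trans; apply: ler_sum => k _; rewrite Normc.normcM.
by rewrite (_ : N (conjc _) = N (a ord0 k))//; case: (a ord0 k) => u v /=; rewrite sqrrN.
Qed.

Lemma ler_hermitian_normD z w : hn (z + w) <= hn z + hn w.
Proof.
rewrite -ler_sqr ?nnegrE ?addr_ge0 ?hermitian_norm_ge0//.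
have E : (hn z + hn w) ^+ 2 = hn z ^+ 2 + hn w ^+ 2 + 2 * (hn z * hn w) by ring.
rewrite E !sqr_hermitian_norm.
have := cauchy_schwarz_sum (fun k => N (z ord0 k)) (fun k => N (w ord0 k)).
rewrite -/(hn z) -/(hn w) => CS.
apply: (@le_trans _ _ (\sum_k (N (z ord0 k) + N (w ord0 k)) ^+ 2)).
  apply: ler_sum => k _; rewrite mxE ler_sqr ?nnegrE ?addr_ge0 ?normc_ge0//.
  exact: le_normcD.
have -> : \sum_k (N (z ord0 k) + N (w ord0 k)) ^+ 2 =
   \sum_k N (z ord0 k) ^+ 2 + \sum_k N (w ord0 k) ^+ 2 +
   2 * \sum_k N (z ord0 k) * N (w ord0 k).
  rewrite mulr_sumr -!big_split/=; apply: eq_bigr => k _; ring.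
rewrite lerD2l; apply: ler_wpM2l => //.
Qed.

Lemma hermitian_normZ (c : R[i]) z : hn (c *: z) = N c * hn z.
Proof.
rewrite /hermitian_norm -[N c]ger0_norm ?normc_ge0// -sqrtr_sqr -sqrtrM ?sqr_ge0//.
congr Num.sqrt; rewrite mulr_sumr; apply: eq_bigr => k _.
by rewrite mxE Normc.normcM exprMn.
Qed.

Lemma normc_le_hermitian_norm z k : N (z ord0 k) <= hn z.
Proof.
rewrite -ler_sqr ?nnegrE ?hermitian_norm_ge0 ?normc_ge0// sqr_hermitian_norm.
by rewrite (bigD1 k)//= lerDl; apply: sumr_ge0 => i _; exact: sqr_ge0.
Qed.

Lemma hermitian_norm_le_sum z : hn z <= \sum_k N (z ord0 k).
Proof.
have S0 : 0 <= \sum_k N (z ord0 k) by apply: sumr_ge0 => k _; exact: normc_ge0.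
rewrite -ler_sqr ?nnegrE ?hermitian_norm_ge0// sqr_hermitian_norm.
rewrite expr2 mulr_suml; apply: ler_sum => k _; rewrite expr2.
apply: ler_wpM2l; first exact: normc_ge0.
by rewrite (bigD1 k)//= lerDl; apply: sumr_ge0 => i _; exact: normc_ge0.
Qed.

Lemma hermitian_norm0 : hn 0 = 0.
Proof.
apply/eqP; rewrite eq_le hermitian_norm_ge0 andbT.
apply: le_trans (hermitian_norm_le_sum _) _.
by rewrite big1// => k _; rewrite mxE; exact: Normc.normc0.
Qed.

Definition sqnorm (t : n.-tuple plane) : R :=
  \sum_(i < n) ((tnth t i).1 ^+ 2 + (tnth t i).2 ^+ 2).

Lemma sqr_hermitian_norm_cvec t : hn (cvec t) ^+ 2 = sqnorm t.
Proof.
rewrite sqr_hermitian_norm; apply: eq_bigr => k _; rewrite mxE/=.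
by rewrite sqr_sqrtr// addr_ge0// sqr_ge0.
Qed.

Lemma unit_ballE z : unit_ball z <-> hn z ^+ 2 < 1.
Proof.
rewrite /unit_ball/= -{2}(expr1n _ 2) ltr_sqr ?nnegrE// hermitian_norm_ge0//.
Qed.

Lemma measurable_sqnorm : measurable_fun [set: n.-tuple plane] sqnorm.
Proof.
apply: measurable_sum => i; apply: measurable_funD; apply: measurable_funX.
  exact: (measurableT_comp measurable_fst (measurable_tnth i)).
exact: (measurableT_comp measurable_snd (measurable_tnth i)).
Qed.

Lemma measurable_ball_cvec : measurable (@cvec R n @^-1` @unit_ball R n).
Proof.
have -> : @cvec R n @^-1` @unit_ball R n = sqnorm @^-1` `]-oo, 1[%classic.
  apply/seteqP; split => t /=; rewrite in_itv/= -sqr_hermitian_norm_cvec.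
    by move/unit_ballE.
  by move=> ?; apply/unit_ballE.
rewrite -[X in measurable X]setTI; apply: measurable_sqnorm => //.
Qed.

End hermitian_norm_theory.

Section tuple_integrals.
Context (R : realType).
Local Notation plane := (measurableTypeR R * measurableTypeR R)%type.

Lemma sqnorm_cons n p (t : n.-tuple plane) :
  sqnorm (cons_pair (p, t)) = p.1 ^+ 2 + p.2 ^+ 2 + sqnorm t.
Proof.
rewrite /sqnorm big_ord_recl tnth0/=; congr (_ + _).
by apply: eq_bigr => i _; rewrite tnthS.
Qed.

Lemma measurable_polysquare n (a : n.-tuple plane) r : measurable (polysquare a r).
Proof.
have -> : polysquare a r = \bigcap_(i in [set: 'I_n])
   ((fun t : n.-tuple plane => (tnth t i).1) @^-1` `[(tnth a i).1 - r, (tnth a i).1 + r]%classic `&`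
    (fun t : n.-tuple plane => (tnth t i).2) @^-1` `[(tnth a i).2 - r, (tnth a i).2 + r]%classic).
  apply/seteqP; split => [t ta i _|t ta i].
    by have [h1 h2] := ta i; split; rewrite /= in_itv.
  by have [/= h1 h2] := ta i I; rewrite !in_itv/= in h1 h2.
apply: fin_bigcap_measurable => // i _; apply: measurableI.
  rewrite -[X in measurable X]setTI.
  exact: (measurableT_comp measurable_fst (measurable_tnth i)).
rewrite -[X in measurable X]setTI.
exact: (measurableT_comp measurable_snd (measurable_tnth i)).
Qed.

Lemma volume_polysquare n (a : n.-tuple plane) r : 0 <= r ->
  lebesgue_C R n (polysquare a r) = (((2 * r) ^+ 2) ^+ n)%:E.
Proof.
move=> r0; elim: n a => [|n IH] a.
  rewrite expr0 /lebesgue_C /= diracE mem_set// => -[] //.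
case/tupleP: a => p a; rewrite /lebesgue_C /=.
have -> : [tuple of p :: a] = cons_pair (p, a) by [].
pose sq : set plane := `[p.1 - r, p.1 + r]%classic `*` `[p.2 - r, p.2 + r]%classic.
rewrite [LHS](_ : _ = (@lebesgue_R2 R \x lebesgue_C R n)%E (sq `*` polysquare a r)).
  rewrite product_measure1E; [|exact: measurableX|exact: measurable_polysquare].
  rewrite IH [X in (X * _)%E](_ : _ = ((2 * r) ^+ 2)%:E).
    by rewrite (exprS ((2 * r) ^+ 2) n) EFinM.
  rewrite [LHS](_ : _ = (@lebesgue_measure R \x @lebesgue_measure R)%E
     (`[p.1 - r, p.1 + r]%classic `*` `[p.2 - r, p.2 + r]%classic))//.
  rewrite product_measure1E//= !lebesgue_measure_itv/= !lte_fin.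
  have itv (x : R) : (if x - r < x + r then ((x + r)%:E - (x - r)%:E)%E else 0%E) = (2 * r)%:E.
    case: ltP => [_|h]; first by rewrite -EFinB; congr EFin; ring.
    by congr EFin; lra.
  by rewrite !itv expr2 EFinM.
rewrite /cons_measure /pushforward; congr (_ _).
apply/seteqP; split => -[q t] /=.
  move=> h; split.
    by have := h ord0; rewrite !tnth0/= => -[h1 h2]; split; rewrite /= in_itv.
  by move=> i; have := h (lift ord0 i); rewrite !tnthS.
move=> [[/= h1 h2] h3]; apply: polysquare_cons => //.
Qed.

(** A smaller exponent gives a larger integrand, since 1 - |z| ^ 2 <= 1; hence b
    may be lowered to at most - 1 / 2. Integrating out the first coordinate then
    leaves a bounded function supported in a polysquare. *)
Lemma integral_cut_pow_sqnorm n b : -1 < b ->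
  (\int[lebesgue_C R n.+1]_t (cut_pow b (1 - sqnorm t))%:E < +oo)%E.
Proof.
(* The exponent required by [integral_plane_cut_pow]. *)
move=> b1; pose b' := Num.min b (- (1/2)).
have b'1 : -1 < b' by rewrite lt_min b1; lra.
have b'2 : b' <= - (1/2) by rewrite ge_min lexx orbT.
have b'b : b' <= b by rewrite ge_min lexx.
have mf : measurable_fun [set: n.+1.-tuple plane] (fun t => (cut_pow b' (1 - sqnorm t))%:E).
  apply/measurable_EFinP; apply: (measurableT_comp (measurable_cut_pow _)).
  by apply: measurable_funB => //; exact: measurable_sqnorm.
apply: (@le_lt_trans _ _ (\int[lebesgue_C R n.+1]_t (cut_pow b' (1 - sqnorm t))%:E)%E).
  apply: ge0_le_integral_nonmeasurable => t _; first by rewrite lee_fin cut_pow_ge0.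
  rewrite lee_fin /cut_pow; case: ltP => // s0; apply: ger_powR => //.
  rewrite s0/= gerBl; apply: sumr_ge0 => i _; by rewrite addr_ge0 ?sqr_ge0.
have [K K0 HK] := integral_plane_cut_pow b'1 b'2.
rewrite /lebesgue_C ge0_integral_power_measureS_swap//; last by move=> t; rewrite lee_fin cut_pow_ge0.
pose a0 : n.-tuple plane := [tuple (0, 0) | i < n].
apply: (@le_lt_trans _ _ (\int[lebesgue_C R n]_t (K * \1_(polysquare a0 1) t)%:E)%E).
  apply: ge0_le_integral_nonmeasurable => t _.
    by apply: integral_ge0 => x _; rewrite lee_fin cut_pow_ge0.
  have tge0 : 0 <= sqnorm t by apply: sumr_ge0 => i _; rewrite addr_ge0 ?sqr_ge0.
  have le1 : 1 - sqnorm t <= 1 by rewrite gerBl.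
  rewrite (_ : (fun p => _) = (fun p : plane =>
      (cut_pow b' (1 - sqnorm t - (p.1 ^+ 2 + p.2 ^+ 2)))%:E)); last first.
    by apply/funext => p; rewrite sqnorm_cons; congr (cut_pow _ _)%:E; ring.
  apply: le_trans (HK _ le1) _; rewrite subr_gt0; case: ltP => t1; last first.
    by rewrite lee_fin mulr_ge0.
  rewrite indicE mem_set ?mulr1// => i.
  have : (tnth t i).1 ^+ 2 + (tnth t i).2 ^+ 2 < 1.
    apply: le_lt_trans t1; rewrite /sqnorm (bigD1 i)//= lerDl.
    by apply: sumr_ge0 => j _; rewrite addr_ge0 ?sqr_ge0.
  rewrite tnth_mktuple/= !sub0r !add0r -!ler_norml => h.
  have x2 := sqr_ge0 (tnth t i).1; have y2 := sqr_ge0 (tnth t i).2.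
  by split; rewrite -ler_sqr ?nnegrE// real_normK ?num_real// expr1n; lra.
under eq_integral do rewrite EFinM.
rewrite ge0_integralZl_EFin//.
- rewrite integral_indic//; last exact: measurable_polysquare.
  rewrite setIT; apply: (@le_lt_trans _ _ (K%:E * (((2 * 1) ^+ 2) ^+ n)%:E)%E).
    rewrite le_eqVlt; apply/orP; left; apply/eqP; congr (_ * _)%E.
    exact: volume_polysquare.
  by rewrite -EFinM ltry.
- by apply/measurable_EFinP; apply: measurable_indic; exact: measurable_polysquare.
Qed.

End tuple_integrals.

(** * Bergman weights *)

Section bergman_weight_theory.
Context (R : realType) (n : nat) (alpha : R).
Hypotheses (n_gt0 : (0 < n)%N) (alpha_gtN1 : -1 < alpha).
Local Notation N := (@Normc.normc R).
Local Notation C := (R[i]^o).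
Local Notation V := [the normedModType R[i] of 'rV[R[i]]_n].
Local Notation hn := (@hermitian_norm R n).
Local Notation plane := (measurableTypeR R * measurableTypeR R)%type.
Local Notation ballT := (@cvec R n @^-1` @unit_ball R n).

Lemma integral_ball_powR_lty b : -1 < b ->
  (integral_ball (fun z : 'rV[R[i]]_n => ((1 - hn z ^+ 2) `^ b)%R) < +oo)%E.
Proof.
move=> b1; apply: (@le_lt_trans _ _ (\int[lebesgue_C R n]_t (cut_pow b (1 - sqnorm t))%:E)%E).
  rewrite /integral_ball integral_mkcond.
  apply: ge0_le_integral_nonmeasurable => t _.
    by apply: erestrict_ge0 => x _; rewrite lee_fin powR_ge0.
  rewrite patchE; case: ifPn => [|_]; last by rewrite lee_fin cut_pow_ge0.
  rewrite inE => /unit_ballE; rewrite sqr_hermitian_norm_cvec => t1.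
  by rewrite /cut_pow subr_gt0 t1.
by case: n n_gt0 => // k _; exact: integral_cut_pow_sqnorm.
Qed.

Lemma bergman_weight_ge0 z : 0 <= bergman_weight alpha (z : 'rV[R[i]]_n).
Proof. exact: powR_ge0. Qed.

(** As e <= 1 - |z| ^ 2 <= 1, the power alpha of 1 - |z| ^ 2 is at least its
    power m, whatever the sign of alpha. *)
Lemma bergman_weight_ge m (e : R) (z : 'rV[R[i]]_n) : `|alpha| <= m%:R ->
  0 <= e -> e <= 1 - hn z -> e ^+ m <= bergman_weight alpha z.
Proof.
move=> am e0 ez; rewrite /bergman_weight.
have h0 := hermitian_norm_ge0 z.
have [e_eq0|e_gt0] := eqVneq e 0.
  rewrite e_eq0; case: m am => [|m] am; last by rewrite expr0n/= powR_ge0.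
  have -> : alpha = 0 by apply/eqP; rewrite -normr_le0.
  by rewrite powRr0.
have ep : 0 < e by rewrite lt_def e_gt0.
have eu : e <= 1 - hn z ^+ 2 by nra.
have u01 : 0 < 1 - hn z ^+ 2 <= 1 by rewrite gerBl sqr_ge0 andbT; lra.
apply: (@le_trans _ _ ((1 - hn z ^+ 2) `^ m%:R)); last first.
  by apply: ger_powR => //; apply: le_trans am; exact: ler_norm.
rewrite powR_mulrn; last by lra.
by apply: lerXn2r; rewrite ?nnegrE //; lra.
Qed.

Lemma integral_ball_subset (B : set (n.-tuple plane)) (f g : n.-tuple plane -> R) :
  B `<=` ballT -> (forall t, B t -> 0 <= f t <= g t) -> (forall t, ballT t -> 0 <= g t) ->
  (\int[lebesgue_C R n]_(t in B) (f t)%:E <= \int[lebesgue_C R n]_(t in ballT) (g t)%:E)%E.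
Proof.
move=> Bb fg g0; rewrite integral_mkcond [leRHS]integral_mkcond.
apply: ge0_le_integral_nonmeasurable => t _.
  by apply: erestrict_ge0 => x /fg/andP[? _]; rewrite lee_fin.
rewrite !patchE; case: ifPn => [|_].
  rewrite inE => Bt; rewrite mem_set; last exact: Bb.
  by rewrite lee_fin; have /andP[] := fg _ Bt.
by case: ifPn => //; rewrite inE => bt; rewrite lee_fin g0.
Qed.

Lemma polysquare_normc (t s : n.-tuple plane) r i : polysquare t r s ->
  N (cvec s ord0 i - cvec t ord0 i) <= 2 * r.
Proof.
move=> /(_ i)[h1 h2]; apply: le_trans (normc_le_ReIm _) _.
rewrite !mxE/=.
have e1 : `|(tnth s i).1 - (tnth t i).1| <= r by rewrite ler_norml; lra.
have e2 : `|(tnth s i).2 - (tnth t i).2| <= r by rewrite ler_norml; lra.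
lra.
Qed.

Lemma hermitian_norm_near (z w : 'rV[R[i]]_n) r :
  (forall i, N (w ord0 i - z ord0 i) <= r) -> hn w <= hn z + n%:R * r.
Proof.
move=> wz; rewrite -[w in leLHS](subrK z) addrC.
apply: le_trans (ler_hermitian_normD _ _) _; rewrite lerD2l.
apply: le_trans (hermitian_norm_le_sum _) _.
apply: (@le_trans _ _ (\sum_(i < n) r)).
  by apply: ler_sum => i _; rewrite !mxE.
by rewrite sumr_const card_ord mulr_natl.
Qed.

(** Near the origin the weight is bounded below, on a polysquare of positive
    volume. *)
Lemma integral_bergman_weight_gt0 :
  (0 < integral_ball (@bergman_weight R n alpha))%E.
Proof.
have n0 : 0 < n%:R :> R by rewrite ltr0n.
(* Points of the polysquare differ from 0 by at most 2 r in each complex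
   coordinate, hence by at most 2 n r = 1 / 2. *)
pose r : R := (4 * n%:R)^-1.
have r0 : 0 < r by rewrite invr_gt0 mulr_gt0// ltr0n.
have nr : n%:R * (2 * r) = 1/2.
  by rewrite /r; field; rewrite gt_eqF.
pose t0 : n.-tuple plane := [tuple (0, 0) | i < n].
have t0E : cvec t0 = 0.
  by apply/rowP => i; rewrite !mxE tnth_mktuple.
have near t : polysquare t0 r t -> hn (cvec t) <= 1/2.
  move=> Bt; rewrite -[leRHS]add0r -(hermitian_norm0 R n) -nr -t0E.
  by apply: hermitian_norm_near => i; exact: polysquare_normc.
pose m := (Num.truncn `|alpha|).+1.
have am : `|alpha| <= m%:R by apply: ltW; exact: truncnS_gt.
have Bb : polysquare t0 r `<=` ballT.
  by move=> t /near h; rewrite /= /unit_ball/=; lra.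
apply: (@lt_le_trans _ _ (\int[lebesgue_C R n]_(t in polysquare t0 r) ((1/2) ^+ m)%:E)%E).
  rewrite integral_cst; last exact: measurable_polysquare.
  rewrite [X in (_ * X)%E](_ : _ = (((2 * r) ^+ 2) ^+ n)%:E); last first.
    by apply: volume_polysquare; exact: ltW.
  rewrite -EFinM lte_fin; apply: mulr_gt0; first by apply: exprn_gt0; lra.
  by do 2 apply: exprn_gt0; apply: mulr_gt0.
apply: integral_ball_subset => // t; last by move=> _; exact: bergman_weight_ge0.
move=> /near h; rewrite exprn_ge0/=; last by lra.
by apply: bergman_weight_ge => //; lra.
Qed.

Lemma bergman_const_gt0 : 0 < bergman_const n alpha.
Proof.
rewrite /bergman_const invr_gt0; apply: fine_gt0.
rewrite integral_bergman_weight_gt0/=.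
exact: integral_ball_powR_lty.
Qed.

Lemma bergman_integral_powR_lty b : -1 < alpha + b ->
  (bergman_integral alpha (fun z : 'rV[R[i]]_n => ((1 - hn z ^+ 2) `^ b)%R) < +oo)%E.
Proof.
move=> ab; have c0 := bergman_const_gt0.
have mball := @measurable_ball_cvec R n.
rewrite /bergman_integral /integral_ball.
have -> : (\int[lebesgue_C R n]_(t in ballT)
    ((1 - hn (cvec t) ^+ 2) `^ b * (bergman_const n alpha * bergman_weight alpha (cvec t)))%R%:E =
  \int[lebesgue_C R n]_(t in ballT)
    ((bergman_const n alpha)%:E * ((1 - hn (cvec t) ^+ 2) `^ (alpha + b))%R%:E))%E.
  apply: eq_integral => t; rewrite inE => /unit_ballE t1.
  rewrite -EFinM; congr EFin; rewrite /bergman_weight powRD; last first.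
    by apply/implyP => _; rewrite subr_eq0 gt_eqF.
  ring.
rewrite ge0_integralZl_EFin//; last 3 first.
- by move=> t _; rewrite lee_fin powR_ge0.
- apply: measurable_funTS; apply/measurable_EFinP.
  apply: (measurableT_comp (measurable_powR _)); apply: measurable_funB => //.
  rewrite (_ : (fun t => _) = @sqnorm R n); first exact: measurable_sqnorm.
  by apply/funext => t; exact: sqr_hermitian_norm_cvec.
- exact: ltW.
have := integral_ball_powR_lty ab.
rewrite /integral_ball => h.
rewrite lte_mul_pinfty// ?lee_fin ?ltW//.
Qed.

(** The slice is f composed with an affine map of one complex variable. *)
Lemma differentiable_set_coord (f : V -> C) (t : n.-tuple plane) i :
  differentiable f (cvec t : V) ->
  differentiable (fun w : C => f (cvec (set_coord t i w)))
    (Complex (tnth t i).1 (tnth t i).2 : C).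
Proof.
move=> df; set w0 : C := Complex _ _.
have E : (fun w : C => cvec (set_coord t i w) : V) =
   (cst (cvec t : V) + (fun w : C => (id - cst w0 : C -> C) w *: (delta_mx ord0 i : V)) : C -> V).
  apply/funext => w; rewrite !fctE; apply/rowP => k; rewrite !mxE tnth_mktuple.
  case: eqVneq => [->|ki] /=.
    by rewrite mulr1 -[LHS]/(Complex _ _) /w0; case: w => a b /=; congr Complex; rewrite addrC subrK.
  by rewrite mulr0 addr0.
have w0E : cvec (set_coord t i w0) = cvec t.
  apply/rowP => k; rewrite !mxE tnth_mktuple; case: eqVneq => [->|] //=.
apply: (@differentiable_comp _ _ _ _ (fun w : C => cvec (set_coord t i w) : V) f); last by rewrite w0E.
rewrite E; apply: differentiableD; first exact: differentiable_cst.
apply: differentiableZl; apply: differentiableB => //; exact: differentiable_cst.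
Qed.

End bergman_weight_theory.

(** * Point evaluations *)

Section point_evaluation.
Context (R : realType) (n : nat) (alpha : R) (psi : R -> R).
Hypotheses (n_gt0 : (0 < n)%N) (alpha_gtN1 : -1 < alpha).
Hypotheses (Opsi : Orlicz_function psi) (Dpsi : Delta2_up psi).
Local Notation N := (@Normc.normc R).
Local Notation C := (R[i]^o).
Local Notation V := [the normedModType R[i] of 'rV[R[i]]_n].
Local Notation hn := (@hermitian_norm R n).
Local Notation plane := (measurableTypeR R * measurableTypeR R)%type.
Local Notation ballT := (@cvec R n @^-1` @unit_ball R n).
Local Notation inv := (Orlicz_inv psi).
Local Notation cst_alpha := (bergman_const n alpha).

Lemma measurable_normc_polysquare (f : V -> C) (t0 : n.-tuple plane) (r e : R) :
  2 * r < e -> (forall w : V, (forall i, N (w ord0 i - cvec t0 ord0 i) < e) ->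
    differentiable f w) -> 0 < e ->
  measurable_fun (polysquare t0 r) (fun t => N (f (cvec t))).
Proof.
move=> re df e0.
pose U : set V := ball (cvec t0 : V) e%:C.
have UE w : U w -> forall i, N (w ord0 i - cvec t0 ord0 i) < e.
  move=> [_ h] i; have := h ord0 i; rewrite /ball/= normC_normc ltcR.
  by rewrite -normcN opprB.
have oU : open U by exact: ball_open.
apply: (@measurable_funS _ _ _ _ (@cvec R n @^-1` U)).
- exact: measurable_cvec_open.
- move=> t /= tr; split; first by rewrite ltcR.
  move=> i j; rewrite (ord1 i) /ball/= normC_normc ltcR -normcN opprB.
  by apply: le_lt_trans re; exact: polysquare_normc.
- apply: (@measurable_fun_cvec R n U (fun w => N (f w)) oU) => z Uz.
  by apply: differentiable_normc_cvg; apply: df; exact: UE.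
Qed.

(** Jensen's inequality up to a factor 2. Let u = |f| / D, and choose x0 so that
    psi(x0) times c0 times the volume of the polysquare is 1. Beyond x0, psi lies
    above its chord through 0, so the modular bounds the integral of
    max(u - x0, 0) by x0 times the volume; hence the average of u is at most
    2 x0, and the mean value inequality applies. The factor 1024 is 256 times the
    ratio 4 of the area of the square of half-side r to r ^ 2. *)
Lemma modular_average_bound (f : V -> C) (t0 : n.-tuple plane) (r e D c0 : R) :
  0 < r -> 2 * r < e ->
  (forall w : V, (forall i, N (w ord0 i - cvec t0 ord0 i) < e) ->
    unit_ball w) ->
  (forall t, polysquare t0 r t -> c0 <= cst_alpha * bergman_weight alpha (cvec t)) ->
  0 < c0 -> 0 < D ->
  holomorphic_on (@unit_ball R n) f -> (Orlicz_modular alpha psi f D <= 1)%E ->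
  N (f (cvec t0)) <= D * (2 * 1024 ^+ n) * inv (1 / (c0 * ((2 * r) ^+ 2) ^+ n)).
Proof.
move=> r0 re Ub wB c00 D0 hf mod1.
pose vol := ((2 * r) ^+ 2) ^+ n.
have vol0 : 0 < vol by do 2 apply: exprn_gt0; lra.
pose x0 := inv (1 / (c0 * vol)).
have y0 : 0 < 1 / (c0 * vol) by apply: divr_gt0 => //; exact: mulr_gt0.
have x00 : 0 < x0 by exact: Orlicz_inv_gt0.
have psix0 : psi x0 = 1 / (c0 * vol) by apply: Orlicz_invK => //; exact: ltW.
have x0n := lt0r_neq0 x00; have voln := lt0r_neq0 vol0; have c0n := lt0r_neq0 c00.
pose B := polysquare t0 r.
have mB : measurable B by exact: measurable_polysquare.
have e0 : 0 < e by lra.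
have Bb : B `<=` ballT.
  move=> t tr; apply: Ub => i; apply: le_lt_trans re; exact: polysquare_normc.
pose u t := N (f (cvec t)) / D.
have u0 t : 0 <= u t by apply: divr_ge0; [exact: normc_ge0|exact: ltW].
have mu_ : measurable_fun B (fun t => N (f (cvec t))).
  by apply: (measurable_normc_polysquare re) => // w /Ub; exact: hf.
have mu1 : measurable_fun B u by apply: measurable_funM.
(* The part of u above x0, to which the chord inequality applies. *)
pose v t := Num.max (u t - x0) 0.
have mv : measurable_fun B v.
  by apply: measurable_maxr => //; exact: measurable_funB.
have v0 t : 0 <= v t by rewrite /v le_max lexx orbT.
have uv t : u t <= x0 + v t by rewrite /v addrC -lerBlDr le_max lexx.
have Iv : (\int[lebesgue_C R n]_(t in B) (v t)%:E <= (x0 * vol)%:E)%E.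
  have k0 : 0 < 1 / (x0 * vol) by apply: divr_gt0 => //; exact: mulr_gt0.
  suff : ((1 / (x0 * vol))%:E * \int[lebesgue_C R n]_(t in B) (v t)%:E <= 1)%E.
    move=> h; rewrite -[X in (_ <= X)%E]mule1 -lee_pdivrMl; last exact: mulr_gt0.
    by rewrite div1r in h.
  rewrite -ge0_integralZl_EFin//; last 3 first.
  - by move=> t _; rewrite lee_fin.
  - exact/measurable_EFinP.
  - exact: ltW.
  apply: le_trans mod1; rewrite /Orlicz_modular /bergman_integral /integral_ball.
  under eq_integral do rewrite -EFinM.
  have ca0 : 0 < cst_alpha by exact: bergman_const_gt0.
  apply: integral_ball_subset => // t.
    move=> Bt; rewrite mulr_ge0 ?(ltW k0)//=.
    have p0 : 0 <= psi (u t) by exact: Orlicz_ge0.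
    apply: (@le_trans _ _ (psi (u t) * c0)); last first.
      by apply: ler_wpM2l => //; exact: wB.
    rewrite /v; have [xu|ux] := leP x0 (u t); last first.
      by rewrite max_r ?mulr0 ?mulr_ge0// ?ltW//; lra.
    rewrite max_l; last by rewrite subr_ge0.
    have := Orlicz_chord Opsi x00 xu; rewrite psix0 => chord.
    apply: (@le_trans _ _ (1 / (x0 * vol) * u t)).
      by apply: ler_wpM2l; [exact: ltW|rewrite gerBl ltW].
    have -> : 1 / (x0 * vol) * u t = c0 / x0 * (1 / (c0 * vol) * u t).
      by field; rewrite ?x0n ?voln ?c0n.
    have -> : psi (u t) * c0 = c0 / x0 * (x0 * psi (u t)) by field; rewrite ?x0n.
    by apply: ler_wpM2l => //; apply: divr_ge0; exact: ltW.
  move=> bt; apply: mulr_ge0; first by apply: Orlicz_ge0 => //; exact: u0.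
  by apply: mulr_ge0; [exact: ltW|exact: bergman_weight_ge0].
pose g := (fun t => (D * (x0 + v t))%:E) \_ B.
have mg : measurable_fun [set: n.-tuple plane] g.
  apply/(measurable_restrictT _ mB); apply/measurable_EFinP.
  by apply: measurable_funM => //; exact: measurable_funD.
have g0 t : (0 <= g t)%E.
  apply: erestrict_ge0 => s _; rewrite lee_fin mulr_ge0 ?(ltW D0)// addr_ge0//.
  exact: ltW.
have Fg t : B t -> ((N (f (cvec t)))%:E <= g t)%E.
  move=> Bt; rewrite /g patchE mem_set// lee_fin mulrC -ler_pdivrMr//; exact: uv.
have dF t i : B t -> differentiable (fun w : C => f (cvec (set_coord t i w)))
       (Complex (tnth t i).1 (tnth t i).2 : C).
  by move=> /Bb bt; apply: differentiable_set_coord; exact: hf.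
have := @cauchy_polysquare_estimate R n t0 r (fun t => f (cvec t)) g r0 mg g0 Fg dF.
have -> : (\int[lebesgue_C R n]_t g t =
   (D * (x0 * vol))%:E + D%:E * \int[lebesgue_C R n]_(t in B) (v t)%:E)%E.
  rewrite -integral_mkcond.
  under eq_integral do rewrite mulrDr EFinD.
  rewrite ge0_integralD//; last 3 first.
  - by move=> t _; rewrite lee_fin mulr_ge0// ltW.
  - by move=> t _; rewrite lee_fin mulr_ge0// ltW.
  - by apply/measurable_EFinP; exact: measurable_funM.
  congr (_ + _)%E.
    rewrite integral_cst// [X in (_ * X)%E](_ : _ = vol%:E); last first.
      by apply: volume_polysquare; exact: ltW.
    by rewrite -EFinM mulrA.
  under eq_integral do rewrite EFinM.
  apply: ge0_integralZl_EFin.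
  - exact: mB.
  - by move=> t _; rewrite lee_fin.
  - exact/measurable_EFinP.
  - exact: ltW.
move=> H; rewrite -lee_fin; apply: (le_trans H).
have c1 : 0 <= (256 / r ^+ 2) ^+ n.
  by apply: exprn_ge0; apply: divr_ge0; [exact: ler0n|exact: sqr_ge0].
apply: (@le_trans _ _ (((256 / r ^+ 2) ^+ n)%:E * (D * (x0 * vol) + D * (x0 * vol))%:E)%E).
  apply: lee_wpmul2l; first by rewrite lee_fin.
  rewrite EFinD; apply: leeD => //; rewrite [leRHS]EFinM.
  by apply: lee_wpmul2l => //; rewrite lee_fin ltW.
rewrite -EFinM lee_fin.
have -> : (256 / r ^+ 2) ^+ n * (D * (x0 * vol) + D * (x0 * vol)) =
  D * (2 * ((256 / r ^+ 2) ^+ n * vol)) * x0 by ring.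
rewrite /vol -exprMn (_ : 256 / r ^+ 2 * (2 * r) ^+ 2 = 1024)//.
by field; rewrite gt_eqF.
Qed.

(** A polysquare of size comparable to 1 - |z| around z lies in the ball, and there
    the weight is at least a power of 1 - |z|: the argument of psi^-1 in
    [modular_average_bound] is polynomial in 1 / (1 - |z|). *)
Lemma point_evaluation : exists2 K, 1 <= K & forall (f : V -> C) (D : R) (z : V),
  holomorphic_on (@unit_ball R n) f -> 0 < D ->
  (Orlicz_modular alpha psi f D <= 1)%E -> unit_ball z ->
  N (f z) <= D * K * inv (1 / (1 - hn z)).
Proof.
pose m := (Num.truncn `|alpha|).+1.
have am : `|alpha| <= m%:R by apply: ltW; exact: truncnS_gt.
have n0 : 0 < n%:R :> R by rewrite ltr0n.
have ca0 : 0 < cst_alpha by exact: bergman_const_gt0.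
(* The constant in the argument of psi^-1 given by [modular_average_bound] for
   the values of r and c0 below. *)
pose A := (2 ^+ m / cst_alpha) * ((4 * n%:R) ^+ 2) ^+ n.
have A0 : 0 <= A.
  apply: mulr_ge0; first by apply: divr_ge0; [exact: exprn_ge0|exact: ltW].
  by apply: exprn_ge0; exact: sqr_ge0.
have [K K1 HK] := Orlicz_inv_poly Opsi Dpsi (m + 2 * n)%N A0.
exists (2 * 1024 ^+ n * K).
  have p1 : 1 <= 1024 ^+ n :> R by apply: exprn_ege1; rewrite ler1n.
  have : 1 * 1 <= 1024 ^+ n * K by apply: ler_pM.
  by rewrite -mulrA mulr1; lra.
move=> f D z hf D0 mod1 zb.
have hz := hermitian_norm_ge0 z.
have zb' : hn z < 1 by [].
pose d := 1 - hn z.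
have d0 : 0 < d by rewrite /d; lra.
have d1 : d <= 1 by rewrite /d; lra.
pose t0 : n.-tuple plane := [tuple (complex.Re (z ord0 i), complex.Im (z ord0 i)) | i < n].
have t0E : cvec t0 = z.
  apply/rowP => i; rewrite !mxE tnth_mktuple/=.
  by case: (z ord0 i).
(* Moving each complex coordinate by at most e changes the norm by at most
   n e = d / 2; points of the polysquare move by at most 2 r < e. *)
pose r := d / (8 * n%:R); pose e := d / (2 * n%:R).
have r0 : 0 < r by apply: divr_gt0 => //; apply: mulr_gt0.
have re : 2 * r < e.
  have -> : e = 4 * r by rewrite /e /r; field; rewrite gt_eqF.
  lra.
have near (w : V) : (forall i, N (w ord0 i - cvec t0 ord0 i) <= e) -> hn w <= hn z + d / 2.
  rewrite t0E => /hermitian_norm_near/le_trans; apply; rewrite lerD2l.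
  by rewrite le_eqVlt; apply/orP; left; apply/eqP; rewrite /e; field; rewrite gt_eqF.
have Ub (w : V) : (forall i, N (w ord0 i - cvec t0 ord0 i) < e) -> unit_ball w.
  move=> h; have : hn w <= hn z + d / 2 by apply: near => i; exact: ltW.
  by rewrite /unit_ball/= /d; lra.
pose c0 := cst_alpha * (d / 2) ^+ m.
have c00 : 0 < c0 by apply: mulr_gt0 => //; apply: exprn_gt0; lra.
have wB t : polysquare t0 r t -> c0 <= cst_alpha * bergman_weight alpha (cvec t).
  move=> Bt; rewrite ler_pM2l//; apply: bergman_weight_ge => //; first by lra.
  have : hn (cvec t) <= hn z + d / 2.
    by apply: near => i; apply: le_trans (polysquare_normc i Bt) (ltW re).
  by rewrite /d; lra.
have := modular_average_bound r0 re Ub wB c00 D0 hf mod1; rewrite t0E.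
move=> /le_trans; apply.
have q0 : 0 <= 2 * 1024 ^+ n :> R.
  by rewrite mulr_ge0 ?ler0n ?exprn_ge0 ?ler0n.
move: (2 * 1024 ^+ n : R) q0 => q q0.
rewrite [leRHS](_ : _ = D * q * (K * inv (1 / (1 - hn z)))); last by rewrite !mulrA.
apply: ler_wpM2l; first by apply: mulr_ge0 => //; exact: ltW.
have vol0 : 0 < ((2 * r) ^+ 2) ^+ n by do 2 apply: exprn_gt0; lra.
apply: HK.
- by rewrite div1r invf_ge1.
- by rewrite ltW// divr_gt0// mulr_gt0.
rewrite le_eqVlt; apply/orP; left; apply/eqP.
rewrite /A /c0 exprD exprM -/d.
have -> : (2 * r) ^+ 2 = d ^+ 2 / (4 * n%:R) ^+ 2.
  by rewrite /r; field; rewrite gt_eqF.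
rewrite !expr_div_n !expr1n.
have dm : d ^+ m != 0 by rewrite expf_neq0// gt_eqF.
have d2n : (d ^+ 2) ^+ n != 0 by rewrite !expf_neq0// gt_eqF.
have n2n : ((4 * n%:R) ^+ 2) ^+ n != 0 :> R by rewrite !expf_neq0// mulf_neq0// gt_eqF.
have m2 : 2 ^+ m != 0 :> R by rewrite expf_neq0.
have cc0 : cst_alpha != 0 by rewrite gt_eqF.
move: dm d2n n2n m2 cc0.
move: (d ^+ m) ((d ^+ 2) ^+ n) (((4 * n%:R) ^+ 2) ^+ n) (2 ^+ m) cst_alpha => a b c x y a0 b0 c1 x0 y0.
by field; rewrite a0 b0 c1 x0 y0.
Qed.

End point_evaluation.

(** * Self-maps near the boundary *)

Section schwarz_pick.
Context (R : realType) (n : nat).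
Local Notation N := (@Normc.normc R).
Local Notation C := (R[i]^o).
Local Notation V := [the normedModType R[i] of 'rV[R[i]]_n].
Local Notation hn := (@hermitian_norm R n).
Local Notation pt x y := (Complex x y : C).

Lemma sqr_normc_complex (x y : R) : N (x +i* y) ^+ 2 = x ^+ 2 + y ^+ 2.
Proof. by rewrite sqr_sqrtr// addr_ge0// sqr_ge0. Qed.

(** The identity behind the fact that w |-> (w - a) / (1 - conj(a) w) preserves the
    unit disc. *)
Lemma mobius_identity (a w : R[i]) :
  N (1 - conjc a * w) ^+ 2 - N (w - a) ^+ 2 = (1 - N a ^+ 2) * (1 - N w ^+ 2).
Proof.
case: a w => a b [c d].
have -> : 1 - conjc (a +i* b) * (c +i* d) =
  (1 - (a * c + b * d)) +i* (- (a * d - b * c)).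
  by apply/eqP; rewrite eq_complex /=; apply/andP; split; apply/eqP; ring.
have -> : (c +i* d) - (a +i* b) = (c - a) +i* (d - b) by [].
rewrite !sqr_normc_complex; ring.
Qed.

Lemma normc_conj (a : R[i]) : N (conjc a) = N a.
Proof. by case: a => u v /=; rewrite sqrrN. Qed.

Lemma mobius_denominator (a w : R[i]) : N w <= 1 ->
  1 - N a <= N (1 - conjc a * w).
Proof.
move=> w1.
have : N (1 : R[i]) <= N (1 - conjc a * w) + N (conjc a * w).
  by apply: le_trans (le_normcD _ _); rewrite subrK.
rewrite [N 1]Normc.normc1 Normc.normcM normc_conj.
have : N a * N w <= N a * 1 by apply: ler_wpM2l => //; exact: normc_ge0.
lra.
Qed.

(** Composing g with the disc automorphism that maps g(0) to 0 and applying
    [schwarz_square] bounds the pseudohyperbolic distance between g(0) and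
    g(1 / 512) by 256 / 512 = 1 / 2. By [mobius_identity] this keeps 1 - |g|
    from dropping by more than a constant factor. *)
Lemma schwarz_pick_square (g : C -> C) (b : R) :
  (forall x y, -1 <= x <= 1 -> -1 <= y <= 1 ->
     differentiable g (pt x y) /\ N (g (pt x y)) < 1) ->
  0 <= b -> g (pt (512^-1) 0) = b%:C ->
  3 / 16 * (1 - N (g 0)) <= 1 - b.
Proof.
move=> Hg b0 gb.
have e0 : 0 <= 512^-1 :> R by rewrite invr_ge0 ler0n.
have e1 : 512^-1 <= 1/2 :> R.
  by rewrite div1r lef_pV2 ?posrE ?ltr0n// ler_nat.
have dom0 : -1 <= (0 : R) <= 1 by lra.
have dome : -1 <= (512^-1 : R) <= 1 by apply/andP; split; lra.
set a := g 0; have a1 : N a < 1 by have [] := Hg 0 0 dom0 dom0.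
have Nb : N (b%:C) = b by rewrite normc_real ger0_norm.
have b1 : b < 1 by have [_] := Hg _ _ dome dom0; rewrite gb Nb.
pose G : C -> C := fun w => (g w - a) / (1 - conjc a * g w).
have den x y : -1 <= x <= 1 -> -1 <= y <= 1 -> 0 < N (1 - conjc a * g (pt x y)).
  move=> hx hy; have [_ g1] := Hg x y hx hy.
  by apply: lt_le_trans (mobius_denominator a (ltW g1)); rewrite subr_gt0.
have HG x y : -1 <= x <= 1 -> -1 <= y <= 1 ->
    differentiable G (pt x y) /\ N (G (pt x y)) <= 1.
  move=> hx hy; have [dg g1] := Hg x y hx hy; have d0 := den x y hx hy; split.
    have -> : G = ((g : C -> C) - cst a) *
       (fun w : C => ((cst 1 - cst (conjc a : C) * g : C -> C) w)^-1 : C).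
      by apply/funext.
    apply: differentiableM; first by apply: differentiableB => //; exact: differentiable_cst.
    apply: differentiableV; last by rewrite -[X in X != 0]/(1 - conjc a * g (pt x y)) -normc_gt0.
    apply: differentiableB; first exact: differentiable_cst.
    by apply: differentiableM => //; exact: differentiable_cst.
  rewrite /G Normc.normcM Normc.normcV ler_pdivrMr// mul1r.
  rewrite -ler_sqr ?nnegrE ?normc_ge0// -subr_ge0 mobius_identity.
  have h1 := normc_ge0 a; have h2 := normc_ge0 (g (pt x y)).
  apply: mulr_ge0; rewrite subr_ge0 expr_le1// ltW//.
have G0 : G 0 = 0 by rewrite /G /a subrr mul0r.
have half : N (G (pt (512^-1) 0)) <= 1/2.
  have h1 : `|512^-1 : R| <= 1/2 by rewrite ger0_norm.
  have h2 : `|0 : R| <= 1/2 by rewrite normr0; lra.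
  have := schwarz_square HG G0 h1 h2.
  have -> : N (pt (512^-1) 0) = 512^-1 by rewrite -[pt _ _]/((512^-1)%:C) normc_real ger0_norm.
  have -> : 256 * 512^-1 = 1/2 :> R by field.
  by [].
move: half; rewrite /G gb Normc.normcM Normc.normcV.
have d0 := den _ _ dome dom0; rewrite gb in d0.
rewrite ler_pdivrMr// => half.
have q1 := mobius_denominator a (ltac:(rewrite Nb; exact: ltW) : N b%:C <= 1).
have id := mobius_identity a b%:C; rewrite Nb in id.
move: half d0 q1 id.
move: (N (b%:C - a)) (normc_ge0 (b%:C - a)) (N (1 - conjc a * b%:C)) (N a) (normc_ge0 a) a1.
move=> p p0 q s s0 s1 half q0 q1 id.
have pq : p ^+ 2 <= q ^+ 2 / 4.
  have : p ^+ 2 <= (1 / 2 * q) ^+ 2 by rewrite ler_sqr ?nnegrE//; lra.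
  by rewrite exprMn expr_div_n expr1n; lra.
have sq : (1 - s) ^+ 2 <= q ^+ 2 by rewrite ler_sqr ?nnegrE//; lra.
have ub : (1 - s ^+ 2) * (1 - b ^+ 2) <= (2 * (1 - s)) * (2 * (1 - b)).
  apply: ler_pM; [| |nra|nra].
    by rewrite subr_ge0 expr_le1// ltW.
  by rewrite subr_ge0 expr_le1// ltW.
have s10 : 0 < 1 - s by lra.
rewrite -(ler_pM2l s10).
have -> : (1 - s) * (3 / 16 * (1 - s)) = 3 / 16 * (1 - s) ^+ 2 by ring.
lra.
Qed.

Lemma differentiable_affine_line (z u : V) (w : C) :
  differentiable (fun w : C => z + w *: u : V) w.
Proof.
have -> : (fun w : C => z + w *: u : V) = (cst z + (fun w : C => (id : C -> C) w *: u) : C -> V).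
  by apply/funext.
apply: differentiableD; first exact: differentiable_cst.
by apply: differentiableZl.
Qed.

Lemma differentiable_inner (phi : V -> V) (a z : V) : differentiable phi z ->
  differentiable (fun x => \sum_k (phi x) ord0 k * conjc (a ord0 k) : C) z.
Proof.
move=> dphi.
have -> : (fun x => \sum_k (phi x) ord0 k * conjc (a ord0 k) : C) =
   \sum_(k < n) ((fun x => (phi x) ord0 k : C) * cst (conjc (a ord0 k) : C)).
  by apply/funext => x; rewrite fct_sumE.
apply: differentiable_sum => k; apply: differentiableM; last exact: differentiable_cst.
have dc : differentiable (fun M : V => M ord0 k : C) (phi z).
  exact: differentiable_coord.
exact: (differentiable_comp dphi dc).
Qed.

(** A displacement by this multiple of 1 - |z| is 1 / 512 of a vector of length
    (1 - |z|) / 4, whose multiples by the complex numbers of the square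
    [-1, 1] ^ 2 keep z in the ball. *)
Definition harnack_radius : R := 2048^-1.

Lemma harnack_radius01 : 0 < harnack_radius < 1.
Proof. by rewrite /harnack_radius invr_gt0 ltr0n invf_lt1 ?ltr0n ?ltr1n. Qed.

(** The component of phi in the direction of phi(z'), restricted to the complex
    line through z and z', is a function on a square with values in the disc, to
    which [schwarz_pick_square] applies. *)
Lemma harnack_step (phi : V -> V) (z z' : V) : holomorphic_self_map phi ->
  hn z < 1 -> hn (z' - z) <= harnack_radius * (1 - hn z) ->
  3 / 16 * (1 - hn (phi z)) <= 1 - hn (phi z').
Proof.
move=> [dphi bphi] z1 zz.
pose u : V := (512%:C : R[i]) *: (z' - z).
have c0 : 0 <= 512 :> R by exact: ler0n.
have hu : hn u <= (1 - hn z) / 4.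
  rewrite /u hermitian_normZ normc_real ger0_norm//.
  apply: (@le_trans _ _ (512 * (harnack_radius * (1 - hn z)))); first exact: ler_wpM2l.
  by rewrite le_eqVlt /harnack_radius; apply/orP; left; apply/eqP; field.
have ball_line x y : -1 <= x <= 1 -> -1 <= y <= 1 -> unit_ball (z + pt x y *: u).
  move=> hx hy; rewrite /unit_ball/=; apply: le_lt_trans (ler_hermitian_normD _ _) _.
  rewrite hermitian_normZ.
  have h2 : N (pt x y) <= 2.
    apply: le_trans (normc_le_ReIm _) _ => /=.
    have : `|x| <= 1 by rewrite ler_norml.
    have : `|y| <= 1 by rewrite ler_norml.
    lra.
  have : N (pt x y) * hn u <= 2 * ((1 - hn z) / 4).
    by apply: ler_pM => //; [exact: normc_ge0|exact: hermitian_norm_ge0].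
  lra.
have dom0 : -1 <= (0 : R) <= 1 by lra.
have dome : -1 <= (512^-1 : R) <= 1.
  have : 512^-1 <= 1 :> R by rewrite invf_le1 ?ltr0n// ler1n.
  have : 0 <= 512^-1 :> R by rewrite invr_ge0.
  by move=> ? ?; apply/andP; split; lra.
have lineE : z + pt (512^-1) 0 *: u = z'.
  rewrite /u scalerA (_ : pt 512^-1 0 * 512%:C = 1) ?scale1r ?subrKC//.
  have nz : 512 != 0 :> R by rewrite pnatr_eq0.
  rewrite -[pt _ _]/((512^-1)%:C) -rmorphM mulVf; last exact: nz.
  by rewrite rmorph1.
have z'b : unit_ball z' by rewrite -lineE; exact: ball_line.
have b0 := hermitian_norm_ge0 (phi z').
have a0 := hermitian_norm_ge0 (phi z).
set b := hn (phi z') in b0 *.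
have [b_eq0|bn0] := eqVneq b 0.
  rewrite b_eq0; have := bphi z z1; rewrite /unit_ball/=; lra.
have bp : 0 < b by rewrite lt_def bn0.
pose e : V := (b^-1)%:C *: phi z'.
have he : hn e = 1.
  by rewrite /e hermitian_normZ normc_real ger0_norm ?invr_ge0// mulVf.
pose g (w : C) : C := \sum_k (phi (z + w *: u)) ord0 k * conjc (e ord0 k).
have Hg x y : -1 <= x <= 1 -> -1 <= y <= 1 ->
    differentiable g (pt x y) /\ N (g (pt x y)) < 1.
  move=> hx hy; have bl := ball_line x y hx hy; split.
    apply: (@differentiable_comp _ _ _ _ (fun w : C => z + w *: u : V)
      (fun x => \sum_k (phi x) ord0 k * conjc (e ord0 k) : C)).
      exact: differentiable_affine_line.
    by apply: differentiable_inner; exact: dphi.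
  apply: le_lt_trans (hermitian_norm_inner _ _) _.
  by rewrite he mulr1; exact: bphi.
have gb : g (pt (512^-1) 0) = b%:C.
  rewrite /g lineE.
  have -> : \sum_k (phi z') ord0 k * conjc (e ord0 k) =
     \sum_k (b^-1 * N ((phi z') ord0 k) ^+ 2)%:C.
    apply: eq_bigr => k _; rewrite /e mxE; case: ((phi z') ord0 k) => x y.
    rewrite sqr_normc_complex; apply/eqP; rewrite eq_complex /=.
    by apply/andP; split; apply/eqP; ring.
  rewrite -rmorph_sum -mulr_sumr -sqr_hermitian_norm -/b expr2 mulrA mulVf// mul1r //.
have := schwarz_pick_square Hg b0 gb.
have g0 : N (g 0) <= hn (phi z).
  rewrite /g; have -> : z + 0 *: u = z by rewrite scale0r addr0.
  by apply: le_trans (hermitian_norm_inner _ _) _; rewrite he mulr1.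
by apply: le_trans; rewrite ler_pM2l ?lerD2l ?lerN2// divr_gt0.
Qed.

(** A step of [harnack_step] along a ray multiplies 1 - |z| by
    1 - [harnack_radius], at the cost of a factor 3 / 16. *)
Lemma harnack_chain (phi : V -> V) m (z : V) : holomorphic_self_map phi ->
  hn z <= 1 - (1 - harnack_radius) ^+ m ->
  (3 / 16) ^+ m * (1 - hn (phi 0)) <= 1 - hn (phi z).
Proof.
move=> Hphi; have [_ bphi] := Hphi.
have /andP[r0 r1] := harnack_radius01.
have q0 : 0 < 1 - harnack_radius by rewrite subr_gt0.
have q1 : 1 - harnack_radius < 1 by rewrite gtrBl.
have ball0 : unit_ball (0 : V) by rewrite /unit_ball/= hermitian_norm0.
have pos (w : V) : unit_ball w -> 0 < 1 - hn (phi w).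
  by move=> /bphi; rewrite subr_gt0.
elim: m z => [|m IH] z.
  rewrite !expr0 subrr mul1r => hz.
  have hz0 : hn z = 0 by apply/eqP; rewrite eq_le hz hermitian_norm_ge0.
  have -> : z = 0.
    apply/rowP => i; rewrite mxE; apply/Normc.eq0_normc/eqP.
    by rewrite eq_le normc_ge0 andbT -hz0 normc_le_hermitian_norm.
  by [].
set p := (1 - harnack_radius) ^+ m in IH *.
have p0 : 0 < p by exact: exprn_gt0.
have p1 : p <= 1.
  by apply: exprn_ile1; exact: ltW.
move=> hz.
have zb : hn z < 1.
  by apply: le_lt_trans hz _; rewrite gtrBl exprn_gt0.
have [/IH hz1|hz1] := leP (hn z) (1 - p).
  apply: le_trans hz1; rewrite exprS -mulrA.
  apply: ler_piMl; last by lra.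
  apply: mulr_ge0; last by apply/ltW; exact: pos.
  by apply: exprn_ge0; lra.
have hz0 : 0 < hn z by apply: le_lt_trans hz1; rewrite subr_ge0.
(* The point s z of the ray at which the first m steps arrive. *)
pose s := (1 - p) / hn z.
have s0 : 0 <= s by apply: divr_ge0; lra.
have s1 : s < 1 by rewrite ltr_pdivrMr// mul1r.
pose z0 : V := s%:C *: z.
have hz0E : hn z0 = 1 - p.
  by rewrite /z0 hermitian_normZ normc_real ger0_norm// divfK// gt_eqF.
have z0b : hn z0 < 1 by rewrite hz0E gtrBl.
have step := @harnack_step phi z0 z Hphi z0b.
rewrite exprS -mulrA; apply: le_trans (step _).
  by apply: ler_wpM2l; [lra|apply: IH; rewrite hz0E].
have -> : z - z0 = (1 - s)%:C *: z by rewrite rmorphB/= scalerBl scale1r.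
rewrite hermitian_normZ normc_real ger0_norm; last by rewrite subr_ge0 ltW.
rewrite hz0E mulrBl mul1r /s divfK ?gt_eqF//.
by move: hz; rewrite exprS -/p; lra.
Qed.

(** The number m of steps of [harnack_chain] from 0 to z is logarithmic in
    1 / (1 - |z|), so that (3 / 16) ^ m is at least a power of 1 - |z|. *)
Lemma self_map_boundary_growth (phi : V -> V) : holomorphic_self_map phi ->
  exists k, exists2 c : R, 0 < c & forall z : V, unit_ball z ->
  c * (1 - hn z) ^+ k <= 1 - hn (phi z).
Proof.
move=> Hphi; have [_ bphi] := Hphi.
have ball0 : unit_ball (0 : V) by rewrite /unit_ball/= hermitian_norm0.
have d0 : 0 < 1 - hn (phi 0) by rewrite subr_gt0; exact: bphi.
have /andP[r0 r1] := harnack_radius01.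
have q0 : 0 < 1 - harnack_radius by rewrite subr_gt0.
have q1 : 1 - harnack_radius < 1 by rewrite gtrBl.
have small (x : R) : 0 < x -> exists m, (1 - harnack_radius) ^+ m <= x.
  move=> x0; have := @cvg_geometric R 1 (1 - harnack_radius).
  rewrite ger0_norm ?(ltW q0)// => /(_ q1).
  move/cvgrPdist_lt => /(_ _ x0)[k _ Hk]; exists k.
  have := Hk k (leqnn k); rewrite /= sub0r normrN /geometric/= mul1r => h.
  by apply: le_trans (ltW h); exact: ler_norm.
set q := 1 - harnack_radius in q0 q1 small *.
have qle1 : q <= 1 by exact: ltW.
(* Turns powers of 3 / 16 into powers of q, hence of 1 - |z|. *)
have [k Hk] : exists k, q ^+ k <= 3 / 16 by apply: small; lra.
exists k; exists (q ^+ k * (1 - hn (phi 0))); first by apply: mulr_gt0 => //; exact: exprn_gt0.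
move=> z zb; have z1 : 0 < 1 - hn z by rewrite subr_gt0.
have zle1 : 1 - hn z <= 1 by rewrite gerBl hermitian_norm_ge0.
have ex := small _ z1.
(* The least number of steps that reach z, so that q ^ (m - 1) > 1 - |z|. *)
have := ex_minnP ex; case: ex_minnP => m hm minm _.
have hz : hn z <= 1 - q ^+ m by lra.
apply: le_trans (harnack_chain Hphi hz).
rewrite mulrAC; apply: ler_wpM2r; first exact: ltW.
apply: (@le_trans _ _ ((q ^+ k) ^+ m)); last first.
  by apply: lerXn2r; rewrite ?nnegrE ?exprn_ge0 ?(ltW q0)//; lra.
rewrite -exprMn exprAC; apply: lerXn2r; rewrite ?nnegrE ?exprn_ge0 ?mulr_ge0 ?(ltW q0) ?(ltW z1)//.
case: m hm minm {hz} => [|m] hm minm.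
  by rewrite expr0; apply: mulr_ile1; rewrite ?(ltW q0) ?(ltW z1).
rewrite exprS; apply: ler_wpM2l; first exact: ltW.
by rewrite leNgt; apply/negP => /ltW /minm; rewrite ltnn.
Qed.

End schwarz_pick.

(** * The growth space *)

Section scale_integral.
Local Open Scope ereal_scope.
Context d (T : measurableType d) (R : realType).
Variable mu : {measure set T -> \bar R}.
Import HBNNSimple.

(** Dividing by k the simple functions below k f gives simple functions below f. *)
Lemma ge0_integralZl_nonmeasurable_le (D : set T) (f : T -> \bar R) (k : R) :
  (0 < k)%R -> (forall x, D x -> 0 <= f x) ->
  \int[mu]_(x in D) (k%:E * f x) <= k%:E * \int[mu]_(x in D) f x.
Proof.
move=> k0 f0; rewrite !ge0_integralE//; last first.
  by move=> x Dx; rewrite mule_ge0 ?lee_fin ?(ltW k0)// f0.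
apply: ge_ereal_sup => _ [h /= hf <-].
have k1 : (0 <= k^-1)%R by rewrite invr_ge0 ltW.
pose h' := scale_nnsfun h k1.
have -> : sintegral mu h = k%:E * sintegral mu h'.
  rewrite (_ : sintegral mu h' = k^-1%:E * sintegral mu h).
    by rewrite muleA -EFinM divff ?mul1e// gt_eqF.
  by rewrite -sintegralrM; apply: eq_sintegral => x.
apply: lee_wpmul2l; first by rewrite lee_fin ltW.
apply: ereal_sup_ubound; exists h' => //= x.
have := hf x; rewrite !patchE; case: ifPn => _ hx.
  by rewrite EFinM lee_pdivrMl.
by rewrite EFinM; apply: mule_ge0_le0 => //; rewrite lee_fin.
Qed.

End scale_integral.

Section growth_space.
Context (R : realType) (n : nat) (alpha : R) (psi : R -> R).
Hypotheses (n_gt0 : (0 < n)%N) (alpha_gtN1 : -1 < alpha).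
Hypotheses (Opsi : Orlicz_function psi) (Dpsi : Delta2_up psi).
Local Notation N := (@Normc.normc R).
Local Notation C := (R[i]^o).
Local Notation V := [the normedModType R[i] of 'rV[R[i]]_n].
Local Notation hn := (@hermitian_norm R n).
Local Notation inv := (Orlicz_inv psi).

Definition growth (z : V) : R := inv (1 / (1 - hn z)).

Lemma growth_arg (z : V) : unit_ball z -> 1 <= 1 / (1 - hn z).
Proof.
move=> zb; have h1 : hn z < 1 by [].
by rewrite div1r invf_ge1 ?subr_gt0// gerBl hermitian_norm_ge0.
Qed.

Lemma growth_gt0 (z : V) : unit_ball z -> 0 < growth z.
Proof. by move=> /growth_arg h; apply: Orlicz_inv_gt0 => //; lra. Qed.

Lemma modular_ge0 (f : V -> C) D z : 0 < D -> 0 <= psi (N (f z) / D).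
Proof. by move=> D0; apply: Orlicz_ge0 => //; rewrite divr_ge0 ?normc_ge0// ltW. Qed.

(** By convexity, psi(x / k) <= psi(x) / k for k >= 1. *)
Lemma modular_scale (f : V -> C) D k : 0 < D -> 1 <= k ->
  (Orlicz_modular alpha psi f (D * k) <= (k^-1)%:E * Orlicz_modular alpha psi f D)%E.
Proof.
move=> D0 k1; have k0 : 0 < k by lra.
have ca0 := bergman_const_gt0 n_gt0 alpha_gtN1.
rewrite /Orlicz_modular {2}/bergman_integral /integral_ball.
apply: le_trans (ge0_integralZl_nonmeasurable_le _ _ _); last 2 first.
- by rewrite invr_gt0.
- move=> t _; rewrite lee_fin mulr_ge0 ?modular_ge0// mulr_ge0 ?bergman_weight_ge0//.
  exact: ltW.
apply: ge0_le_integral_nonmeasurable => t _.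
  rewrite lee_fin mulr_ge0 ?modular_ge0 ?mulr_gt0// mulr_ge0 ?bergman_weight_ge0//.
  exact: ltW.
rewrite -EFinM lee_fin [leRHS]mulrA; apply: ler_wpM2r.
  by rewrite mulr_ge0 ?bergman_weight_ge0// ltW.
have -> : N (f (cvec t)) / (D * k) = k^-1 * (N (f (cvec t)) / D).
  by rewrite invfM mulrA [RHS]mulrC.
apply: Orlicz_scale => //; first by rewrite invr_ge0 ltW//= invf_le1.
by rewrite divr_ge0 ?normc_ge0// ltW.
Qed.

Lemma modular_admissible (f : V -> C) D : 0 < D ->
  (Orlicz_modular alpha psi f D < +oo)%E ->
  exists2 D', 0 < D' & (Orlicz_modular alpha psi f D' <= 1)%E.
Proof.
move=> D0 Doo.
have ca0 := bergman_const_gt0 n_gt0 alpha_gtN1.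
have I0 : (0 <= Orlicz_modular alpha psi f D)%E.
  apply: integral_ge0 => t _; rewrite lee_fin mulr_ge0 ?modular_ge0//.
  by rewrite mulr_ge0 ?bergman_weight_ge0// ltW.
have IE : Orlicz_modular alpha psi f D = (fine (Orlicz_modular alpha psi f D))%:E.
  by rewrite fineK// ge0_fin_numE.
set I := fine _ in IE.
have Ige0 : 0 <= I by rewrite fine_ge0.
exists (D * (I + 1)); first by apply: mulr_gt0 => //; lra.
apply: le_trans (modular_scale _ D0 _) _; first by lra.
by rewrite IE -EFinM lee_fin mulrC ler_pdivrMr; lra.
Qed.

(** By [Orlicz_inv_root], |f| is at most a multiple of D psi^-1((1 - |z|) ^ - e), so
    that psi of the quotient is at most (1 - |z|) ^ - e, which is integrable when
    alpha - e > -1. [modular_scale] brings the modular below 1. *)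
Lemma modular_growth : exists2 K, 1 <= K & forall (f : V -> C) D, 0 < D ->
  (forall z, unit_ball z -> N (f z) <= D * growth z) ->
  (Orlicz_modular alpha psi f (D * K) <= 1)%E.
Proof.
(* Any e with alpha - e > -1 will do. *)
have [e [e0 ae]] : exists e : R, 0 < e /\ -1 < alpha + - e.
  have a1 := alpha_gtN1; exists ((1 + alpha) / 2); split; [lra|].
  by move: a1; lra.
have [K K1 HK] := Orlicz_inv_root Opsi Dpsi e0.
have ca0 := bergman_const_gt0 n_gt0 alpha_gtN1.
have Ioo := bergman_integral_powR_lty n_gt0 alpha_gtN1 ae.
set J := bergman_integral _ _ in Ioo.
have J0 : (0 <= J)%E.
  apply: integral_ge0 => t _; rewrite lee_fin mulr_ge0 ?powR_ge0//.
  by rewrite mulr_ge0 ?bergman_weight_ge0// ltW.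
have JE : J = (fine J)%:E by rewrite fineK// ge0_fin_numE.
have fJ0 : 0 <= fine J by rewrite fine_ge0.
have t0 : 0 < 2 `^ e :> R by exact: powR_gt0.
(* Here 2 ^ e accounts for 1 - |z| ^ 2 <= 2 (1 - |z|). *)
pose L := 2 `^ e * fine J + 1.
have L1 : 1 <= L by rewrite /L lerDr mulr_ge0 // ltW.
exists (K * L).
  by apply: (le_trans K1); apply: ler_peMr => //; lra.
move=> f D D0 fg.
have DK0 : 0 < D * K by apply: mulr_gt0 => //; lra.
rewrite mulrA; apply: le_trans (modular_scale f DK0 L1) _.
have L0 : 0 < L by lra.
suff H : (Orlicz_modular alpha psi f (D * K) <= (2 `^ e * fine J)%:E)%E.
  apply: (@le_trans _ _ (L^-1%:E * (2 `^ e * fine J)%:E)%E).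
    by apply: lee_wpmul2l => //; rewrite lee_fin invr_ge0 ltW.
  by rewrite -EFinM lee_fin mulrC ler_pdivrMr// mul1r /L lerDl.
rewrite EFinM -JE /J /bergman_integral /integral_ball.
apply: le_trans (ge0_integralZl_nonmeasurable_le _ _ _); last 2 first.
- exact: t0.
- move=> t _; rewrite lee_fin mulr_ge0 ?powR_ge0//.
  by rewrite mulr_ge0 ?bergman_weight_ge0// ltW.
apply: ge0_le_integral_nonmeasurable => t tb.
  rewrite lee_fin mulr_ge0 ?modular_ge0// mulr_ge0 ?bergman_weight_ge0//.
  exact: ltW.
rewrite -EFinM lee_fin [leRHS]mulrA; apply: ler_wpM2r.
  by rewrite mulr_ge0 ?bergman_weight_ge0// ltW.
set z := cvec t; have zb : unit_ball z by [].
have z1 : hn z < 1 by [].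
have z0 := hermitian_norm_ge0 z.
have y1 := growth_arg zb.
have yE : 0 <= 1 / (1 - hn z) by lra.
apply: (@le_trans _ _ (psi (inv ((1 / (1 - hn z)) `^ e)))).
  apply: Orlicz_le => //; first by rewrite divr_ge0 ?normc_ge0// ltW.
  rewrite ler_pdivrMr//; apply: le_trans (fg z zb) _.
  rewrite mulrC (mulrC D) mulrA; apply: ler_wpM2r; first exact: ltW.
  by rewrite mulrC; exact: HK.
rewrite Orlicz_invK ?powR_ge0//.
have u0 : 0 < 1 - hn z by lra.
have v0 : 0 < 1 - hn z ^+ 2 by nra.
rewrite div1r -powR_inv1 ?(ltW u0)// -powRrM mulN1r !powRN.
have a0 : 0 < (1 - hn z) `^ e by exact: powR_gt0.
have b0 : 0 < (1 - hn z ^+ 2) `^ e by exact: powR_gt0.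
rewrite ler_pdivlMr// mulrC ler_pdivrMr// -powRM; [|by []|exact: ltW].
apply: ge0_ler_powR; rewrite ?nnegrE; [exact: ltW|exact: ltW| |nra].
by apply: mulr_ge0 => //; exact: ltW.
Qed.

End growth_space.

(** * Composition operators *)

Section composition.
Context (R : realType) (n : nat) (alpha : R) (psi : R -> R).
Hypotheses (n_gt0 : (0 < n)%N) (alpha_gtN1 : -1 < alpha).
Hypotheses (Opsi : Orlicz_function psi) (Dpsi : Delta2_up psi).
Local Notation N := (@Normc.normc R).
Local Notation C := (R[i]^o).
Local Notation V := [the normedModType R[i] of 'rV[R[i]]_n].
Local Notation hn := (@hermitian_norm R n).
Local Notation inv := (Orlicz_inv psi).
Local Notation growth := (@growth R n psi).

(** The polynomial loss in [self_map_boundary_growth] is absorbed by psi^-1. *)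
Lemma growth_self_map (phi : V -> V) : holomorphic_self_map phi ->
  exists2 B, 0 < B & forall z, unit_ball z -> growth (phi z) <= B * growth z.
Proof.
move=> Hphi; have [k [c c0 Hc]] := self_map_boundary_growth Hphi.
have c1 : 0 <= c^-1 by rewrite invr_ge0 ltW.
have [B B1 HB] := Orlicz_inv_poly Opsi Dpsi k c1.
exists B => [|z zb]; first by lra.
have z1 : 0 < 1 - hn z by rewrite subr_gt0; exact: zb.
have pz1 : 0 < 1 - hn (phi z) by rewrite subr_gt0; exact: Hphi.2.
apply: HB; [exact: growth_arg|by rewrite div1r invr_ge0 ltW|].
rewrite !div1r exprVn -invfM lef_pV2 ?posrE ?mulr_gt0 ?exprn_gt0//.
exact: Hc.
Qed.

Lemma holomorphic_comp (phi : V -> V) (f : V -> C) : holomorphic_self_map phi ->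
  holomorphic_on (@unit_ball R n) f ->
  holomorphic_on (@unit_ball R n) (composition_operator phi f).
Proof.
move=> [dphi bphi] df z zb; apply: differentiable_comp; first exact: dphi.
by apply: df; exact: bphi.
Qed.

Lemma Luxemburg_norm_le (f : V -> C) D : 0 < D ->
  (Orlicz_modular alpha psi f D <= 1)%E -> (Luxemburg_norm alpha psi f <= D%:E)%E.
Proof. by move=> D0 H; apply: ereal_inf_lbound; exists D. Qed.

(** If D is admissible for f, then |f| <= K D w by [point_evaluation], hence
    |f o phi| <= K B D w, and [modular_growth] makes a multiple of B D admissible
    for f o phi. *)
Lemma composition_bound : exists2 K, 0 < K & forall (phi : V -> V) (B : R),
  holomorphic_self_map phi -> 0 < B ->
  (forall z, unit_ball z -> growth (phi z) <= B * growth z) ->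
  forall f : V -> C, Bergman_Orlicz alpha psi f ->
   Bergman_Orlicz alpha psi (composition_operator phi f) /\
   (Luxemburg_norm alpha psi (composition_operator phi f) <=
     (K * B)%:E * Luxemburg_norm alpha psi f)%E.
Proof.
have [K K1 HK] := point_evaluation n_gt0 alpha_gtN1 Opsi Dpsi.
have [L L1 HL] := modular_growth n_gt0 alpha_gtN1 Opsi Dpsi.
have KL0 : 0 < K * L by apply: mulr_gt0; lra.
exists (K * L) => // phi B Hphi B0 HB f [hf [D0 D00 fD0]].
have c0 : 0 < K * L * B by exact: mulr_gt0.
have adm D : 0 < D -> (Orlicz_modular alpha psi f D <= 1)%E ->
    (Orlicz_modular alpha psi (composition_operator phi f) (K * L * B * D) <= 1)%E.
  move=> Dp fD.
  have -> : K * L * B * D = D * K * B * L by ring.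
  apply: HL; first by do 2 (apply: mulr_gt0 => //); lra.
  move=> z zb; apply: le_trans (HK _ _ _ hf Dp fD (Hphi.2 z zb)) _.
  have DK : 0 <= D * K by apply: mulr_ge0; lra.
  by rewrite -[leRHS]mulrA; apply: ler_wpM2l => //; exact: HB.
split.
  split; first exact: holomorphic_comp.
  have [D Dp fD] := modular_admissible n_gt0 alpha_gtN1 Opsi D00 fD0.
  exists (K * L * B * D); first exact: mulr_gt0.
  by apply: le_lt_trans (adm _ Dp fD) (ltry _).
rewrite -lee_pdivrMl//; apply: le_ereal_inf_tmp => _ [D [Dp fD] <-].
rewrite lee_pdivrMl// -EFinM; apply: Luxemburg_norm_le; first exact: mulr_gt0.
exact: adm.
Qed.

(** A multiple of the kernel 1 / (1 - <z, a>) that satisfies |f| <= w with equality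
    at z = a up to a factor 2. It depends on psi through a constant only. *)
Definition kernel_test (a z : V) : C :=
  (growth a * (1 - hn a))%:C / (1 - \sum_k z ord0 k * conjc (a ord0 k)).

Lemma kernel_denominator (a z : V) :
  1 - hn z * hn a <= N (1 - \sum_k z ord0 k * conjc (a ord0 k)).
Proof.
set s := \sum_k _.
have h1 : N (1 : R[i]) <= N (1 - s) + N s by apply: le_trans (le_normcD _ _); rewrite subrK.
have h2 := hermitian_norm_inner z a.
rewrite [N 1]Normc.normc1 in h1; rewrite -/s in h2; lra.
Qed.

(** With t = (1 - |a|) / |1 - <z, a>| in [0, 1], convexity gives
    psi(t w(a)) <= t psi(w(a)) = 1 / |1 - <z, a>| <= 1 / (1 - |z|) = psi(w(z)). *)
Lemma kernel_test_le (a z : V) : unit_ball a -> unit_ball z ->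
  N (kernel_test a z) <= growth z.
Proof.
move=> ab zb.
have a1 : hn a < 1 by []. have z1 : hn z < 1 by [].
have a0 := hermitian_norm_ge0 a; have z0 := hermitian_norm_ge0 z.
have ga := growth_gt0 Opsi ab.
have den := kernel_denominator a z.
rewrite /kernel_test; set q : R[i] := (X in _ <= N X) in den *.
have za : hn z * hn a <= hn a by apply: ler_piMl => //; exact: ltW.
have za' : hn z * hn a <= hn z by apply: ler_piMr => //; exact: ltW.
have q0 : 0 < N q by lra.
rewrite Normc.normcM Normc.normcV normc_real ger0_norm; last first.
  by rewrite mulr_ge0// ?(ltW ga)//; lra.
pose t := (1 - hn a) / N q.
have t01 : 0 <= t <= 1.
  by rewrite /t divr_ge0/= ?normc_ge0 ?ler_pdivrMr//; lra.
rewrite -mulrA -/t mulrC.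
have yz : 0 <= 1 / (1 - hn z) by apply: divr_ge0; lra.
rewrite leNgt; apply/negP => H.
have gz := growth_gt0 Opsi zb.
have := Orlicz_lt Opsi (ltW gz) H.
apply/negP; rewrite -leNgt; apply: le_trans (Orlicz_scale Opsi t01 (ltW ga)) _.
rewrite /growth !Orlicz_invK//; last by apply: divr_ge0; lra.
rewrite /t !div1r mulrAC divff ?mul1r; last by lra.
rewrite lef_pV2 ?posrE//; lra.
Qed.

Lemma kernel_test_diag (a : V) : unit_ball a -> growth a / 2 <= N (kernel_test a a).
Proof.
move=> ab; have a1 : hn a < 1 by [].
have a0 := hermitian_norm_ge0 a.
have ga := growth_gt0 Opsi ab.
rewrite /kernel_test.
have -> : \sum_k a ord0 k * conjc (a ord0 k) = (hn a ^+ 2)%:C.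
  rewrite sqr_hermitian_norm rmorph_sum; apply: eq_bigr => k _.
  case: (a ord0 k) => x y; rewrite sqr_normc_complex.
  by apply/eqP; rewrite eq_complex /=; apply/andP; split; apply/eqP; ring.
have -> : 1 - (hn a ^+ 2)%:C = (1 - hn a ^+ 2)%:C :> R[i] by rewrite rmorphB rmorph1.
rewrite Normc.normcM Normc.normcV !normc_real.
have d0 : 0 < 1 - hn a ^+ 2 by nra.
rewrite !ger0_norm; [|exact: ltW|by rewrite mulr_ge0 ?(ltW ga)//; lra].
rewrite ler_pdivlMr// mulrAC ler_pdivrMr//.
rewrite -!mulrA; apply: ler_wpM2l; first exact: ltW.
nra.
Qed.

Lemma holomorphic_kernel_test (a : V) : unit_ball a ->
  holomorphic_on (@unit_ball R n) (kernel_test a).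
Proof.
move=> ab z zb.
have a1 : hn a < 1 by []. have z1 : hn z < 1 by [].
have a0 := hermitian_norm_ge0 a; have z0 := hermitian_norm_ge0 z.
have den := kernel_denominator a z.
have za : hn z * hn a <= hn a by apply: ler_piMl => //; exact: ltW.
have dinner : differentiable (fun x : V => \sum_k x ord0 k * conjc (a ord0 k) : C) z.
  exact: (@differentiable_inner _ _ id a z).
have -> : kernel_test a = (cst ((growth a * (1 - hn a))%:C : C)) *
   (fun z => ((cst 1 - (fun x : V => \sum_k x ord0 k * conjc (a ord0 k) : C) : V -> C) z)^-1 : C).
  by apply/funext.
apply: differentiableM; first exact: differentiable_cst.
apply: differentiableV.
  by apply: differentiableB => //; exact: differentiable_cst.
rewrite -[X in X != 0]/(1 - \sum_k z ord0 k * conjc (a ord0 k)) -normc_gt0; lra.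
Qed.

(** Take for f the kernel at a = phi(z), scaled into the unit ball of the space.
    Then f o phi has size w(a) at z, up to a constant, whereas [point_evaluation]
    allows it to be at most a multiple of w(z) times its norm. *)
Lemma composition_lower_bound : exists2 K, 0 < K & forall (phi : V -> V) z,
  holomorphic_self_map phi -> unit_ball z ->
  ((growth (phi z) / growth z)%:E <=
     K%:E * operator_norm alpha psi (composition_operator phi))%E.
Proof.
have [K K1 HK] := point_evaluation n_gt0 alpha_gtN1 Opsi Dpsi.
have [L L1 HL] := modular_growth n_gt0 alpha_gtN1 Opsi Dpsi.
have L0 : 0 < L by lra.
have LK0 : 0 < 2 * L * K by apply: mulr_gt0; lra.
exists (2 * L * K) => // phi z Hphi zb.
have [dphi bphi] := Hphi.
set a := phi z; have ab : unit_ball a by exact: bphi.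
pose f : V -> C := fun x => (L^-1)%:C * kernel_test a x.
have Nf x : N (f x) = N (kernel_test a x) / L.
  by rewrite /f Normc.normcM normc_real ger0_norm ?invr_ge0 ?ltW// mulrC.
have hf : holomorphic_on (@unit_ball R n) f.
  move=> x xb; have -> : f = (cst ((L^-1)%:C : C)) * kernel_test a by apply/funext.
  apply: differentiableM; first exact: differentiable_cst.
  exact: holomorphic_kernel_test.
have f1 : (Orlicz_modular alpha psi f 1 <= 1)%E.
  have Linv : 0 < L^-1 by rewrite invr_gt0.
  rewrite -[X in Orlicz_modular _ _ _ X](mulVf (lt0r_neq0 L0)).
  apply: HL => // x xb; rewrite Nf mulrC; apply: ler_wpM2l; first exact: ltW.
  exact: kernel_test_le.
have Lf : (Luxemburg_norm alpha psi (composition_operator phi f) <=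
    operator_norm alpha psi (composition_operator phi))%E.
  apply: ereal_sup_ubound; exists f => //; split.
    by split => //; exists 1 => //; exact: le_lt_trans f1 (ltry _).
  exact: Luxemburg_norm_le.
apply: le_trans (lee_wpmul2l _ Lf); last by rewrite lee_fin ltW.
rewrite -lee_pdivrMl//; apply: le_ereal_inf_tmp => _ [D [Dp fD] <-].
rewrite lee_pdivrMl// -EFinM lee_fin.
have gz := growth_gt0 Opsi zb.
rewrite ler_pdivrMr//.
have := HK _ _ _ (holomorphic_comp Hphi hf) Dp fD zb.
rewrite /composition_operator/= -/a Nf ler_pdivrMr// => H.
have := kernel_test_diag ab; rewrite -/a => H2.
have -> : 2 * L * K * D * growth z = 2 * (D * K * growth z * L) by ring.
rewrite -/(growth z) in H.
by move: (D * K * growth z * L) H => X H; lra.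
Qed.

End composition.

Section comparison.
Context (R : realType).

Lemma ereal_sup_comparison (X : Type) (A : set X) (F G : X -> R) c : 0 <= c ->
  (forall z, A z -> F z <= c * G z) ->
  (ereal_sup [set (F z)%:E | z in A] <= c%:E * ereal_sup [set (G z)%:E | z in A])%E.
Proof.
move=> c0 FG; apply: ge_ereal_sup => _ [z Az <-].
apply: (@le_trans _ _ (c%:E * (G z)%:E)%E).
  by rewrite -EFinM lee_fin; exact: FG.
apply: lee_wpmul2l; first by rewrite lee_fin.
by apply: ereal_sup_ubound; exists z.
Qed.

End comparison.

(** * The norm estimates *)

Lemma ler_ratio_comparable (F : realFieldType) (Q g w g' w' : F) :
  0 < g -> 0 < g' -> g <= w <= Q * g -> g' <= w' <= Q * g' ->
  w' / w <= Q * (g' / g) /\ g' / g <= Q * (w' / w).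
Proof.
move=> g0 g0' /andP[gw wg] /andP[gw' wg'].
have w0 : 0 < w := lt_le_trans g0 gw.
have w0' : 0 < w' := lt_le_trans g0' gw'.
split; rewrite ler_pdivrMr//.
  apply: (le_trans wg').
  rewrite (_ : Q * (g' / g) * w = Q * g' * (w / g)); last by ring.
  rewrite ler_peMr//; last by rewrite ler_pdivlMr// mul1r.
  exact: le_trans (ltW w0') wg'.
apply: (le_trans gw').
rewrite (_ : Q * (w' / w) * g = w' * (Q * g / w)); last by ring.
by rewrite ler_peMr ?(ltW w0')// ler_pdivlMr// mul1r.
Qed.

Section main_estimates.
Context (R : realType) (n : nat) (alpha : R) (psi : R -> R).
Hypotheses (n_gt0 : (0 < n)%N) (alpha_gtN1 : -1 < alpha).
Hypotheses (Opsi : Orlicz_function psi) (Dpsi : Delta2_up psi).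
Local Notation V := [the normedModType R[i] of 'rV[R[i]]_n].
Local Notation hn := (@hermitian_norm R n).
Local Notation inv := (Orlicz_inv psi).
Local Notation growth := (@growth R n psi).

(** A power p >= 1 of 1 / (1 - |z|) is at least 1 / (1 - |z|) and at most an
    integral power of it. *)
Lemma growth_power (p : R) : 1 <= p -> exists2 K, 1 <= K &
  forall z : V, unit_ball z ->
    growth z <= inv (1 / (1 - hn z) `^ p) <= K * growth z.
Proof.
move=> p1; pose m := (Num.truncn p).+1.
have pm : p <= m%:R by apply: ltW; exact: truncnS_gt.
have [K K1 HK] := Orlicz_inv_poly Opsi Dpsi m ler01.
exists K => // z zb.
have u0 : 0 < 1 - hn z by rewrite subr_gt0; exact: zb.
have y1 := growth_arg zb.
have yE : 1 / (1 - hn z) `^ p = (1 / (1 - hn z)) `^ p.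
  by rewrite !div1r -[in RHS]powR_inv1 ?(ltW u0)// -powRrM mulN1r powRN.
rewrite yE; apply/andP; split.
  apply: Orlicz_inv_le => //; first by lra.
  exact: le1r_powR.
apply: HK => //; first exact: powR_ge0.
have := ler_powR y1 pm; rewrite powR_mulrn; last by lra.
by rewrite [X in _ -> (_ <= X)]mul1r.
Qed.

(** The supremum of the quotients is a positive real number, and as such a legitimate
    constant B in [composition_bound]. *)
Lemma growth_sup_fin (phi : V -> V) : holomorphic_self_map phi ->
  exists2 B, 0 < B &
    (ereal_sup [set (growth (phi z) / growth z)%:E | z in @unit_ball R n] = B%:E)%E /\
    forall z, unit_ball z -> growth (phi z) <= B * growth z.
Proof.
move=> Hphi; have [B0 B00 HB0] := growth_self_map Opsi Dpsi Hphi.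
have zero_ball : unit_ball (0 : V) by rewrite /unit_ball/= hermitian_norm0.
set S := [set _ | _ in _].
have Sle : (ereal_sup S <= B0%:E)%E.
  apply: ge_ereal_sup => _ [z zb <-]; rewrite lee_fin ler_pdivrMr; last exact: growth_gt0.
  exact: HB0.
have Sge : ((growth (phi 0) / growth 0)%:E <= ereal_sup S)%E.
  by apply: ereal_sup_ubound; exists 0.
have q0 : 0 < growth (phi 0) / growth 0.
  by apply: divr_gt0; apply: growth_gt0 => //; exact: Hphi.2.
have SE : ereal_sup S = (fine (ereal_sup S))%:E.
  rewrite fineK// fin_real// (lt_le_trans _ Sge) ?ltNyr//=.
  exact: le_lt_trans Sle (ltry _).
exists (fine (ereal_sup S)).
  by rewrite -lte_fin -SE; apply: lt_le_trans Sge; rewrite lte_fin.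
split=> // z zb; rewrite -ler_pdivrMr; last exact: growth_gt0.
by rewrite -lee_fin -SE; apply: ereal_sup_ubound; exists z.
Qed.

End main_estimates.

Theorem corollary3p8 (R : realType) (N : nat) (alpha : R) (psi : R -> R)
    (N_gt0 : (0 < N)%N) (alpha_gtN1 : -1 < alpha)
    (psi_Orlicz : Orlicz_function psi) (psi_Delta2 : Delta2_up psi) :
  (forall phi : 'rV[R[i]]_N -> 'rV[R[i]]_N, holomorphic_self_map phi ->
     bounded_operator alpha psi (composition_operator phi)) /\
  comparable_on [set phi : 'rV[R[i]]_N -> 'rV[R[i]]_N | holomorphic_self_map phi]
    (fun phi => operator_norm alpha psi (composition_operator phi))
    (fun phi => ereal_sup
       [set (Orlicz_inv psi
               (1 / (1 - hermitian_norm (phi z)) `^ (N%:R + alpha + 1)) /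
             Orlicz_inv psi
               (1 / (1 - hermitian_norm z) `^ (N%:R + alpha + 1)))%:E
       | z in @unit_ball R N]) /\
  comparable_on [set phi : 'rV[R[i]]_N -> 'rV[R[i]]_N | holomorphic_self_map phi]
    (fun phi => ereal_sup
       [set (Orlicz_inv psi
               (1 / (1 - hermitian_norm (phi z)) `^ (N%:R + alpha + 1)) /
             Orlicz_inv psi
               (1 / (1 - hermitian_norm z) `^ (N%:R + alpha + 1)))%:E
       | z in @unit_ball R N])
    (fun phi => ereal_sup
       [set (Orlicz_inv psi (1 / (1 - hermitian_norm (phi z))) /
             Orlicz_inv psi (1 / (1 - hermitian_norm z)))%:E
       | z in @unit_ball R N]).
Proof.
have [K K0 HK] := composition_bound N_gt0 alpha_gtN1 psi_Orlicz psi_Delta2.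
have [L L0 HL] := composition_lower_bound N_gt0 alpha_gtN1 psi_Orlicz psi_Delta2.
set p := N%:R + alpha + 1.
have p1 : 1 <= p.
  have : 1 <= N%:R :> R by rewrite ler1n.
  by move: alpha_gtN1; rewrite /p; lra.
have [Q Q1 HQ] := growth_power N psi_Orlicz psi_Delta2 p1.
have Q0 : 0 < Q by lra.
pose wp (z : 'rV[R[i]]_N) := Orlicz_inv psi (1 / (1 - hermitian_norm z) `^ p).
pose M1 (phi : 'rV[R[i]]_N -> 'rV[R[i]]_N) := ereal_sup
  [set (growth psi (phi z) / growth psi z)%:E | z in @unit_ball R N].
pose Mp (phi : 'rV[R[i]]_N -> 'rV[R[i]]_N) := ereal_sup
  [set (wp (phi z) / wp z)%:E | z in @unit_ball R N].
have pointwise (phi : 'rV[R[i]]_N -> 'rV[R[i]]_N) z : holomorphic_self_map phi ->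
    unit_ball z ->
    wp (phi z) / wp z <= Q * (growth psi (phi z) / growth psi z) /\
    growth psi (phi z) / growth psi z <= Q * (wp (phi z) / wp z).
  move=> [_ bphi] zb; have pzb := bphi z zb.
  have := ler_ratio_comparable (growth_gt0 psi_Orlicz zb) (growth_gt0 psi_Orlicz pzb).
  by apply; exact: HQ.
have MpM1 phi : holomorphic_self_map phi -> (Mp phi <= Q%:E * M1 phi)%E.
  move=> Hphi; apply: ereal_sup_comparison; first exact: ltW.
  by move=> z zb; exact: (pointwise phi z Hphi zb).1.
have M1Mp phi : holomorphic_self_map phi -> (M1 phi <= Q%:E * Mp phi)%E.
  move=> Hphi; apply: ereal_sup_comparison; first exact: ltW.
  by move=> z zb; exact: (pointwise phi z Hphi zb).2.
split; [|split].
- move=> phi Hphi; have [B B0 [_ HB]] := growth_sup_fin psi_Orlicz psi_Delta2 Hphi.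
  by exists (K * B) => f; exact: HK.
- exists (Q * L)^-1, (K * Q); split; [by rewrite invr_gt0 mulr_gt0|exact: mulr_gt0|].
  move=> phi Hphi; split.
    rewrite lee_pdivrMl; last exact: mulr_gt0.
    apply: le_trans (MpM1 phi Hphi) _; rewrite EFinM -muleA.
    apply: lee_wpmul2l; first by rewrite lee_fin ltW.
    by apply: ge_ereal_sup => _ [z zb <-]; exact: HL.
  have [B B0 [ME HB]] := growth_sup_fin psi_Orlicz psi_Delta2 Hphi.
  apply: (@le_trans _ _ (K%:E * M1 phi)%E); last first.
    rewrite EFinM -muleA; apply: lee_wpmul2l; first by rewrite lee_fin ltW.
    exact: M1Mp.
  rewrite /M1 ME -EFinM.
  apply: ge_ereal_sup => _ [f [hf f1] <-].
  apply: le_trans (HK phi B Hphi B0 HB f hf).2 _.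
  rewrite -[leRHS]mule1; apply: lee_wpmul2l => //.
  by rewrite lee_fin ltW// mulr_gt0.
- exists Q^-1, Q; split; [by rewrite invr_gt0|by []|].
  move=> phi Hphi; split; last exact: MpM1.
  by rewrite lee_pdivrMl//; exact: M1Mp.
Qed.
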